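(* Let $d\ge1$ be an integer. The probability measures $$\mu_k^z=\frac1{\Pi_{h_0^{kd}}(z,z)}\sum_{\alpha\in kdP\cap\mathbb Z^m}\frac{|s_\alpha(z)|^2_{h_0^{kd}}}{Q_{h_0^{kd}}(\alpha)}\,\delta_{\frac{\alpha}{kd}},\qquad z\in M,$$ satisfy a Laplace large deviations principle on $P$, uniformly on $M$, with speed $kd$ and with convex rate functions $I^z\ge0$ on $P$ defined as follows: (i) If $z=e^{\rho/2+i\theta}\in M^o$, then $I^z(x)=u_0(x)-\langle x,\rho\rangle+\varphi_{P^o}(z)$ for $x\in P$. (ii) If $z\in\mu_0^{-1}(F^o)$ for some face $F$ of $\partial P$, then $I^z(x)=u_F(x)-\langle x'',\rho''\rangle+\varphi_F(z)$ for $x\in F$, where $\rho''$ are the logarithmic orbit coordinates of $z$ along $F$, and $I^z(x)=+\infty$ for $x\in P\setminus F$. (iii) If $z$ is a fixed point of the torus action and $v=\mu_0(z)$ is the corresponding vertex, then $I^z(v)=0$ and $I^z(x)=+\infty$ for $x\neq v$.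
   Context: Toric setup. $M$ is a smooth projective toric manifold of dimension $m$: $(\mathbb C^* )^m$ acts holomorphically with an open orbit $M^o\cong(\mathbb C^* )^m$; $\mathbf T^m=(S^1)^m$. $P\subset\mathbb R^m$ is a Delzant lattice polytope with $0\in P\subset[0,\infty)^m$, and $L\to M$ is the corresponding very ample toric line bundle. For each $N\ge1$, $H^0(M,L^N)$ has the basis of monomial sections $s_\alpha$, $\alpha\in NP\cap\mathbb Z^m$, with $s_\alpha=z^\alpha e^{\otimes N}$ on $M^o$, where $e$ is a $\mathbf T^m$-invariant nowhere vanishing holomorphic frame of $L$ over $M^o$. $h_0$ is a smooth $\mathbf T^m$-invariant Hermitian metric on $L$ with positive curvature form $\omega_0=-i\partial\bar\partial\log|e|^2_{h_0}$. Put $Q_{h_0^N}(\alpha)=\int_M|s_\alpha|^2_{h_0^N}\,\omega_0^m/m!$ and $\Pi_{h_0^N}(z,z)=\sum_{\alpha}|s_\alpha(z)|^2_{h_0^N}/Q_{h_0^N}(\alpha)$. On $M^o$ write $z=e^{\rho/2+i\theta}$, i.e. $\rho_j=\log|z_j|^2$. The open-orbit Kähler potential is $\varphi_{P^o}=-\log|e|^2_{h_0}$, a strictly convex function of $\rho\in\mathbb R^m$; the moment map $\mu_0:M\to P$ is $\nabla_\rho\varphi_{P^o}$ on $M^o$, extended continuously to $M$; the symplectic potential is $u_0(x)=\sup_{\rho\in\mathbb R^m}(\langle x,\rho\rangle-\varphi_{P^o}(\rho))$, $x\in P$. Faces. Let $F$ be a closed face of $P$ of dimension $n$ with relative interior $F^o$.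 Choose a vertex $w$ of $F$; let $w^1,\dots,w^m$ be the $\mathbb Z$-basis of primitive edge vectors of $P$ at $w$, ordered so that $w^1,\dots,w^n$ are parallel to $F$. Write $x\in F$ as $x=w+\sum_{j\le n}x''_jw^j$. The orbit $\mu_0^{-1}(F^o)\cong(\mathbb C^* )^n$ has coordinates $\eta_j$ (the extension of $z^{w^j}$), $j\le n$, and $\rho''_j=\log|\eta_j|^2$. Put $\varphi_F=-\log|s_w|^2_{h_0}$ on this orbit ($s_w\in H^0(M,L)$), a function of $\rho''\in\mathbb R^n$, and $u_F(x)=\sup_{\rho''\in\mathbb R^n}(\langle x'',\rho''\rangle-\varphi_F(\rho''))$ for $x\in F$. Uniform Laplace principle. For $h\in C(P)$ put $F(z,h)=-\inf_{x\in P}(h(x)+I^z(x))$. The family $\{\mu_k^z\}$ satisfies the Laplace principle on $P$ with speed $a_k$ and rate functions $I^z$ uniformly on $M$ if: (1) for every $c\in\mathbb R$, $\bigcup_{z\in M}(I^z)^{-1}[0,c]$ is compact; (2) for every $h\in C(P)$, $\limsup_{k\to\infty}\sup_{z\in M}\big(\frac1{a_k}\log\int_Pe^{-a_kh}d\mu_k^z-F(z,h)\big)\le0$; (3) for every $h\in C(P)$, $\liminf_{k\to\infty}\inf_{z\in M}\big(\frac1{a_k}\log\int_Pe^{-a_kh}d\mu_k^z-F(z,h)\big)\ge0$. Rate functions take values in $[0,\infty]$ and are lower semicontinuous. *)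

(* Defs.v *)
(* MathComp-Analysis, over an arbitrary [R : realType]; complex numbers are
   [R[i]] from mathcomp-real-closed. *)
From HB Require Import structures.
From mathcomp Require Import all_boot all_order all_algebra.
From mathcomp Require Import complex.
From mathcomp Require Import all_classical all_reals all_analysis.

Set Implicit Arguments.
Unset Strict Implicit.
Unset Printing Implicit Defensive.

Import Order.TTheory GRing.Theory Num.Theory.
Import numFieldNormedType.Exports.

Local Open Scope classical_set_scope.
Local Open Scope ring_scope.

(** * Polytopes *)

Section Polytopes.
Variables (R : realType) (m : nat).
Implicit Types (P F : set 'rV[R]_m) (x y : 'rV[R]_m).

Definition dotp x y : R := \sum_(j < m) x 0 j * y 0 j.

Definition toR (a : 'rV[int]_m) : 'rV[R]_m := map_mx intr a.

Definition conv_hull (s : seq 'rV[int]_m) : set 'rV[R]_m :=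
  [set x | exists t : 'I_(size s) -> R,
    [/\ forall i, 0 <= t i, \sum_i t i = 1
      & x = \sum_i t i *: toR (nth 0 s i)]].

Definition aff_hull F : set 'rV[R]_m :=
  [set x | exists n (p : 'I_n -> 'rV[R]_m) (t : 'I_n -> R),
    [/\ forall i, F (p i), \sum_i t i = 1 & x = \sum_i t i *: p i]].

Definition rel_interior F : set 'rV[R]_m :=
  [set x | F x /\
    exists2 e, 0 < e & forall y, aff_hull F y -> `|y - x| < e -> F y].

(* Nonempty closed faces; [P] itself is the face cut out by [l = 0]. *)
Definition is_face P F : Prop :=
  F !=set0 /\ exists l : 'rV[R]_m,
    F = [set x | P x /\ forall y, P y -> dotp l y <= dotp l x].

Definition is_vertex P (v : 'rV[int]_m) : Prop := is_face P [set toR v].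

Definition primitive (w : 'rV[int]_m) : Prop :=
  forall (k : int) u, w = k *: u -> k \is a GRing.unit.

Definition edge_vector P (v w : 'rV[int]_m) : Prop :=
  primitive w /\
  exists2 l : R, 0 < l &
    is_face P [set toR v + s *: toR w | s in `[0, l]%classic].

End Polytopes.
Arguments conv_hull R {m} s.

(* A Delzant lattice polytope [P] with [0 \in P] and [P] inside the closed
   positive orthant.  [verts] lists the vertices; for a vertex [v] the rows of
   [edges v] are the primitive edge vectors at [v] (in an arbitrary order), and
   they form a Z-basis of the lattice. *)
Record delzant (R : realType) (m : nat) := Delzant {
  verts : seq 'rV[int]_m;
  edges : 'rV[int]_m -> 'M[int]_m;
  verts_uniq : uniq verts;
  verts_vertex : forall v, v \in verts -> is_vertex (conv_hull R verts) v;
  edges_unimodular : forall v, v \in verts -> edges v \in unitmx;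
  edgesP : forall v, v \in verts -> forall w,
    edge_vector (conv_hull R verts) v w <-> exists j, w = row j (edges v);
  polytope0 : conv_hull R verts 0;
  polytope_ge0 : forall x, conv_hull R verts x -> forall j, 0 <= x 0 j
}.

Definition polytope (R : realType) (m : nat) (P : delzant R m) :
  set 'rV[R]_m := conv_hull R (verts P).

Lemma verts0 (R : realType) (m : nat) (P : delzant R m) : 0 \in verts P.
Proof.
have [t [t0 t1 E]] := polytope0 P.
have [i ti] : exists i, 0 < t i.
  apply/existsP; apply: contra_eqT t1 => /existsPn H.
  rewrite big1 ?(eq_sym 0) ?oner_eq0// => i _; apply/eqP.
  by rewrite eq_le t0 andbT leNgt H.
suff <- : nth 0 (verts P) i = 0 by rewrite mem_nth.
have vge0 k j : 0 <= toR R (nth 0 (verts P) k) 0 j.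
  have [ks|ks] := ltnP k (size (verts P)); last first.
    by rewrite nth_default// mxE mxE.
  apply: (@polytope_ge0 _ _ P); exists (fun l => (l == Ordinal ks)%:R).
  split; first by move=> l; rewrite ler0n.
    by rewrite (bigD1 (Ordinal ks))//= eqxx big1 ?addr0// => l /negbTE->.
  rewrite (bigD1 (Ordinal ks))//= eqxx scale1r big1 ?addr0// => l /negbTE->.
  by rewrite scale0r.
apply/rowP => j; apply/eqP; rewrite !mxE -(intr_eq0 R).
have /rowP/(_ j)/esym/eqP := E; rewrite !mxE summxE psumr_eq0 => [/allP|k _].
  move=> /(_ i (mem_index_enum _)); rewrite /= !mxE mulf_eq0.
  by rewrite (gt_eqF ti).
by rewrite mxE mulr_ge0.
Qed.

(* [R^m] with its Borel sigma-algebra *)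
Definition borel_rV (R : realType) (m : nat) :=
  g_sigma_algebraType (@open 'rV[R]_m).

(** * The toric manifold of a Delzant polytope *)

Section Toric.
Variables (R : realType) (m : nat) (P : delzant R m).

Let C := R[i].

Definition vertex := seq_sub (verts P).

Definition vertex0 : vertex := SeqSub (verts0 P).

(* [N P] intersected with the lattice *)
Definition lattice_points (N : nat) : set 'rV[int]_m :=
  [set a | exists2 x, polytope P x & toR R a = N%:R *: x].

Definition normsq (c : C) : R := complex.Re c ^+ 2 + complex.Im c ^+ 2.

Definition monomial (z : 'rV[C]_m) (a : 'rV[int]_m) : C :=
  \prod_(j < m) z 0 j ^ a 0 j.

(* Coordinates of a lattice vector, resp. a real vector, in the basis of
   primitive edge vectors at [v]. *)
Definition edge_coord (v : vertex) (a : 'rV[int]_m) : 'rV[int]_m :=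
  a *m invmx (edges P (val v)).

Definition edge_coordR (v : vertex) (x : 'rV[R]_m) : 'rV[R]_m :=
  x *m invmx (map_mx intr (edges P (val v))).

(* [M] is the union of the images of the affine charts [C^m], one per vertex
   [v], in the projective space with homogeneous coordinates indexed by the
   lattice points of [P] (the embedding by the very ample bundle [L]).  In the
   chart of [v], with coordinates [eta_j = z^{w^j}], the monomial section [s_a]
   divided by [s_v] is [eta^(edge_coord v (a - v))]; these ratios are the
   homogeneous coordinates.  A projective point is a punctured line. *)
Definition hcoord (v : vertex) (eta : 'rV[C]_m) (a : 'rV[int]_m) : C :=
  if `[< lattice_points 1 a >] then monomial eta (edge_coord v (a - val v))
  else 0.

Definition punctured_line (Z : 'rV[int]_m -> C) : set ('rV[int]_m -> C) :=
  [set fun a => c * Z a | c in [set c : C | c != 0]].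

Record toric := Toric {
  proj_point : set ('rV[int]_m -> C);
  proj_pointP : exists p : vertex * 'rV[C]_m,
    proj_point = punctured_line (hcoord p.1 p.2)
}.

Definition chart (v : vertex) (eta : 'rV[C]_m) : toric :=
  Toric (ex_intro (fun p : vertex * 'rV[C]_m =>
    punctured_line (hcoord v eta) = punctured_line (hcoord p.1 p.2))
    (v, eta) erefl).

(* some chart coordinates of a point *)
Definition coords (z : toric) : vertex * 'rV[C]_m :=
  projT1 (cid (proj_pointP z)).

(* The action of the torus in the chart of [v], and on [M]. *)
Definition act_chart (v : vertex) (t eta : 'rV[C]_m) : 'rV[C]_m :=
  \row_j (monomial t (row j (edges P (val v))) * eta 0 j).

Definition act (t : 'rV[C]_m) (z : toric) : toric :=
  let: (v, eta) := coords z in chart v (act_chart v t eta).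

Definition torus_fixed (z : toric) : Prop :=
  forall t : 'rV[C]_m, (forall j, t 0 j != 0) -> act t z = z.

(* The open orbit: [z] in [(C^* )^m] has coordinates [z^{w^j}] in the chart of
   the vertex [0]. *)
Definition torus_point (z : 'rV[C]_m) : toric :=
  chart vertex0 (\row_j monomial z (row j (edges P 0))).

(* [e^(rho/2 + i theta)] *)
Definition exp_coord (rho theta : 'rV[R]_m) : 'rV[C]_m :=
  \row_j ((expR (rho 0 j / 2) * cos (theta 0 j))
          +i* (expR (rho 0 j / 2) * sin (theta 0 j)))%C.

(** ** Complex analysis in a chart *)

Definition cplx (p : 'rV[R]_m * 'rV[R]_m) : 'rV[C]_m :=
  \row_j (p.1 0 j +i* p.2 0 j)%C.

Definition smooth (V : normedModType R) (f : V -> R^o) : Prop :=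
  forall s : seq V,
    let g := foldr (fun v g x => 'D_v g x) f s in
    continuous g /\ forall x v, derivable g x v.

Definition dRe (j : 'I_m) (f : 'rV[R]_m * 'rV[R]_m -> R^o) :
    'rV[R]_m * 'rV[R]_m -> R^o :=
  fun p => 'D_(delta_mx 0 j, 0) f p.
Definition dIm (j : 'I_m) (f : 'rV[R]_m * 'rV[R]_m -> R^o) :
    'rV[R]_m * 'rV[R]_m -> R^o :=
  fun p => 'D_(0, delta_mx 0 j) f p.

(* The complex Hessian: entry [(j, k)] is
   [d^2 f / (d eta_j d (conj eta_k))], i.e.
   [(dRe_j - i dIm_j) (dRe_k + i dIm_k) f / 4]. *)
Definition levi (f : 'rV[R]_m * 'rV[R]_m -> R^o) (p : 'rV[R]_m * 'rV[R]_m) :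
    'M[C]_m :=
  \matrix_(j, k)
    (((dRe j (dRe k f) p + dIm j (dIm k f) p) / 4)
     +i* ((dRe j (dIm k f) p - dIm j (dRe k f) p) / 4))%C.

Definition posdef (A : 'M[C]_m) : Prop :=
  forall c : 'rV[C]_m, c != 0 ->
    0 < \sum_j \sum_k c 0 j * (c 0 k)^*%C * A j k.

(* Iterated Lebesgue integral over [R^n]; for a nonnegative Borel function it
   is the integral against Lebesgue measure, by Tonelli. *)
Fixpoint lebesgue_int (n : nat) : ('rV[R]_n -> \bar R) -> \bar R :=
  match n with
  | 0 => fun f => f 0
  | n'.+1 => fun f => (\int[lebesgue_measure]_(t in setT)
      lebesgue_int (fun x : 'rV[R]_n' => f (row_mx (t%:M : 'rV[R]_1) x)))%E
  end.

Definition lebesgue_intC (f : 'rV[R]_m * 'rV[R]_m -> \bar R) : \bar R :=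
  lebesgue_int (fun x => lebesgue_int (fun y => f (x, y))).

(** ** Invariant positively curved Hermitian metrics on [L] *)

(* [L] is trivialised over the chart of [v] by the section [s_v], and the
   metric is given by the functions [weight v = |s_v|^2]; on overlaps
   [s_v = (s_v / s_v') s_v'].  The curvature form [-i ddbar log (weight v)]
   is positive exactly when the complex Hessian below is positive definite. *)
Record metric := Metric {
  weight : vertex -> 'rV[C]_m -> R;
  weight_gt0 : forall v eta, 0 < weight v eta;
  weight_smooth : forall v, smooth (weight v \o cplx : _ -> R^o);
  weight_glue : forall v v' eta eta', chart v eta = chart v' eta' ->
    weight v eta =
      normsq (monomial eta' (edge_coord v' (val v - val v'))) * weight v' eta';
  weight_invariant : forall v (t eta : 'rV[C]_m),
    (forall j, normsq (t 0 j) = 1) ->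
    weight v (act_chart v t eta) = weight v eta;
  weight_curv : forall v p,
    posdef (levi (fun q => - ln (weight v (cplx q))) p)
}.

Variable h0 : metric.

(* [|s_a(z)|^2] for the metric [h0^N]: in the chart of [v],
   [s_a = eta^(edge_coord v (a - N v)) s_v^N]. *)
Definition section_normsq (N : nat) (a : 'rV[int]_m) (z : toric) : R :=
  let: (v, eta) := coords z in
  normsq (monomial eta (edge_coord v (a - val v *+ N))) * weight h0 v eta ^+ N.

(* The density of [omega_0^m / m!] in the chart of [v] with respect to Lebesgue
   measure: [omega_0 = i sum g_jk d eta_j /\ d (conj eta_k)] and
   [i d eta_j /\ d (conj eta_j) = 2 dx_j /\ dy_j]. *)
Definition vol_density (v : vertex) (p : 'rV[R]_m * 'rV[R]_m) : R :=
  2 ^+ m * complex.Re (\det (levi (fun q => - ln (weight h0 v (cplx q))) p)).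

(* A partition of [M] into Borel pieces, each inside one chart: a point belongs
   to the piece of the first vertex [v] for which [|s_v|] is maximal.  The
   integral of a form over [M] is the sum of its chart integrals over the
   pieces of any such partition. *)
Definition piece (v : vertex) : set 'rV[C]_m :=
  [set eta | forall v' : vertex,
    let r := normsq (monomial eta (edge_coord v (val v' - val v))) in
    if (index (val v') (verts P) < index (val v) (verts P))%N
    then r < 1 else r <= 1].

Definition integral_M (f : toric -> R) : \bar R :=
  (\sum_(v : vertex)
    lebesgue_intC (fun p =>
      (f (chart v (cplx p)) * vol_density v p * \1_(piece v) (cplx p))%:E))%E.

Definition Qnorm (N : nat) (a : 'rV[int]_m) : R :=
  fine (integral_M (section_normsq N a)).

Definition szego (N : nat) (z : toric) : R :=
  \sum_(a \in lattice_points N) (section_normsq N a z / Qnorm N a).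

(* [phi_{P^o} = - log |e|^2] on the open orbit, where [e = s_0]. *)
Definition phi_open (z : toric) : R := - ln (section_normsq 1 0 z).

Definition phi_rho (rho : 'rV[R]_m) : R :=
  phi_open (torus_point (exp_coord rho 0)).

(* The moment map: [grad_rho phi_{P^o}] on the open orbit, extended
   continuously to [M], which carries the topology glued from the charts. *)
Definition is_moment_map (mu0 : toric -> 'rV[R]_m) : Prop :=
  (forall v : vertex, continuous (fun p : 'rV[R]_m * 'rV[R]_m =>
     mu0 (chart v (cplx p)))) /\
  forall (rho theta : 'rV[R]_m) j,
    mu0 (torus_point (exp_coord rho theta)) 0 j
      = 'D_(delta_mx 0 j) (phi_rho : _ -> R^o) rho.

Definition symp_pot (x : 'rV[R]_m) : \bar R :=
  ereal_sup [set (dotp x rho - phi_rho rho)%:E | rho in [set: 'rV[R]_m]].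

(* [mu] is [szego^-1 sum_a (|s_a(z)|^2 / Q(a)) delta_(a / N)]. *)
Definition is_mu (N : nat) (z : toric) (mu : set 'rV[R]_m -> \bar R) : Prop :=
  forall A, measurable (A : set (borel_rV R m)) ->
    mu A = ((szego N z)^-1%:E * \sum_(a \in lattice_points N)
             (section_normsq N a z / Qnorm N a)%:E
             * \d_(N%:R^-1 *: toR R a : borel_rV R m) A)%E.

(** ** Faces *)

Section Face.
Variables (F : set 'rV[R]_m) (w : vertex).

(* the indices of the edge vectors at [w] that are parallel to [F] *)
Definition face_dirs : pred 'I_m :=
  fun j => `[< aff_hull F (toR R (val w + row j (edges P (val w)))) >].

(* [phi_F = - log |s_w|^2] *)
Definition phi_face (z : toric) : R := - ln (section_normsq 1 (val w) z).

(* The point of the orbit of [F] with [|eta_j|^2 = e^{rho_j}] for the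
   directions [j] of [F]; only these components of [rho] are used, so [rho]
   stands for a vector of [R^n], [n] the dimension of [F]. *)
Definition face_point (rho : 'rV[R]_m) : toric :=
  chart w (\row_j (if face_dirs j then (expR (rho 0 j / 2))%:C%C else 0)).

Definition face_dotp (x rho : 'rV[R]_m) : R :=
  \sum_(j < m | face_dirs j) edge_coordR w (x - toR R (val w)) 0 j * rho 0 j.

Definition symp_pot_face (x : 'rV[R]_m) : \bar R :=
  ereal_sup [set (face_dotp x rho - phi_face (face_point rho))%:E
            | rho in [set: 'rV[R]_m]].

End Face.

(** ** The rate functions *)

Definition rate_open (I : toric -> 'rV[R]_m -> \bar R) : Prop :=
  forall (rho theta x : 'rV[R]_m), polytope P x ->
    let z := torus_point (exp_coord rho theta) in
    I z x = (symp_pot x - (dotp x rho)%:E + (phi_open z)%:E)%E.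

Definition rate_face (mu0 : toric -> 'rV[R]_m)
    (I : toric -> 'rV[R]_m -> \bar R) : Prop :=
  forall (F : set 'rV[R]_m) (w : vertex) (z : toric),
    is_face (polytope P) F -> F <> polytope P -> F (toR R (val w)) ->
    rel_interior F (mu0 z) ->
    exists eta : 'rV[C]_m,
      [/\ z = chart w eta,
          forall j, (eta 0 j != 0) = face_dirs F w j,
          forall x, F x ->
            I z x = (symp_pot_face F w x
                     - (face_dotp F w x (\row_j ln (normsq (eta 0 j))))%:E
                     + (phi_face w z)%:E)%E
        & forall x, polytope P x -> ~ F x -> I z x = +oo%E].

Definition rate_fixed (mu0 : toric -> 'rV[R]_m)
    (I : toric -> 'rV[R]_m -> \bar R) : Prop :=
  forall z, torus_fixed z ->
    [/\ exists2 v, v \in verts P & mu0 z = toR R v,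
        I z (mu0 z) = 0%E
      & forall x, polytope P x -> x <> mu0 z -> I z x = +oo%E].

End Toric.

(** * Uniform Laplace principle *)

Section Laplace.
Variables (R : realType) (m : nat).

Variables (M : Type) (P : set 'rV[R]_m).

Definition rate_function (I : 'rV[R]_m -> \bar R) : Prop :=
  (forall x, P x -> (0 <= I x)%E) /\
  lower_semicontinuous (I : subspace P -> \bar R).

Definition convex_on (I : 'rV[R]_m -> \bar R) : Prop :=
  forall x y (t : R), P x -> P y -> 0 <= t <= 1 ->
    (I (t *: x + (1 - t) *: y)%R <= t%:E * I x + (1 - t)%:E * I y)%E.

Variables (mu : nat -> M -> probability (borel_rV R m) R) (a : nat -> R).
Variable I : M -> 'rV[R]_m -> \bar R.

Definition laplace_F (z : M) (h : 'rV[R]_m -> R) : \bar R :=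
  (- ereal_inf [set (h x)%:E + I z x | x in P])%E.

Definition laplace_gap (h : 'rV[R]_m -> R) (k : nat) (z : M) : \bar R :=
  ((a k)^-1%:E * lne (\int[mu k z]_(x in P) (expR (- a k * h x))%:E)
   - laplace_F z h)%E.

Definition uniform_laplace : Prop :=
  [/\ forall c : R,
        compact [set x | P x /\ exists z : M, (0 <= I z x <= c%:E)%E],
      forall h : 'rV[R]_m -> R, {within P, continuous h} ->
        (limn_esup (fun k => ereal_sup [set laplace_gap h k z | z in setT])
           <= 0)%E
    & forall h : 'rV[R]_m -> R, {within P, continuous h} ->
        (0 <=
         limn_einf (fun k => ereal_inf [set laplace_gap h k z | z in setT]))%E].

End Laplace.

(* Main.v *)
(* In the chart of a vertex, [|s_a|^(2/N)] only depends on [x = a / N], and its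
   formula defines a function [sec h0 z x] of all real [x] in [P], with
   [ln (sec h0 z x)] affine in [x] where it is finite.  Its supremum over [z] is
   [exp (symp_pot x)], and the rate function is [symp_pot x - ln (sec h0 z x)];
   it vanishes at the moment map image of [z].

   [Qnorm N a] is [exp (N symp_pot (a / N))] up to a factor [e^(N e)]: the upper
   bound is immediate, and for the lower bound the integrand is nearly maximal
   on a cube whose size is uniform in [a / N], by compactness of [P].  As [N P]
   has polynomially many lattice points, the Laplace principle follows once every
   [x] in [P] is within [O(1/N)] of some [a / N] with [sec z (a / N) >= sec z x];
   log-affinity provides it, as [x] is a convex combination of such points.  All
   the bounds are uniform in [z].

   For the faces: positivity of the curvature makes [- ln sec] strictly convex
   along one-parameter subgroups, which forces the orbit of [z] to correspond
   to the face containing [mu0 z] in its relative interior. *)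
Require Import Defs.
From HB Require Import structures.
From mathcomp Require Import all_boot all_order all_algebra.
From mathcomp Require Import complex.
From mathcomp Require Import all_classical all_reals all_analysis.
From mathcomp Require Import measurable_realfun ring lra.

Set Implicit Arguments.
Unset Strict Implicit.
Unset Printing Implicit Defensive.

Import Order.TTheory GRing.Theory Num.Theory.
Import numFieldNormedType.Exports.

Local Open Scope classical_set_scope.
Local Open Scope ring_scope.

(** * Second derivatives along exponential curves *)

(** The metric is given only by its chart functions, and their smoothness only by directional
    derivatives. The differential calculus is therefore reduced to functions of one real variable:
    by torus invariance the complex Hessian, evaluated on a real vector, is a positive multiple of
    the second derivative along a real one-parameter subgroup, so that positive curvature becomes
    convexity along such curves. [toric] carries no topology; the compactness of [M] is replaced by
    that of the closed unit polydiscs, which cover it. [delzant] names the edges at a vertex but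
    does not say that they span the cone of [P] there. This is extracted from the faces in
    [edge_cone]; it makes the exponents of all sections nonnegative, hence their norms meaningful on
    the boundary orbits. There [0 ^ 0 = 1], and the norms are only upper semicontinuous jointly in
    the point and the weight. That is the direction that suprema over compact sets require. The
    moment map provides, for every [z], a point where the rate vanishes; so the normalising sums are
    positive and the infima finite. *)

Section ChainRule.
Variable R : realType.

Lemma is_derive_line (V : normedModType R) (f : V -> R^o) (x v : V) (t : R) :
  derivable f (x + t *: v) v ->
  is_derive t 1 (fun s : R => f (x + s *: v) : R^o) ('D_v f (x + t *: v)).
Proof.
move=> df.
have E : (fun h : R => h^-1 *: (((fun s : R => f (x + s *: v) : R^o) \o shift t) (h *: (1:R^o)) - f (x + t *: v))) =
  (fun h => h^-1 *: ((f \o shift (x + t *: v)) (h *: v) - f (x + t *: v))).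
  apply/funext => h /=; rewrite /shift /=; congr (_ *: (f _ - _)).
  have -> : h *: (1 : R^o) = h by rewrite /GRing.scale/= mulr1.
  by rewrite scalerDl addrCA.
by apply: DeriveDef; rewrite /derivable /derive /= E.
Qed.

Lemma line_increment (V : normedModType R) (f : V -> R^o) (y v : V) (h c e : R) :
  (forall x, derivable f x v) ->
  (forall s, `|s| <= `|h| -> `|'D_v f (y + s *: v) - c| <= e) ->
  `|f (y + h *: v) - f y - h * c| <= e * `|h|.
Proof.
move=> df H.
pose g (s : R) : R^o := f (y + s *: (h *: v)).
have dg (t : R) : is_derive t (1 : R^o) g (h * 'D_v f (y + t *: (h *: v))).
  have := @is_derive_line _ f y v (t * h).
  move/(_ (df _)) => d1.
  have -> : g = (fun s : R => f (y + s *: v) : R^o) \o (fun s : R => s * h).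
    by apply/funext => s; rewrite /g /= scalerA.
  rewrite scalerA mulrC; apply: is_derive1_comp => //.
  apply: is_derive_eq; rewrite /GRing.scale/=.
  by rewrite mulr0 mulr1 add0r.
have [||c0 /andP[c0a c0b] E] := @MVT_segment R g (fun t => h * 'D_v f (y + t *: (h *: v))) 0 1.
- exact: ler01.
- apply: derivable_within_continuous => t _.
  by have [] := dg t.
move: E; rewrite /g scale1r scale0r addr0 subr0 mulr1 => ->.
rewrite -mulrBr normrM mulrC ler_wpM2r// scalerA H// normrM.
by rewrite -[leRHS]mul1r ler_wpM2r// ger0_norm.
Qed.

(** The increments along the [b i] are added one at a time, and the mean value theorem bounds each
    error by the oscillation of the corresponding directional derivative near [x0]. No Frechet
    differentiability is assumed. *)
Lemma C1_increment (V : normedModType R) (f : V -> R^o) n (b : 'I_n -> V) (x0 : V) :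
  (forall i x, derivable f x (b i)) ->
  (forall i, {for x0, continuous ('D_(b i) f)}) ->
  forall e, 0 < e -> exists2 d, 0 < d & forall y (h : 'I_n -> R),
    `|y - x0| < d -> (forall i, `|h i| < d) ->
    `|f (y + \sum_i h i *: b i) - f y - \sum_i h i * 'D_(b i) f x0|
      <= e * \sum_i `|h i|.
Proof.
elim: n b => [|n IH] b df cf e e0.
  exists 1 => // y h _ _.
  by rewrite !big_ord0 addr0 subrr subr0 normr0 mulr0.
have [||d1 d10 H1] := IH (fun i => b (widen_ord (leqnSn n) i)) _ _ _ e0.
- by move=> i x; exact: df.
- by move=> i; exact: cf.
have [d2 /= d20 H2] : exists2 d, 0 < d & forall z, `|z - x0| < d ->
    `|'D_(b ord_max) f z - 'D_(b ord_max) f x0| <= e.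
  have /cvgrPdist_le/(_ _ e0) := cf ord_max.
  move=> /nbhs_ballP[d /= d0 H]; exists d => // z zx.
  by rewrite distrC; apply: H; rewrite -ball_normE /= distrC.
pose B := \sum_i `|b i|.
have B0 : 0 <= B by exact: sumr_ge0.
(* With [|y - x0|] and all [|h i|] below [d2 / (2 + B)], the points visited along the last direction
   stay within [d2 (1 + B) / (2 + B) < d2] of [x0]. *)
exists (Num.min d1 (d2 / (2 + B))) => [|y h].
  by rewrite lt_min d10 divr_gt0// ltr_wpDr.
rewrite lt_min => /andP[y1 y2] hd.
have hd1 i : `|h i| < d1 by have := hd i; rewrite lt_min => /andP[].
have hd2 i : `|h i| < d2 / (2 + B) by have := hd i; rewrite lt_min => /andP[].
rewrite !big_ord_recr /= addrA.
set y' := y + _.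
have {}H1 := H1 y (fun i => h (widen_ord (leqnSn n) i)) y1 (fun i => hd1 _).
have : `|f (y' + h ord_max *: b ord_max) - f y' - h ord_max * 'D_(b ord_max) f x0|
    <= e * `|h ord_max|.
  apply: line_increment => [x|s sh]; first exact: df.
  apply: H2.
  have -> : y' + s *: b ord_max - x0 = (y - x0) +
      (\sum_(i < n) h (widen_ord (leqnSn n) i) *: b (widen_ord (leqnSn n) i)
       + s *: b ord_max) by rewrite /y' addrAC -!addrA; congr (_ + _); rewrite addrCA addrC -addrA.
  pose D := d2 / (2 + B).
  apply: (@le_lt_trans _ _ (D + D * B)).
    apply: (le_trans (ler_normD _ _)); apply: lerD; first exact: ltW.
    apply: (le_trans (ler_normD _ _)).
    have -> : B = \sum_(i < n) `|b (widen_ord (leqnSn n) i)| + `|b ord_max|.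
      by rewrite /B big_ord_recr.
    rewrite mulrDr; apply: lerD.
      apply: (le_trans (ler_norm_sum _ _ _)).
      rewrite mulr_sumr; apply: ler_sum => i _; rewrite normrZ.
      by apply: ler_wpM2r => //; exact: (ltW (hd2 _)).
    rewrite normrZ; apply: ler_wpM2r => //.
    by apply: (le_trans sh); exact: (ltW (hd2 _)).
  rewrite -[X in X + _]mulr1 -mulrDr /D mulrAC ltr_pdivrMr ?ltr_wpDr//.
  by rewrite ltr_pM2l// ltrD2r ltr1n.
move=> H3; rewrite mulrDr.
have -> : f (y' + h ord_max *: b ord_max) - f y -
   (\sum_(i < n) h (widen_ord (leqnSn n) i) * 'D_(b (widen_ord (leqnSn n) i)) f x0
     + h ord_max * 'D_(b ord_max) f x0) =
   (f y' - f y - \sum_(i < n) h (widen_ord (leqnSn n) i) * 'D_(b (widen_ord (leqnSn n) i)) f x0)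
   + (f (y' + h ord_max *: b ord_max) - f y' - h ord_max * 'D_(b ord_max) f x0).
  by ring.
by apply: (le_trans (ler_normD _ _)); apply: lerD.
Qed.

Lemma is_derive_curve (V : normedModType R) (f : V -> R^o) n (b : 'I_n -> V)
    (a a' : 'I_n -> R -> R) (t0 : R) :
  (forall i x, derivable f x (b i)) ->
  (forall i, continuous ('D_(b i) f)) ->
  (forall i, is_derive t0 (1:R) (a i : R -> R^o) (a' i t0)) ->
  is_derive t0 (1:R) (fun t => f (\sum_i a i t *: b i) : R^o)
    (\sum_i a' i t0 * 'D_(b i) f (\sum_i a i t0 *: b i)).
Proof.
move=> df cf da.
set x0 := \sum_i a i t0 *: b i.
set L := \sum_i _.
pose q i (h : R) := h^-1 * (a i (h + t0) - a i t0).
have qa i : q i @ 0^' --> a' i t0.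
  have [d1 <-] := da i.
  rewrite /derive /=.
  have -> : q i = (fun h : R => h^-1 *: ((a i \o shift t0) (h *: (1:R^o)) - a i t0)).
    by apply/funext => h /=; rewrite /q /shift /GRing.scale /= mulr1.
  exact: d1.
have ca i : {for t0, continuous (a i)}.
  have [d1 _] := da i.
  by apply: differentiable_continuous; apply/derivable1_diffP.
pose F (t : R) : R^o := f (\sum_i a i t *: b i).
have E : (fun h : R => h^-1 *: ((F \o shift t0) (h *: (1:R^o)) - F t0))
   = (fun h : R => h^-1 * (F (h + t0) - F t0)).
  by apply/funext => h /=; rewrite /shift /GRing.scale /= mulr1.
suff H : (fun h : R => h^-1 * (F (h + t0) - F t0)) @ 0^' --> L.
  split; first by apply/cvg_ex; exists L; rewrite /= E.
  rewrite /derive E; exact/cvg_lim.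
have sumq : (fun h => \sum_i q i h * 'D_(b i) f x0) @ 0^' --> L.
  apply: cvg_big => [|i _]; [exact: add_continuous|]; apply: cvgM; first exact: qa.
  exact: cvg_cst.
have sumnq : (fun h => \sum_i `|q i h|) @ 0^' --> \sum_i `|a' i t0|.
  apply: cvg_big => [|i _]; [exact: add_continuous|]; apply: cvg_norm; exact: qa.
apply/cvgrPdist_le => e e0.
(* [A] bounds the sum of the difference quotients near [t0], so that an expansion error with factor
   [e / 2 / A] costs at most [e / 2]. *)
pose A : R := \sum_i `|a' i t0| + 1.
have A0 : 0 < A by rewrite ltr_wpDl// sumr_ge0.
have e1 : 0 < e / 2 / A by rewrite !divr_gt0.
have [d d0 H] := @C1_increment V f n b x0 df (fun i => cf i x0) _ e1.
have nq : \forall h \near 0^', \sum_i `|q i h| <= A.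
  have /cvgrPdist_le/(_ _ ltr01) := sumnq.
  apply: filterS => h; rewrite /A => /ler_normlP[]; rewrite opprB lerBlDl => /le_trans H' _.
  by apply: H'; rewrite addrC.
have na : \forall h \near 0^', forall i, `|a i (h + t0) - a i t0| < d.
  apply: filter_forall => i.
  have /cvgrPdist_lt/(_ _ d0) := ca i.
  move=> /nbhs_ballP[r /= r0 Hr].
  near=> h; rewrite distrC; apply: Hr; rewrite -ball_normE/= opprD addrCA subrr addr0 normrN.
  by near: h; exact: dnbhs0_lt.
have nh : \forall h \near (0:R)^', h != 0 by exact: nbhs_dnbhs_neq.
have /cvgrPdist_le/(_ (e/2)) := sumq.
rewrite divr_gt0// => /(_ isT) n3.
near=> h.
have h0 : h != 0 by near: h.
have := H x0 (fun i => a i (h + t0) - a i t0).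
rewrite subrr normr0 => /(_ d0) => /(_ _)/wrap[|]; first by near: h.
have -> : x0 + \sum_i (a i (h + t0) - a i t0) *: b i = \sum_i a i (h + t0) *: b i.
  by rewrite -big_split /=; apply: eq_bigr => i _; rewrite -scalerDl addrC subrK.
rewrite -/(F (h + t0)) -[f x0]/(F t0) => H1.
have H2 : `|h^-1 * (F (h + t0) - F t0) - \sum_i q i h * 'D_(b i) f x0| <= e / 2.
  have -> : h^-1 * (F (h + t0) - F t0) - \sum_i q i h * 'D_(b i) f x0 =
    h^-1 * (F (h + t0) - F t0 - \sum_i (a i (h + t0) - a i t0) * 'D_(b i) f x0).
    rewrite [RHS]mulrBr mulr_sumr; congr (_ - _); apply: eq_bigr => i _.
    by rewrite /q mulrA.
  rewrite normrM.
  apply: (le_trans (ler_wpM2l _ H1)) => //.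
  have -> : `|h^-1| * (e / 2 / A * \sum_i `|a i (h + t0) - a i t0|) =
     e / 2 / A * \sum_i `|q i h|.
    rewrite mulrCA mulr_sumr; congr (_ * _); apply: eq_bigr => i _.
    by rewrite /q normrM.
  rewrite -mulrA ger_pMr ?divr_gt0// mulrC ler_pdivrMr// mul1r.
  by near: h.
have H3 : `|L - \sum_i q i h * 'D_(b i) f x0| <= e / 2 by near: h.
rewrite (splitr e).
have -> : L - h^-1 * (F (h + t0) - F t0) = (L - \sum_i q i h * 'D_(b i) f x0)
  - (h^-1 * (F (h + t0) - F t0) - \sum_i q i h * 'D_(b i) f x0) by ring.
by apply: (le_trans (ler_normB _ _)); apply: lerD.
Unshelve. all: by end_near. Qed.

End ChainRule.

(** * Complex Hessian and real one-parameter subgroups *)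

Section Plurisubharmonic.
Variables (R : realType) (m : nat).
Local Notation V := ('rV[R]_m * 'rV[R]_m)%type.

Definition C1 (f : V -> R^o) :=
  forall v, (forall x, derivable f x v) /\ continuous ('D_v f).

Definition C2 (f : V -> R^o) := C1 f /\ forall v, C1 ('D_v f).

Lemma is_derive_lineP (W : normedModType R) (f : W -> R^o) (x v : W) (d : R) :
  is_derive x v f d <-> is_derive (0:R) (1 : R) (fun h : R => f (x + h *: v) : R^o) d.
Proof.
have E : (fun h : R => h^-1 *: ((f \o shift x) (h *: v) - f x)) =
 (fun h : R => h^-1 *: (((fun h : R => f (x + h *: v) : R^o) \o shift 0) (h *: (1:R^o)) - f (x + 0 *: v))).
  apply/funext => h /=; rewrite scale0r addr0 /shift /= addr0.
  have -> : h *: (1 : R^o) = h by rewrite /GRing.scale/= mulr1.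
  by rewrite [h *: v + x]addrC.
split => -[]; rewrite /derivable /derive => d1 d2.
  by apply: DeriveDef; rewrite /derivable /derive -E.
by apply: DeriveDef; rewrite /derivable /derive E.
Qed.

Lemma is_derive_compR (W : normedModType R) (f : W -> R^o) (g : R -> R^o) (x v : W) (a b : R) :
  is_derive (f x : R) (1:R) g a -> is_derive x v f b -> is_derive x v (g \o f) (a * b).
Proof.
move=> dg /is_derive_lineP df; apply/is_derive_lineP.
have E : (fun h : R => (g \o f) (x + h *: v) : R^o) = g \o (fun h => f (x + h *: v)) by [].
rewrite E; apply: is_derive1_comp => //.
by rewrite scale0r addr0.
Qed.

Lemma is_derive_add (f g : R -> R^o) (t a b : R) :
  is_derive t (1:R) f a -> is_derive t (1:R) g b ->
  is_derive t (1:R) (fun s => f s + g s : R^o) (a + b).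
Proof. by move=> df dg; have := is_deriveD df dg. Qed.

Lemma is_derive_mul (W : normedModType R) (f g : W -> R^o) (t v : W) (a b : R) :
  is_derive t v f a -> is_derive t v g b ->
  is_derive t v (fun s => f s * g s : R^o) (a * g t + f t * b).
Proof.
move=> df dg; have := is_deriveM df dg.
by rewrite /GRing.scale /= addrC [g t * a]mulrC.
Qed.

Lemma is_derive_sumf n (h : 'I_n -> R -> R^o) (d : 'I_n -> R) (t : R) :
  (forall i, is_derive t (1:R) (h i) (d i)) ->
  is_derive t (1:R) (fun s => \sum_i h i s : R^o) (\sum_i d i).
Proof.
move=> dh; have -> : (fun s => \sum_i h i s : R^o) = \sum_i h i.
  by apply/funext => s; rewrite fct_sumE.
exact: is_derive_sum.
Qed.

Lemma is_derive_curve2 (f : V -> R^o) (a1 a2 a1' a2' : 'I_m -> R -> R) (t : R) :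
  C1 f ->
  (forall i, is_derive t (1:R) (a1 i : R -> R^o) (a1' i t)) ->
  (forall i, is_derive t (1:R) (a2 i : R -> R^o) (a2' i t)) ->
  is_derive t (1:R) (fun t => f (\row_j a1 j t, \row_j a2 j t) : R^o)
   (\sum_j a1' j t * dRe j f (\row_j a1 j t, \row_j a2 j t) +
    \sum_j a2' j t * dIm j f (\row_j a1 j t, \row_j a2 j t)).
Proof.
move=> Cf d1 d2.
pose b (i : 'I_(m + m)) : V := match fintype.split i with
  inl j => (delta_mx 0 j, 0) | inr j => (0, delta_mx 0 j) end.
pose a (i : 'I_(m + m)) : R -> R := match fintype.split i with inl j => a1 j | inr j => a2 j end.
pose a' (i : 'I_(m + m)) : R -> R := match fintype.split i with inl j => a1' j | inr j => a2' j end.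
have sl j : fintype.split (lshift m j) = inl j :> 'I_m + 'I_m by rewrite -[lshift m j]/(fintype.unsplit (inl j)) fintype.unsplitK.
have sr j : fintype.split (rshift m j) = inr j :> 'I_m + 'I_m by rewrite -[rshift m j]/(fintype.unsplit (inr j)) fintype.unsplitK.
have E s : (\row_j a1 j s, \row_j a2 j s) = \sum_i a i s *: b i :> V.
  rewrite big_split_ord /=.
  under eq_bigr do rewrite /a /b sl.
  under [X in _ + X]eq_bigr do rewrite /a /b sr.
  have S1 (F : 'I_m -> V) : \sum_i F i = (\sum_i (F i).1, \sum_i (F i).2).
    apply: (big_rec3 (fun x y z => x = (z, y))) => // i x y z _ ->; by case: (F i).
  rewrite !S1 /=; congr pair; apply/rowP => k; rewrite !mxE !summxE.
    rewrite (bigD1 k)//= !mxE !eqxx mulr1 big1 ?big1 ?addr0// => i.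
      by rewrite !mxE mulr0.
    by move=> ik; rewrite !mxE eqxx/= eq_sym (negbTE ik) mulr0.
  rewrite addrC (bigD1 k)//= !mxE !eqxx mulr1 big1 ?big1 ?addr0// => i.
    by rewrite !mxE mulr0.
  by move=> ik; rewrite !mxE eqxx/= eq_sym (negbTE ik) mulr0.
have -> : (fun t => f (\row_j a1 j t, \row_j a2 j t) : R^o) = (fun t => f (\sum_i a i t *: b i) : R^o).
  by apply/funext => s; rewrite E.
rewrite E.
have -> : \sum_j a1' j t * dRe j f (\sum_i a i t *: b i) +
    \sum_j a2' j t * dIm j f (\sum_i a i t *: b i) =
   \sum_i a' i t * 'D_(b i) f (\sum_i a i t *: b i).
  have sp (G : 'I_(m + m) -> R) :
    \sum_i G i = \sum_i G (lshift m i) + \sum_i G (rshift m i) by exact: big_split_ord.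
  rewrite (sp (fun i => a' i t * 'D_(b i) f (\sum_i a i t *: b i))); congr (_ + _); apply: eq_bigr => i _.
    by rewrite /a' sl; have -> : b (lshift m i) = (delta_mx 0 i, 0) by rewrite /b sl.
  by rewrite /a' sr; have -> : b (rshift m i) = (0, delta_mx 0 i) by rewrite /b sr.
apply: is_derive_curve.
- by move=> i x; have [H _] := Cf (b i); exact: H.
- by move=> i; have [_ H] := Cf (b i).
- by move=> i; rewrite /a /a'; case: (fintype.split i).
Qed.

Variable f : V -> R^o.
Hypothesis Cf : C2 f.
Hypothesis f_rot : forall (r c : 'rV[R]_m) (t : R),
  f (\row_j (r 0 j * cos (c 0 j * t)), \row_j (r 0 j * sin (c 0 j * t))) = f (r, 0).

(** The orbit of a real point under positive real torus elements. The imaginary part is [\row_j 0]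
    rather than [0] to match the curves of [is_derive_curve2]. *)
Let rad (r c : 'rV[R]_m) (t : R) : V := (\row_j (r 0 j * expR (c 0 j * t)), \row_j 0).

Definition rad_d1 (r c : 'rV[R]_m) (t : R) : R :=
  \sum_j (c 0 j * (r 0 j * expR (c 0 j * t))) * dRe j f (rad r c t).

(* By [rot_identity] this value of the complex Hessian of [f] is also the second
   derivative of [f] along [rad]; it is positive for plurisubharmonic [f]. *)
Definition rad_d2 (r c : 'rV[R]_m) (t : R) : R :=
  \sum_j \sum_k (c 0 j * (r 0 j * expR (c 0 j * t))) * (c 0 k * (r 0 k * expR (c 0 k * t)))
   * (dRe k (dRe j f) (rad r c t) + dIm k (dIm j f) (rad r c t)).

Let d_exp (a b t : R) : is_derive t (1:R) (fun s : R => a * expR (b * s) : R^o) (b * (a * expR (b * t))).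
Proof.
apply: is_derive_eq; rewrite /GRing.scale /=.
by ring.
Qed.
Let d_cos (a b t : R) : is_derive t (1:R) (fun s : R => a * cos (b * s) : R^o) (- (b * a * sin (b * t))).
Proof.
apply: is_derive_eq; rewrite /GRing.scale /=.
by ring.
Qed.
Let d_sin (a b t : R) : is_derive t (1:R) (fun s : R => a * sin (b * s) : R^o) (b * a * cos (b * t)).
Proof.
apply: is_derive_eq; rewrite /GRing.scale /=.
by ring.
Qed.

Lemma rad_derive1 (r c : 'rV[R]_m) (t : R) :
  is_derive t (1:R) (fun s => f (rad r c s) : R^o) (rad_d1 r c t).
Proof.
have [C _] := Cf.
have := @is_derive_curve2 f (fun j s => r 0 j * expR (c 0 j * s)) (fun _ _ => 0)
  (fun j s => c 0 j * (r 0 j * expR (c 0 j * s))) (fun _ _ => 0) t C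
  (fun i => d_exp _ _ _) _.
move=> /(_ (fun i => is_derive_cst _ _ _)).
rewrite [X in _ + X]big1 ?addr0// => i _; by rewrite mul0r.
Qed.

(* The second derivative at [t = 0] of the constant function
   [t |-> f (e^(i c t) r)]. *)
Lemma rot_identity (r c : 'rV[R]_m) :
  \sum_j \sum_k (c 0 j * r 0 j) * (c 0 k * r 0 k) * dIm k (dIm j f) (r, 0)
  = \sum_j c 0 j ^+ 2 * r 0 j * dRe j f (r, 0).
Proof.
have [C CC] := Cf.
pose rot (t : R) : V := (\row_j (r 0 j * cos (c 0 j * t)), \row_j (r 0 j * sin (c 0 j * t))).
have rot0 : rot 0 = (r, 0).
  by congr pair; apply/rowP => j; rewrite !mxE mulr0 ?cos0 ?sin0 ?mulr1 ?mulr0.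
pose k1 (t : R) : R := \sum_j - (c 0 j * r 0 j * sin (c 0 j * t)) * dRe j f (rot t) +
    \sum_j c 0 j * r 0 j * cos (c 0 j * t) * dIm j f (rot t).
have dr (g : V -> R^o) t : C1 g -> is_derive t (1:R) (fun s => g (rot s) : R^o)
   (\sum_j - (c 0 j * r 0 j * sin (c 0 j * t)) * dRe j g (rot t) +
    \sum_j c 0 j * r 0 j * cos (c 0 j * t) * dIm j g (rot t)).
  move=> Cg.
  exact: (@is_derive_curve2 g (fun j s => r 0 j * cos (c 0 j * s)) (fun j s => r 0 j * sin (c 0 j * s))
    (fun j s => - (c 0 j * r 0 j * sin (c 0 j * s))) (fun j s => c 0 j * r 0 j * cos (c 0 j * s)) t Cg
    (fun i => d_cos _ _ _) (fun i => d_sin _ _ _)).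
(* [k1] is the first derivative of [f] along [rot], where [f] is constant; so its own derivative at
   [0], computed termwise below, vanishes as well. *)
have k10 : k1 = cst 0.
  apply/funext => t; rewrite /k1; have [_ <-] := dr f t C.
  have -> : (fun s => f (rot s) : R^o) = cst (f (r, 0)) by apply/funext => s; exact: f_rot.
  by rewrite derive_cst.
have : is_derive (0:R) (1:R) (k1 : R -> R^o)
  (\sum_j - (c 0 j ^+ 2 * r 0 j * dRe j f (r, 0)) +
   \sum_j \sum_k (c 0 j * r 0 j) * (c 0 k * r 0 k) * dIm k (dIm j f) (r, 0)).
  apply: is_derive_add; apply: is_derive_sumf => j.
    have d1 := dr (dRe j f) 0 (CC _).
    have d2 : is_derive (0:R) (1:R) (fun t : R => - (c 0 j * r 0 j * sin (c 0 j * t)) : R^o) (- (c 0 j ^+ 2 * r 0 j)).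
      have d0 := d_sin (- (c 0 j * r 0 j)) (c 0 j) 0.
      under eq_fun do rewrite -mulNr.
      apply: is_derive_eq d0 _; rewrite mulr0 cos0; ring.
    apply: is_derive_eq (is_derive_mul d2 d1) _.
    by rewrite mulr0 sin0 mulr0 oppr0 mul0r addr0 rot0 mulNr.
  have d1 := dr (dIm j f) 0 (CC _).
  have d2 := d_cos (c 0 j * r 0 j) (c 0 j) 0.
  apply: is_derive_eq (is_derive_mul d2 d1) _.
  rewrite [X in _ * (X + _)]big1; last by move=> k _; rewrite mulr0 sin0 mulr0 oppr0 mul0r.
  rewrite add0r mulr0 sin0 mulr0 oppr0 mul0r add0r cos0 mulr1 rot0 mulr_sumr.
  by apply: eq_bigr => k _; rewrite mulr0 cos0 mulr1 !mulrA.
rewrite k10 => -[_]; rewrite derive_cst sumrN => /esym/eqP.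
by rewrite addrC subr_eq0 => /eqP.
Qed.

(** Differentiating twice gives the terms in [dRe k (dRe j f)] and first-order terms from the second
    derivatives of the exponentials; [rot_identity] at the point [rad r c t] turns the latter into
    the [dIm k (dIm j f)] terms of the complex Hessian. *)
Lemma rad_derive2 (r c : 'rV[R]_m) (t : R) :
  is_derive t (1:R) (rad_d1 r c : R -> R^o) (rad_d2 r c t).
Proof.
have [C CC] := Cf.
have -> : rad_d2 r c t = \sum_j (c 0 j * (c 0 j * (r 0 j * expR (c 0 j * t))) * dRe j f (rad r c t)
  + c 0 j * (r 0 j * expR (c 0 j * t)) * (\sum_k (c 0 k * (r 0 k * expR (c 0 k * t))) * dRe k (dRe j f) (rad r c t))).
  have := rot_identity (rad r c t).1 c.
  have -> : ((rad r c t).1, 0) = rad r c t by congr pair; apply/rowP => j; rewrite !mxE.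
  move=> H; rewrite big_split /=.
  have -> : \sum_(i < m) c 0 i * (c 0 i * (r 0 i * expR (c 0 i * t))) * dRe i f (rad r c t) =
    \sum_(j < m) c 0 j ^+ 2 * (rad r c t).1 0 j * dRe j f (rad r c t).
    by apply: eq_bigr => j _; rewrite mxE; ring.
  rewrite -H -big_split /=; apply: eq_bigr => j _.
  rewrite mulr_sumr -big_split /=; apply: eq_bigr => k _.
  rewrite !mxE; ring.
apply: is_derive_sumf => j.
have d1 : is_derive t (1:R) (fun s => dRe j f (rad r c s) : R^o) (\sum_k (c 0 k * (r 0 k * expR (c 0 k * t))) * dRe k (dRe j f) (rad r c t)).
  have := @is_derive_curve2 (dRe j f) (fun j s => r 0 j * expR (c 0 j * s)) (fun _ _ => 0)
  (fun j s => c 0 j * (r 0 j * expR (c 0 j * s))) (fun _ _ => 0) t (CC _)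
  (fun i => d_exp _ _ _) (fun i => is_derive_cst _ _ _).
  rewrite [X in _ + X]big1 ?addr0// => i _; by rewrite mul0r.
have d2 : is_derive t (1:R) (fun s => c 0 j * (r 0 j * expR (c 0 j * s)) : R^o) (c 0 j * (c 0 j * (r 0 j * expR (c 0 j * t)))).
  have d0 := d_exp (c 0 j * r 0 j) (c 0 j) t.
  under eq_fun do rewrite mulrA.
  by apply: is_derive_eq d0 _; ring.
apply: is_derive_eq (is_derive_mul d2 d1) _.
by [].
Qed.

End Plurisubharmonic.

(** * Monomials and invariant weights *)

Section Monomials.
Variable R : realType.
Local Notation C := R[i].

Lemma exprz_sum (F : fieldType) (x : F) n (e : 'I_n -> int) :
  x != 0 \/ (forall i, 0 <= e i) -> x ^ (\sum_i e i) = \prod_i x ^ e i.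
Proof.
move=> H; case: n e H => [|n] e H; first by rewrite !big_ord0.
have {H}[x0|e0] := H.
  by elim/big_rec2: _ => // i y1 y2 _ <-; rewrite expfzDr.
suff [] : 0 <= \sum_i e i /\ x ^ (\sum_i e i) = \prod_i x ^ e i by [].
elim/big_rec2: _ => // i y1 y2 _ [y0 <-]; split; first by rewrite addr_ge0.
by rewrite exprzD_ss// e0 y0.
Qed.

Lemma exprz_prod (F : fieldType) n (x : 'I_n -> F) (e : int) :
  (\prod_i x i) ^ e = \prod_i x i ^ e.
Proof. by elim/big_rec2: _ => [|i y1 y2 _ <-]; rewrite ?exp1rz// expfzMl. Qed.

(** At a vanishing coordinate exponents of opposite sign do not add up, since [0 ^ 1 * 0 ^ (-1) = 0]
    while [0 ^ 0 = 1]. The alternative for each coordinate is what the boundary points of a chart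
    satisfy. *)
Lemma monomialD m (z : 'rV[C]_m) (a b : 'rV[int]_m) :
  (forall j, z 0 j != 0 \/ (0 <= a 0 j /\ 0 <= b 0 j)) ->
  monomial z (a + b) = monomial z a * monomial z b.
Proof.
move=> H; rewrite /monomial -big_split /=; apply: eq_bigr => j _; rewrite mxE.
by have [?|[a0 b0]] := H j; [rewrite expfzDr|rewrite exprzD_ss// a0 b0].
Qed.

Lemma monomial0 m (z : 'rV[C]_m) : monomial z 0 = 1.
Proof. by rewrite /monomial big1// => j _; rewrite mxE expr0z. Qed.

Lemma monomial_neq0 m (z : 'rV[C]_m) (a : 'rV[int]_m) :
  (monomial z a != 0) <-> (forall j, z 0 j != 0 \/ a 0 j = 0).
Proof.
rewrite /monomial; split => [|H].
  move/prodf_neq0 => H j; have := H j isT; rewrite expfz_eq0 negb_and negbK.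
  by case: (z 0 j == 0) => //=; [rewrite orbF => /eqP; right|left].
apply/prodf_neq0 => j _; rewrite expfz_eq0 negb_and negbK.
by have [->|->] := H j; rewrite ?orbT ?eqxx.
Qed.

Lemma monomial_mul m n (z : 'rV[C]_m) (A : 'M[int]_(n, m)) (b : 'rV[int]_n) :
  (forall j, z 0 j != 0 \/ (forall i, 0 <= A i j) /\ (forall i, 0 <= b 0 i)) ->
  monomial (\row_i monomial z (row i A)) b = monomial z (b *m A).
Proof.
move=> H; rewrite /monomial.
under eq_bigr do rewrite mxE exprz_prod.
rewrite exchange_big /=; apply: eq_bigr => j _.
rewrite mxE exprz_sum; last first.
  by have [?|[Ha Hb]] := H j; [left|right => i; exact: mulr_ge0].
by apply: eq_bigr => i _; rewrite mxE exprz_exp mulrC.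
Qed.

Lemma monomial_delta m (z : 'rV[C]_m) j : monomial z (delta_mx 0 j) = z 0 j.
Proof.
rewrite /monomial (bigD1 j)//= !mxE !eqxx expr1z big1 ?mulr1// => i ij.
by rewrite !mxE (negbTE ij) andbF expr0z.
Qed.

Lemma monomial_unimodular m (z : 'rV[C]_m) (E : 'M[int]_m) :
  E \in unitmx -> (forall j, z 0 j != 0) ->
  \row_j monomial (\row_i monomial z (row i (invmx E))) (row j E) = z.
Proof.
move=> uE z0; apply/rowP => j; rewrite mxE monomial_mul; last by move=> i; left.
by rewrite -row_mul mulmxV// rowE mulmx1 monomial_delta.
Qed.

Lemma normsq_ge0 (x : C) : 0 <= normsq x.
Proof. by rewrite /normsq addr_ge0 ?sqr_ge0. Qed.

Lemma normsq_eq0 (x : C) : (normsq x == 0) = (x == 0).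
Proof.
case: x => a b; rewrite /normsq /= eq_complex /=.
by rewrite paddr_eq0 ?sqr_ge0// !sqrf_eq0.
Qed.

Lemma normsqM (x y : C) : normsq (x * y) = normsq x * normsq y.
Proof. by case: x => a b; case: y => c d; rewrite /normsq /=; ring. Qed.

Lemma normsq1 : normsq (1 : C) = 1.
Proof. by rewrite /normsq /= expr1n expr0n addr0. Qed.

Lemma normsqV (x : C) : normsq x^-1 = (normsq x)^-1.
Proof.
have [->|x0] := eqVneq x 0.
  by rewrite invr0 /normsq /= !expr0n addr0 invr0.
have nx : normsq x != 0 by rewrite normsq_eq0.
by apply: (mulfI nx); rewrite -normsqM !divff// normsq1.
Qed.

Lemma normsqX (x : C) (n : nat) : normsq (x ^+ n) = normsq x ^+ n.
Proof. by elim: n => [|n IH]; rewrite ?expr0 ?normsq1// !exprS normsqM IH. Qed.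

Lemma normsq_exprz (x : C) (n : int) : normsq (x ^ n) = normsq x ^ n.
Proof. by case: n => n; rewrite ?NegzE -?exprnN ?normsqV normsqX. Qed.

Lemma normsq_prod n (x : 'I_n -> C) : normsq (\prod_i x i) = \prod_i normsq (x i).
Proof. by elim/big_rec2: _ => [|i y1 y2 _ <-]; rewrite ?normsq1// normsqM. Qed.

Lemma normsq_monomial m (z : 'rV[C]_m) (a : 'rV[int]_m) :
  normsq (monomial z a) = \prod_j normsq (z 0 j) ^ a 0 j.
Proof. by rewrite /monomial normsq_prod; apply: eq_bigr => j _; rewrite normsq_exprz. Qed.

Lemma normsq_real (a : R) : normsq a%:C%C = a ^+ 2.
Proof. by rewrite /normsq /= expr0n addr0. Qed.

Lemma polar (c : C) : c != 0 -> exists theta : R,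
  c = (Num.sqrt (normsq c) * cos theta +i* (Num.sqrt (normsq c) * sin theta))%C.
Proof.
case: c => a b c0; set n := normsq _.
have n0 : 0 < n by rewrite lt_neqAle normsq_ge0 eq_sym normsq_eq0 c0.
have nE : n = a ^+ 2 + b ^+ 2 by [].
set r := Num.sqrt n; have r0 : 0 < r by rewrite sqrtr_gt0.
have r2 : r ^+ 2 = n by rewrite sqr_sqrtr// ltW.
pose x := a / r.
have x2 : 1 - x ^+ 2 = (b / r) ^+ 2.
  rewrite /x !expr_div_n r2 nE; field.
  by rewrite -nE gt_eqF.
have x1 : -1 <= x <= 1.
  by have := sqr_ge0 (b / r); rewrite -x2 => ?; apply/andP; split; nra.
have cx : r * cos (acos x) = a.
  by rewrite acosK ?in_itv//= /x mulrC divfK// gt_eqF.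
have sx : r * sin (acos x) = `|b|.
  rewrite sin_acos// x2 sqrtr_sqr normrM normfV (gtr0_norm r0) mulrC divfK//.
  by rewrite gt_eqF.
have [b0|b0] := leP 0 b.
  by exists (acos x); rewrite cx sx ger0_norm.
exists (- acos x); rewrite cosN sinN cx mulrN sx.
by rewrite ltr0_norm// opprK.
Qed.

End Monomials.

(** * Convexity of the local potentials of an invariant metric *)

Section MetricConvexity.
Variables (R : realType) (m : nat) (P : delzant R m) (h0 : metric P).
Local Notation C := R[i].

(** By invariance the weight depends on the squared moduli only ([weight_abs]). These are the
    natural variables: on the open orbit they are exponentials of linear forms in [rho]. *)
Definition wgt (v : vertex P) (q : 'rV[R]_m) : R :=
  weight h0 v (cplx (\row_j Num.sqrt (q 0 j), 0)).

Lemma weight_abs (v : vertex P) (eta : 'rV[C]_m) :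
  weight h0 v eta = wgt v (\row_j normsq (eta 0 j)).
Proof.
(* The inverse phases of the coordinates, with the arbitrary value [1] where a coordinate
   vanishes. *)
pose s : 'rV[C]_m := \row_j if eta 0 j == 0 then 1
  else (Num.sqrt (normsq (eta 0 j)))%:C%C / eta 0 j.
have ns j : normsq (s 0 j) = 1.
  rewrite mxE; case: ifPn => [|e0]; first by rewrite normsq1.
  rewrite normsqM normsqV normsq_real sqr_sqrtr ?normsq_ge0// divff//.
  by rewrite normsq_eq0.
have s0 j : s 0 j != 0 by rewrite -normsq_eq0 ns oner_eq0.
have uE : edges P (val v) \in unitmx by apply: edges_unimodular; exact: valP.
(* The torus acts in the chart through the monomials of the edge matrix; its unimodularity lets any
   prescribed phases be realised. *)
set t := \row_i monomial s (row i (invmx (edges P (val v)))).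
rewrite -(@weight_invariant _ _ _ h0 v t).
  rewrite /wgt; congr (weight h0 v _); apply/rowP => j; rewrite /act_chart mxE.
  have /rowP/(_ j) := monomial_unimodular uE s0.
  rewrite mxE => ->; rewrite !mxE; case: ifPn => [/eqP ->|e0].
    by rewrite mulr0 /normsq /= !expr0n addr0 sqrtr0.
  by rewrite divfK.
move=> j; rewrite mxE normsq_monomial big1// => i _; rewrite ns.
exact: exp1rz.
Qed.

(** The local Kaehler potential of the curvature form in the chart of [v]. *)
Definition logw (v : vertex P) (p : 'rV[R]_m * 'rV[R]_m) : R^o :=
  - ln (weight h0 v (cplx p)).

Lemma is_derive_Nln (g : 'rV[R]_m * 'rV[R]_m -> R^o) x v d : 0 < g x ->
  is_derive x v g d -> is_derive x v (fun p => - ln (g p) : R^o) (- (d / g x)).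
Proof.
move=> g0 dg.
have dl : is_derive (g x : R) (1:R) (fun y : R => - ln y : R^o) (- (g x)^-1).
  by apply: is_deriveN; apply: is_derive1_ln.
have := is_derive_compR dl dg; rewrite /comp.
by rewrite mulNr mulrC.
Qed.

Lemma logw_C2 (v : vertex P) : C2 (logw v).
Proof.
pose g : 'rV[R]_m * 'rV[R]_m -> R^o := weight h0 v \o @cplx R m.
have g0 p : 0 < g p by exact: weight_gt0.
have gs := @weight_smooth _ _ _ h0 v.
have sg (s : seq ('rV[R]_m * 'rV[R]_m)) :
  let k := foldr (fun v k x => 'D_v k x) g s in
    continuous k /\ forall x v, derivable k x v by exact: gs.
have [cg dg] := sg [::].
have d1 u x : is_derive x u (logw v) (- ('D_u g x / g x)).
  by apply: (@is_derive_Nln g) => //; exact/derivableP.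
have E u : 'D_u (logw v) = (fun x => - ('D_u g x / g x) : R^o).
  by apply/funext => x; have [_ ->] := d1 u x.
have cV : continuous (fun x => (g x)^-1 : R^o).
  by move=> x; apply: cvgV; [rewrite gt_eqF|exact: cg].
have d2 u w x : is_derive x w ('D_u (logw v) : _ -> R^o)
   (- ('D_w ('D_u g) x / g x - 'D_u g x * 'D_w g x / (g x) ^+ 2)).
  rewrite E; apply: is_deriveN.
  have D1 : is_derive x w ('D_u g : _ -> R^o) ('D_w ('D_u g) x).
    by apply/derivableP; have [_] := sg [:: u]; exact.
  have D2 : is_derive x w (fun x => (g x)^-1 : R^o) (- (g x) ^- 2 * 'D_w g x).
    by apply: DeriveDef; [apply: derivableV|rewrite deriveV]; rewrite ?gt_eqF//; exact: dg.
  apply: is_derive_eq (is_derive_mul D1 D2) _.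
  have := g0 x; move: ('D_w ('D_u g) x) ('D_w g x) ('D_u g x) (g x) => a b c k k0.
  by field; rewrite gt_eqF.
split.
  move=> u; split => [x|]; first by have [] := d1 u x.
  rewrite E => x; apply: cvgN; apply: cvgM; last exact: cV.
  by have [+ _] := sg [:: u]; exact.
move=> u w; split => [x|]; first by have [] := d2 u w x.
have -> : 'D_w ('D_u (logw v)) = (fun x => - ('D_w ('D_u g) x * (g x)^-1 - 'D_u g x * 'D_w g x * ((g x)^-1 * (g x)^-1)) : R^o).
  by apply/funext => x; have [_ ->] := d2 u w x; rewrite expr2 invfM.
move=> x; apply: cvgN; apply: cvgB.
  apply: cvgM; last exact: cV.
  by have [+ _] := sg [:: w; u]; exact.
apply: cvgM; last by apply: cvgM; exact: cV.
by apply: cvgM; [have [+ _] := sg [:: u]|have [+ _] := sg [:: w]]; exact.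
Qed.

Lemma logw_rot (v : vertex P) (r c : 'rV[R]_m) (t : R) :
  logw v (\row_j (r 0 j * cos (c 0 j * t)), \row_j (r 0 j * sin (c 0 j * t)))
  = logw v (r, 0).
Proof.
rewrite /logw !weight_abs; congr (- ln (wgt v _)); apply/rowP => j.
rewrite !mxE /normsq /= ?mxE !exprMn -mulrDr cos2Dsin2 mulr1.
by rewrite expr0n addr0.
Qed.

(** The velocity of [rad] is a real vector, nonzero as soon as one coordinate moves, and the real
    part of the Hermitian form [levi] on it is a quarter of [rad_d2]. *)
Lemma rad_d2_gt0 (v : vertex P) (r c : 'rV[R]_m) (t : R) j :
  r 0 j != 0 -> c 0 j != 0 -> 0 < rad_d2 (logw v) r c t.
Proof.
move=> rj cj; rewrite /rad_d2.
set p := (_, _) : 'rV[R]_m * 'rV[R]_m.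
pose u : 'rV[C]_m := \row_j (c 0 j * (r 0 j * expR (c 0 j * t)))%:C%C.
have u0 : u != 0.
  apply/negP => /eqP/rowP/(_ j)/eqP; rewrite !mxE => /eqP[]/eqP.
  by rewrite !mulf_eq0 (negbTE rj) (negbTE cj) gt_eqF ?expR_gt0.
have := @weight_curv _ _ _ h0 v p u u0.
rewrite ltcE => /andP[_].
rewrite raddf0 raddf_sum /=.
have -> : \sum_(i < m) complex.Re (\sum_(k < m) u 0 i * (u 0 k)^*%C *
      levi (fun q : 'rV[R]_m * 'rV[R]_m => - ln (weight h0 v (cplx q))) p i k) =
  4^-1 * \sum_(i < m) \sum_k c 0 i * (r 0 i * expR (c 0 i * t)) *
        (c 0 k * (r 0 k * expR (c 0 k * t))) *
        (dRe k (dRe i (logw v)) p + dIm k (dIm i (logw v)) p).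
  rewrite [in RHS]exchange_big /= mulr_sumr; apply: eq_bigr => i _.
  rewrite raddf_sum mulr_sumr; apply: eq_bigr => k _.
  rewrite -[LHS]/(complex.Re _) /u !mxE /= oppr0 !mulr0 !mul0r !subr0 -/(logw v).
  by rewrite addr0 mul0r subr0 [LHS]mulrA [LHS]mulrC; congr (_ * (_ * _)); exact: mulrC.
by rewrite pmulr_rgt0 ?invr_gt0.
Qed.

End MetricConvexity.

(** * Separation and cones *)

Section Separation.
Variables (R : realType) (m : nat).
Implicit Types (x y l : 'rV[R]_m).

Lemma dotpDl x y l : dotp (x + y) l = dotp x l + dotp y l.
Proof. by rewrite /dotp -big_split; apply: eq_bigr => j _; rewrite mxE mulrDl. Qed.

Lemma dotpZl a x l : dotp (a *: x) l = a * dotp x l.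
Proof. by rewrite /dotp mulr_sumr; apply: eq_bigr => j _; rewrite mxE mulrA. Qed.

Lemma dotpC x y : dotp x y = dotp y x.
Proof. by rewrite /dotp; apply: eq_bigr => j _; rewrite mulrC. Qed.

Lemma dotpDr l x y : dotp l (x + y) = dotp l x + dotp l y.
Proof. by rewrite dotpC dotpDl !(dotpC l). Qed.

Lemma dotpZr a l x : dotp l (a *: x) = a * dotp l x.
Proof. by rewrite dotpC dotpZl (dotpC l). Qed.

Lemma dotpNl x l : dotp (- x) l = - dotp x l.
Proof. by rewrite -scaleN1r dotpZl mulN1r. Qed.

Lemma dotpNr l x : dotp l (- x) = - dotp l x.
Proof. by rewrite dotpC dotpNl (dotpC l). Qed.

Lemma dotpBl x y l : dotp (x - y) l = dotp x l - dotp y l.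
Proof. by rewrite dotpDl dotpNl. Qed.

Lemma dotpBr l x y : dotp l (x - y) = dotp l x - dotp l y.
Proof. by rewrite dotpDr dotpNr. Qed.

Lemma dotp0l x : dotp 0 x = 0.
Proof. by rewrite -(scale0r x) dotpZl mul0r. Qed.

Lemma dotp0r x : dotp x 0 = 0.
Proof. by rewrite dotpC dotp0l. Qed.

Lemma dotp_sumr n l (F : 'I_n -> 'rV[R]_m) : dotp l (\sum_i F i) = \sum_i dotp l (F i).
Proof. by elim/big_rec2: _ => [|i a b _ <-]; rewrite ?dotp0r// dotpDr. Qed.

Lemma dotp_sqrB s x l : dotp (s *: x - l) (s *: x - l) =
  s * (s * dotp x x) - s * dotp l x *+ 2 + dotp l l.
Proof. by rewrite !(dotpBl, dotpBr, dotpZl, dotpZr) (dotpC x l); ring. Qed.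

Lemma dotp_sqr_ge0 x : 0 <= dotp x x.
Proof. by apply: sumr_ge0 => j _; rewrite -expr2 sqr_ge0. Qed.

Lemma dotp_sqr_eq0 x : dotp x x = 0 -> x = 0.
Proof.
move/eqP; rewrite psumr_eq0 => [/allP H|j _]; last by rewrite -expr2 sqr_ge0.
apply/rowP => j; have := H j (mem_index_enum _).
by rewrite /= -expr2 sqrf_eq0 mxE => /eqP.
Qed.

(** [l] points to [x] from the nearest point [y0] of [S]. A point of [S] on the positive side of
    [y0] would allow a step inside [S] that gets closer to [x]. *)
Lemma separation (S : set 'rV[R]_m) x : compact S ->
  (forall y z (t : R), S y -> S z -> 0 <= t <= 1 -> S (y + t *: (z - y))) ->
  ~ S x -> exists l, forall y, S y -> dotp l y < dotp l x.
Proof.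
move=> cS convS Sx.
have [->|/set0P S0] := eqVneq S set0; first by exists 0.
pose f (y : 'rV[R]_m) := dotp (y - x) (y - x).
have cf : continuous f.
  apply: (@continuous_big R 'I_m +%R 0 xpredT); first exact: add_continuous.
  move=> j _ y.
  have c : (fun y : 'rV[R]_m => (y - x) 0 j) @ y --> (y - x) 0 j.
    have -> : (fun y : 'rV[R]_m => (y - x) 0 j) = (fun y => y 0 j - x 0 j).
      by apply/funext => z; rewrite !mxE.
    have -> : (y - x) 0 j = y 0 j - x 0 j by rewrite !mxE.
    have c1 : (fun z : 'rV[R]_m => z 0 j) @ y --> y 0 j by exact: coord_continuous.
    exact: cvgB c1 (cvg_cst _).
  exact: (cvgM c c).
have [y0] := compact_EVT_min S0 cS (continuous_subspaceT cf).
rewrite inE => Sy0 ymin.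
pose l := x - y0.
have l0 : 0 < dotp l l.
  rewrite lt_neqAle dotp_sqr_ge0 andbT eq_sym; apply/eqP => /dotp_sqr_eq0/eqP.
  by rewrite subr_eq0 => /eqP xy; apply: Sx; rewrite xy.
exists l => y Sy.
suff le : dotp l (y - y0) <= 0.
  have : dotp l (x - y) = dotp l l - dotp l (y - y0).
    by rewrite -dotpBr; congr dotp; rewrite /l opprB addrA subrK.
  rewrite dotpBr => E; rewrite -subr_gt0 E.
  by apply: (lt_le_trans l0); rewrite lerBrDl gerDr.
rewrite leNgt; apply/negP; set d := dotp _ _ => d0.
pose B := dotp (y - y0) (y - y0).
have B0 : 0 <= B by exact: dotp_sqr_ge0.
have dB : 0 < d + B by rewrite ltr_wpDr.
(* This step makes [s * B < 2 * d], so the change [s * (s * B - 2 * d)] of the squared distance is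
   negative. *)
pose s := d / (d + B).
have s0 : 0 < s by rewrite divr_gt0.
have s1 : s <= 1 by rewrite ler_pdivrMr// mul1r lerDl.
have := ymin (y0 + s *: (y - y0)).
rewrite inE => /(_ (convS _ _ _ Sy0 Sy _)); rewrite (ltW s0) s1 => /(_ isT).
rewrite /f.
have -> : y0 + s *: (y - y0) - x = s *: (y - y0) - l.
  by rewrite /l opprB [RHS]addrCA addrA.
have -> : y0 - x = - l by rewrite opprB.
have -> : dotp (- l) (- l) = dotp l l by rewrite dotpNl dotpNr opprK.
have -> : dotp (s *: (y - y0) - l) (s *: (y - y0) - l) = s * (s * B) - s * d *+ 2 + dotp l l.
  exact: dotp_sqrB.
have : s * B < d *+ 2.
  rewrite /s mulrAC ltr_pdivrMr//.
  rewrite mulr2n; nra.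
move=> H1; nra.
Qed.

(** The generators keep their indices and only the set [A] of allowed ones varies, so that
    [cone_exposed] can minimise over [A]. *)
Definition cvx n (A : {set 'I_n}) (q : 'I_n -> 'rV[R]_m) : set 'rV[R]_m :=
  [set x | exists t : 'I_n -> R, [/\ forall i, 0 <= t i, forall i, i \notin A -> t i = 0,
     \sum_i t i = 1 & x = \sum_i t i *: q i]].

Lemma compact_cvx n (A : {set 'I_n}) (q : 'I_n -> 'rV[R]_m) : compact (cvx A q).
Proof.
pose D : set 'rV[R]_n := [set t | (forall i, t 0 i \in `[0, 1])] `&`
  ([set t | \sum_i t 0 i = 1] `&` \bigcap_(i in [set i | i \notin A]) [set t | t 0 i = 0]).
have cD : compact D.
  have cb : compact [set t : 'rV[R]_n | (forall i, t 0 i \in `[0, 1])].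
    have := @rV_compact R n (fun=> `[0, 1]%classic) (fun _ => @segment_compact _ _ _).
    by [].
  apply: compact_closedI => //.
  apply: closedI.
    have : continuous (fun t : 'rV[R]_n => \sum_i t 0 i).
      apply: (@continuous_big R 'I_n +%R 0 xpredT); first exact: add_continuous.
      by move=> i _ t; exact: coord_continuous.
    move=> c; apply: (@preimage_closed _ _ (fun t : 'rV[R]_n => \sum_i t 0 i) [set 1]); last exact: closed_eq.
    by move=> t _; exact: c.
  apply: closed_bigI => i _.
  apply: (@preimage_closed _ _ (fun t : 'rV[R]_n => t 0 i) [set 0]); last exact: closed_eq.
  by move=> t _; exact: coord_continuous.
have -> : cvx A q = (fun t : 'rV[R]_n => \sum_i t 0 i *: q i) @` D.
  apply/seteqP; split => x /=.
    move=> [t [t0 tA t1 ->]]; exists (\row_i t i) => /=.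
      split=> /=.
        move=> i; rewrite mxE in_itv /= t0 /= -t1 (bigD1 i)//= lerDl.
        exact: sumr_ge0.
      split; first by rewrite -t1; apply: eq_bigr => i _; rewrite mxE.
      by move=> i /= iA; rewrite mxE tA.
    by apply: eq_bigr => i _; rewrite mxE.
  move=> [t [t0 [t1 tA]] <-]; exists (fun i => t 0 i); split => //.
  by move=> i; have := t0 i; rewrite in_itv => /andP[].
apply: continuous_compact => //; apply: continuous_subspaceT.
apply: (@continuous_big 'rV[R]_m 'I_n +%R 0 xpredT); first exact: add_continuous.
move=> i _ t.
have c1 : (fun z : 'rV[R]_n => z 0 i) @ t --> t 0 i by exact: coord_continuous.
exact: cvgZ c1 (cvg_cst _).
Qed.

Lemma convex_cvx n (A : {set 'I_n}) (q : 'I_n -> 'rV[R]_m) y z (t : R) :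
  cvx A q y -> cvx A q z -> 0 <= t <= 1 -> cvx A q (y + t *: (z - y)).
Proof.
move=> [a [a0 aA a1 ->]] [b [b0 bA b1 ->]] /andP[t0 t1].
exists (fun i => (1 - t) * a i + t * b i); split.
- by move=> i; rewrite addr_ge0// mulr_ge0// subr_ge0.
- by move=> i iA; rewrite aA// bA// !mulr0 addr0.
- by rewrite big_split /= -!mulr_sumr a1 b1 !mulr1 subrK.
- under [RHS]eq_bigr do rewrite scalerDl -!scalerA.
  rewrite big_split /= -!scaler_sumr scalerBr scalerBl scale1r.
  by rewrite addrA addrAC.
Qed.

Lemma cvx_separation n (A : {set 'I_n}) (q : 'I_n -> 'rV[R]_m) x :
  ~ cvx A q x -> exists l, forall j, j \in A -> dotp l (q j) < dotp l x.
Proof.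
move=> H.
have [l Hl] := separation (@compact_cvx n A q) (@convex_cvx n A q) H.
exists l => j jA; apply: Hl; exists (fun i => (i == j)%:R); split.
- by move=> i; rewrite ler0n.
- by move=> i; apply: contraNeq; rewrite pnatr_eq0 eqb0 negbK => /eqP ->.
- by rewrite (bigD1 j)//= eqxx big1 ?addr0// => i /negbTE ->.
- by rewrite (bigD1 j)//= eqxx scale1r big1 ?addr0// => i /negbTE ->; rewrite scale0r.
Qed.

(* Slice the cone by the hyperplane [l = -1] and keep a minimal set of points of
   the slice whose convex hull contains all of them. *)
Lemma cone_exposed n (g : 'I_n -> 'rV[R]_m) (l : 'rV[R]_m) (K : set 'rV[R]_m) :
  (forall i, dotp l (g i) < 0) ->
  K 0 -> (forall x y, K x -> K y -> K (x + y)) ->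
  (forall a x, 0 <= a -> K x -> K (a *: x)) ->
  (forall i l', dotp l' (g i) = 0 -> (forall k, dotp l' (g k) <= 0) ->
    (forall k, dotp l' (g k) = 0 -> exists2 c, 0 <= c & g k = c *: g i) -> K (g i)) ->
  forall i, K (g i).
Proof.
move=> lg K0 KD KZ Kexp.
pose q i := (- dotp l (g i))^-1 *: g i.
have c0 i : 0 < - dotp l (g i) by rewrite oppr_gt0.
have gq i : g i = (- dotp l (g i)) *: q i.
  by rewrite /q scalerA divff ?scale1r// gt_eqF.
have lq i : dotp l (q i) = -1.
  by rewrite /q dotpZr invrN mulNr mulVf// lt_eqF.
have self (A : {set 'I_n}) i : i \in A -> cvx A q (q i).
  move=> iA; exists (fun j => (j == i)%:R); split.
  - by move=> j; rewrite ler0n.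
  - by move=> j; apply: contraNeq; rewrite pnatr_eq0 eqb0 negbK => /eqP ->.
  - by rewrite (bigD1 i)//= eqxx big1 ?addr0// => j /negbTE ->.
  - by rewrite (bigD1 i)//= eqxx scale1r big1 ?addr0// => j /negbTE ->; rewrite scale0r.
pose gen (A : {set 'I_n}) := `[< forall i, cvx A q (q i) >].
have genT : gen [set: 'I_n]%SET by apply/asboolP => i; apply: self; rewrite inE.
have [A /asboolP genA minA] := arg_minnP (fun A : {set 'I_n} => #|A|) genT.
have KA a : a \in A -> K (g a).
  move=> aA.
  (* If [q a] were a combination of the other points of [A], substituting it would give a generating
     set with one element less. *)
  have na : ~ cvx (A :\ a) q (q a).
    move=> [s [s0 sA s1 sq]].
    have : gen (A :\ a).
      apply/asboolP => i; have [t [t0 tA t1 tq]] := genA i.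
      exists (fun j => if j == a then 0 else t j + t a * s j).
      have sa : s a = 0 by apply: sA; rewrite !inE eqxx.
      split.
      + by move=> j; case: ifP => // _; rewrite addr_ge0// mulr_ge0.
      + move=> j; rewrite !inE negb_and negbK; case: eqVneq => //= ja jA.
        by rewrite tA// sA ?mulr0 ?addr0// !inE negb_and jA orbT.
      + rewrite (bigD1 a)//= eqxx add0r.
        rewrite (eq_bigr (fun j => t j + t a * s j)); last by move=> j /negbTE ->.
        rewrite big_split /= -mulr_sumr.
        have -> : \sum_(i0 | i0 != a) s i0 = 1 by rewrite -s1 [RHS](bigD1 a)//= sa add0r.
        by rewrite mulr1 addrC -t1 [RHS](bigD1 a).
      + rewrite tq (bigD1 a)//= [RHS](bigD1 a)//= eqxx scale0r add0r.
        rewrite [RHS](eq_bigr (fun j => t j *: q j + t a *: (s j *: q j))); last first.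
          by move=> j /negbTE ->; rewrite scalerDl scalerA.
        rewrite big_split /= -scaler_sumr addrC; congr (_ + _ *: _).
        by rewrite {1}sq [LHS](bigD1 a)//= sa scale0r add0r.
    move=> /minA; rewrite (cardsD1 a A) aA.
    by rewrite add1n ltnn.
  have [l' Hl'] := cvx_separation na.
  (* As [l] equals [-1] on the slice, this multiple of [l] shifts [l'] to the value [0] at [q a] and
     keeps its order on the slice. *)
  pose l2 := l' + dotp l' (q a) *: l.
  have l2q k : dotp l2 (q k) = dotp l' (q k) - dotp l' (q a).
    by rewrite /l2 dotpDl dotpZl lq mulrN1.
  have lek k : dotp l' (q k) <= dotp l' (q a) /\ (dotp l' (q k) = dotp l' (q a) -> q k = q a).
    have [t [t0 tA t1 ->]] := genA k.
    have E : dotp l' (\sum_i t i *: q i) - dotp l' (q a) = \sum_i t i * (dotp l' (q i) - dotp l' (q a)).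
      under [RHS]eq_bigr do rewrite mulrBr.
      rewrite sumrB -mulr_suml t1 mul1r dotp_sumr; congr (_ - _).
      by apply: eq_bigr => i _; rewrite dotpZr.
    have le0 i : t i * (dotp l' (q i) - dotp l' (q a)) <= 0.
      have [iA|iA] := boolP (i \in A); last by rewrite tA// mul0r.
      rewrite mulr_ge0_le0// subr_le0; have [->//|ia] := eqVneq i a.
      by apply: ltW; apply: Hl'; rewrite !inE ia.
    split; first by rewrite -subr_le0 E; apply: sumr_le0.
    move=> /eqP; rewrite -subr_eq0 E => /eqP Z.
    have tz i : i != a -> t i = 0.
      move=> ia; have [iA|iA] := boolP (i \in A); last by rewrite tA.
      have : \sum_i - (t i * (dotp l' (q i) - dotp l' (q a))) == 0 by rewrite sumrN Z oppr0.
      rewrite psumr_eq0 => [/allP/(_ i (mem_index_enum _))|? _]; last by rewrite oppr_ge0.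
      rewrite /= oppr_eq0 mulf_eq0 subr_eq0 => /orP[/eqP//|/eqP e].
      have := Hl' i; rewrite !inE ia iA e ltxx => /(_ isT); by [].
    have ta : t a = 1 by rewrite -t1 (bigD1 a)//= big1 ?addr0// => i; exact: tz.
    by rewrite (bigD1 a)//= big1 ?addr0 ?ta ?scale1r// => i ia; rewrite tz// scale0r.
  apply: (Kexp a l2).
  - by rewrite gq dotpZr l2q subrr mulr0.
  - by move=> k; rewrite gq dotpZr l2q mulr_ge0_le0// ?(ltW (c0 _))// subr_le0; have [] := lek k.
  - move=> k; rewrite gq dotpZr l2q => /eqP.
    rewrite mulf_eq0 gt_eqF//= subr_eq0 => /eqP /(proj2 (lek k)) qk.
    exists (- dotp l (g k) * (- dotp l (g a))^-1); first by rewrite mulr_ge0 ?invr_ge0// ltW.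
    by rewrite gq qk /q scalerA.
move=> i; rewrite gq; apply: (KZ); first exact: ltW.
have [t [t0 tA t1 ->]] := genA i.
apply: (big_ind K) => // j _.
have [jA|jA] := boolP (j \in A); last by rewrite tA// scale0r.
by apply: (KZ) => //; rewrite /q; apply: (KZ); [rewrite invr_ge0 ltW|exact: KA].
Qed.

End Separation.

Section Primitive.

(** [k] is the gcd of the entries; a non-unit factor of [w] would enlarge it. *)
Lemma primitive_part m (a : 'rV[int]_m) : a != 0 ->
  exists (k : nat) (w : 'rV[int]_m), [/\ (0 < k)%N, a = k%:Z *: w & primitive w].
Proof.
move=> a0; pose k := \big[gcdn/0%N]_(j < m) absz (a 0 j).
have kd j : (k%:Z %| a 0%R j)%Z.
  by rewrite dvdzE /k /=; apply: (biggcdn_inf j).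
have k0 : (0 < k)%N.
  rewrite lt0n; apply: contra_neq a0 => k0; apply/rowP => j; rewrite mxE.
  by have := kd j; rewrite k0 dvd0z => /eqP.
pose w : 'rV[int]_m := \row_j divz (a 0 j) k%:Z.
have aw : a = k%:Z *: w.
  by apply/rowP => j; rewrite !mxE mulrC divzK.
exists k, w; split => // u w' ww'.
have : (absz u * k %| k)%N.
  rewrite {2}/k; apply/dvdn_biggcdP => j _.
  by rewrite aw ww' !mxE !abszM /= mulnA dvdn_mulr// mulnC.
rewrite -{2}(mul1n k) dvdn_pmul2r// dvdn1 => /eqP u1.
by move: u1 {ww'}; case: u => [[|[|n]]|[|n]].
Qed.

End Primitive.

(** * Edge coordinates *)

Section DelzantPolytope.
Variables (R : realType) (m : nat) (P : delzant R m).
Local Notation toR := (toR R).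

Lemma toRD (a b : 'rV[int]_m) : toR (a + b) = toR a + toR b.
Proof. exact: map_mxD. Qed.
Lemma toRB (a b : 'rV[int]_m) : toR (a - b) = toR a - toR b.
Proof. exact: map_mxB. Qed.
Lemma toR0 : toR (0 : 'rV[int]_m) = 0.
Proof. exact: map_mx0. Qed.
Lemma toRZ (k : int) (a : 'rV[int]_m) : toR (k *: a) = k%:~R *: toR a.
Proof. exact: map_mxZ. Qed.
Lemma toRMn (a : 'rV[int]_m) (n : nat) : toR (a *+ n) = n%:R *: toR a.
Proof. by elim: n => [|n IH]; rewrite ?mulr0n ?scale0r ?toR0// !mulrS toRD IH scalerDl scale1r. Qed.
Lemma toR_inj : injective (@Defs.toR R m).
Proof.
move=> a b /matrixP e; apply/matrixP => i j.
by have := e i j; rewrite !mxE => /intr_inj.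
Qed.

Variable v : vertex P.
Local Notation E := (edges P (val v)).
Local Notation ER := (map_mx intr E : 'M[R]_m).

Lemma edges_unit : E \in unitmx.
Proof. by apply: edges_unimodular; exact: valP. Qed.

Lemma edgesR_inv : invmx ER = map_mx intr (invmx E).
Proof.
have H : ER *m map_mx intr (invmx E) = 1%:M.
  by rewrite -map_mxM mulmxV ?edges_unit// map_mx1.
by have [u _] := mulmx1_unit H; rewrite -[RHS](mulKmx u) H mulmx1.
Qed.

Lemma edgesR_unit : ER \in unitmx.
Proof.
have H : ER *m map_mx intr (invmx E) = 1%:M.
  by rewrite -map_mxM mulmxV ?edges_unit// map_mx1.
by have [] := mulmx1_unit H.
Qed.

Lemma edge_coordR_toR (a : 'rV[int]_m) : edge_coordR v (toR a) = toR (edge_coord v a).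
Proof. by rewrite /edge_coordR edgesR_inv /edge_coord /toR map_mxM. Qed.

Lemma edge_coord_row j : edge_coord v (row j E) = delta_mx 0 j.
Proof. by rewrite /edge_coord -row_mul mulmxV ?edges_unit// rowE mulmx1. Qed.

Lemma edge_coordK (a : 'rV[int]_m) : edge_coord v a *m E = a.
Proof. by rewrite /edge_coord mulmxKV ?edges_unit. Qed.

Lemma edge_coordRK (x : 'rV[R]_m) : edge_coordR v x *m ER = x.
Proof. by rewrite /edge_coordR mulmxKV ?edgesR_unit. Qed.

Lemma edge_coordRD (x y : 'rV[R]_m) : edge_coordR v (x + y) = edge_coordR v x + edge_coordR v y.
Proof. exact: mulmxDl. Qed.
Lemma edge_coordRB (x y : 'rV[R]_m) : edge_coordR v (x - y) = edge_coordR v x - edge_coordR v y.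
Proof. exact: mulmxBl. Qed.
Lemma edge_coordRZ a (x : 'rV[R]_m) : edge_coordR v (a *: x) = a *: edge_coordR v x.
Proof. by rewrite /edge_coordR scalemxAl. Qed.
Lemma edge_coordR0 : edge_coordR v 0 = 0.
Proof. exact: mul0mx. Qed.
Lemma edge_coordD (x y : 'rV[int]_m) : edge_coord v (x + y) = edge_coord v x + edge_coord v y.
Proof. exact: mulmxDl. Qed.
Lemma edge_coordB (x y : 'rV[int]_m) : edge_coord v (x - y) = edge_coord v x - edge_coord v y.
Proof. exact: mulmxBl. Qed.
Lemma edge_coord0 : edge_coord v 0 = 0.
Proof. exact: mul0mx. Qed.
Lemma edge_coordMn (x : 'rV[int]_m) n : edge_coord v (x *+ n) = edge_coord v x *+ n.
Proof. by elim: n => [|n IH]; rewrite ?edge_coord0// !mulrS edge_coordD IH. Qed.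

Lemma polytope_vert (u : 'rV[int]_m) : u \in verts P -> polytope P (toR u).
Proof.
move=> uP; have us : (index u (verts P) < size (verts P))%N by rewrite index_mem.
exists (fun i => (i == Ordinal us)%:R); split.
- by move=> i; rewrite ler0n.
- by rewrite (bigD1 (Ordinal us))//= eqxx big1 ?addr0// => i /negbTE ->.
- rewrite (bigD1 (Ordinal us))//= eqxx scale1r nth_index// big1 ?addr0//.
  by move=> i /negbTE ->; rewrite scale0r.
Qed.

Lemma polytope_seg x y (t : R) : polytope P x -> polytope P y -> 0 <= t <= 1 ->
  polytope P (t *: x + (1 - t) *: y).
Proof.
move=> [a [a0 a1 ->]] [b [b0 b1 ->]] /andP[t0 t1].
exists (fun i => t * a i + (1 - t) * b i); split.
- by move=> i; rewrite addr_ge0// mulr_ge0// subr_ge0.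
- by rewrite big_split /= -!mulr_sumr a1 b1 !mulr1 addrC subrK.
- under [RHS]eq_bigr do rewrite scalerDl -!scalerA.
  by rewrite big_split /= -!scaler_sumr.
Qed.

Lemma polytope_dotp_le (l : 'rV[R]_m) (c : R) :
  (forall u, u \in verts P -> dotp l (toR u) <= c) ->
  forall x, polytope P x -> dotp l x <= c.
Proof.
move=> H x [t [t0 t1 ->]]; rewrite dotp_sumr -[c]mul1r -t1 mulr_suml.
by apply: ler_sum => i _; rewrite dotpZr ler_wpM2l// H// mem_nth.
Qed.

Lemma vertex_functional : exists l : 'rV[R]_m, forall u, u \in verts P -> u != val v ->
  dotp l (toR u) < dotp l (toR (val v)).
Proof.
have [_ [l Fl]] := verts_vertex (valP v).
have vl : [set toR (val v)] (toR (val v)) by [].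
move: (vl); rewrite Fl => -[_ vmax].
exists l => u uP uv; rewrite lt_neqAle vmax ?andbT; last exact: polytope_vert.
apply: contra_neq uv => e; apply: toR_inj.
suff : [set toR (val v)] (toR u) by [].
rewrite Fl; split; first exact: polytope_vert.
by move=> y Py; rewrite e; exact: vmax.
Qed.

(** The far end of the edge is a convex combination of vertices, and those with positive weight lie
    on the edge, because the face functional is maximal there; one of them is not [v]. Its position
    along the edge is an integer because the edge vectors form a lattice basis. *)
Lemma edge_end j : exists2 k : nat, (0 < k)%N & val v + row j E *+ k \in verts P.
Proof.
have [_ [L L0 [_ [l Fl]]]] : edge_vector (conv_hull R (verts P)) (val v) (row j E).
  by apply/edgesP; [exact: valP|exists j].
set seg := [set _ | _ in _] in Fl.
have : seg (toR (val v) + L *: toR (row j E)).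
  by exists L => //=; rewrite in_itv/= lexx ltW.
rewrite {1}Fl => -[[t [t0 t1 tE]] tmax].
set x := toR (val v) + _ in tE tmax *.
have lev i : 0 <= t i * (dotp l x - dotp l (toR (nth 0 (verts P) i))).
  by rewrite mulr_ge0// subr_ge0 tmax//; apply: polytope_vert; rewrite mem_nth.
have tv i : 0 < t i -> seg (toR (nth 0 (verts P) i)).
  move=> ti; rewrite Fl; split; first by apply: polytope_vert; rewrite mem_nth.
  move=> y Py; apply: (le_trans (tmax y Py)).
  have : \sum_i t i * (dotp l x - dotp l (toR (nth 0 (verts P) i))) == 0.
    under eq_bigr do rewrite mulrBr.
    rewrite sumrB -mulr_suml t1 mul1r {1}tE dotp_sumr subr_eq0; apply/eqP.
    by apply: eq_bigr => k _; rewrite dotpZr.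
  rewrite psumr_eq0 => [/allP/(_ i (mem_index_enum _))|k _]; last exact: lev.
  by rewrite /= mulf_eq0 gt_eqF//= subr_eq0 => /eqP ->.
have [i [ti]] : exists i, 0 < t i /\ toR (nth 0 (verts P) i) <> toR (val v).
  apply/not_existsP => H.
  have : x = toR (val v).
    rewrite tE -[RHS]scale1r -t1 scaler_suml; apply: eq_bigr => i _.
    have := t0 i; rewrite le_eqVlt => /orP[/eqP <-|ti]; first by rewrite !scale0r.
    by have /not_andP[//|/contrapT ->] := H i.
  rewrite /x => /(congr1 (fun y => y - toR (val v))).
  rewrite addrAC subrr add0r => /eqP; rewrite scaler_eq0 gt_eqF//= => /eqP z.
  have : edge_coord v (row j E) 0 j = 0.
    by rewrite (toR_inj (etrans z (esym toR0))) edge_coord0 mxE.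
  by rewrite edge_coord_row mxE !eqxx.
have [s] := tv i ti; rewrite /= in_itv/= => /andP[s0 sL] vsE ne.
have {}s0 : 0 < s.
  rewrite lt_neqAle s0 andbT eq_sym; apply/eqP => sz; apply: ne.
  by rewrite -vsE sz scale0r addr0.
set u := nth 0 (verts P) i in vsE ne.
have uP : u \in verts P by rewrite mem_nth.
have cE : toR (edge_coord v (u - val v)) = s *: delta_mx 0 j.
  rewrite -edge_coordR_toR toRB -vsE addrAC subrr add0r edge_coordRZ.
  by rewrite edge_coordR_toR edge_coord_row /Defs.toR map_delta_mx.
pose n := edge_coord v (u - val v) 0 j.
have ns : n%:~R = s.
  have : toR (edge_coord v (u - val v)) 0 j = s by rewrite cE !mxE !eqxx mulr1.
  by rewrite [LHS]mxE.
have uE : u = val v + n *: row j E.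
  rewrite addrC; apply/eqP; rewrite -subr_eq; apply/eqP.
  rewrite -[LHS]edge_coordK rowE scalemxAl; congr (_ *m _).
  by apply: toR_inj; rewrite cE toRZ ns /Defs.toR map_delta_mx.
have n0 : 0 < n by rewrite -(ltr0z R) ns.
exists (absz n); first by rewrite absz_gt0 gt_eqF.
by rewrite -scaler_nat natz gtz0_abs// -uE.
Qed.

Lemma edge_lattice j : lattice_points P 1 (val v + row j E).
Proof.
have [k k0 uP] := edge_end j.
exists (toR (val v + row j E)); last by rewrite scale1r.
have -> : toR (val v + row j E) = k%:R^-1 *: toR (val v + row j E *+ k) + (1 - k%:R^-1) *: toR (val v).
  rewrite !toRD toRMn scalerDr scalerA mulVf ?pnatr_eq0 -?lt0n// scale1r.
  by rewrite [RHS]addrAC -scalerDl addrCA subrr addr0 scale1r.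
apply: polytope_seg.
- exact: polytope_vert.
- by apply: polytope_vert; exact: valP.
- by rewrite invr_ge0 ler0n /= invf_le1 ?ltr0n// ler1n.
Qed.

(** By [cone_exposed] only the exposed rays of the cone generated by the other vertices matter. Such
    a ray carries an edge of [P], so by [edgesP] its primitive vector is a row of the edge matrix,
    with a unit vector as edge coordinates. *)
Lemma edge_cone x j : polytope P x -> 0 <= edge_coordR v (x - toR (val v)) 0 j.
Proof.
suff H u : u \in verts P -> 0 <= edge_coordR v (toR u - toR (val v)) 0 j.
  move=> [t [t0 t1 ->]].
  have -> : \sum_i t i *: toR (nth 0 (verts P) i) - toR (val v) =
    \sum_i t i *: (toR (nth 0 (verts P) i) - toR (val v)).
    under [RHS]eq_bigr do rewrite scalerBr.
    by rewrite sumrB -scaler_suml t1 scale1r.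
  elim/big_ind: _ => [|y z y0 z0|i _].
  - by rewrite edge_coordR0 mxE.
  - by rewrite edge_coordRD mxE addr_ge0.
  - by rewrite edge_coordRZ mxE mulr_ge0// H// mem_nth.
move=> uP; have [->|uv] := eqVneq u (val v).
  by rewrite subrr edge_coordR0 mxE.
have [l Hl] := vertex_functional.
pose s := [seq x <- verts P | x != val v].
pose g (i : 'I_(size s)) := toR (nth 0 s i) - toR (val v).
have sP (i : 'I_(size s)) : nth 0 s i \in verts P /\ nth 0 s i != val v.
  by have := mem_nth 0 (ltn_ord i); rewrite mem_filter => /andP[].
pose K := [set y : 'rV[R]_m | forall j, 0 <= edge_coordR v y 0 j].
have us : u \in s by rewrite mem_filter uv.
have ui : (index u s < size s)%N by rewrite index_mem.
suff : K (g (Ordinal ui)) by move/(_ j); rewrite /g /= nth_index.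
apply: (@cone_exposed _ _ _ g l).
- move=> i; have [iP iv] := sP i.
  by rewrite /g dotpBr subr_lt0 Hl.
- by move=> k; rewrite edge_coordR0 mxE.
- by move=> x0 y0 Kx Ky k; rewrite edge_coordRD mxE addr_ge0.
- by move=> a y0 a0 Ky k; rewrite edge_coordRZ mxE mulr_ge0.
move=> i l' l'i l'le l'eq.
have [iP iv] := sP i.
have [k [w [k0 aw pw]]] : exists (k : nat) (w : 'rV[int]_m),
  [/\ (0 < k)%N, nth 0 s i - val v = k%:Z *: w & primitive w].
  by apply: primitive_part; rewrite subr_eq0.
have gw : g i = k%:R *: toR w by rewrite /g -toRB aw toRZ.
have kR : 0 < k%:R :> R by rewrite ltr0n.
have l'w : dotp l' (toR w) = 0.
  move: l'i; rewrite gw dotpZr => /eqP; rewrite mulf_eq0 gt_eqF//= => /eqP //.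
have l'le' x0 : x0 \in verts P -> dotp l' (toR x0) <= dotp l' (toR (val v)).
  move=> x0P; have [->//|xv] := eqVneq x0 (val v).
  have xs : x0 \in s by rewrite mem_filter xv.
  have xi : (index x0 s < size s)%N by rewrite index_mem.
  by have := l'le (Ordinal xi); rewrite /g /= nth_index// dotpBr subr_le0.
have l'eq' x0 : x0 \in verts P -> dotp l' (toR x0) = dotp l' (toR (val v)) ->
    exists2 c, 0 <= c & toR x0 = toR (val v) + c *: toR w.
  move=> x0P e; have [->|xv] := eqVneq x0 (val v).
    by exists 0 => //; rewrite scale0r addr0.
  have xs : x0 \in s by rewrite mem_filter xv.
  have xi : (index x0 s < size s)%N by rewrite index_mem.
  have := l'eq (Ordinal xi); rewrite /g /= nth_index// dotpBr e subrr => /(_ erefl)[c c0].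
  rewrite -/(g i) gw scalerA => /eqP; rewrite subr_eq addrC => /eqP ->.
  by exists (c * k%:R) => //; rewrite mulr_ge0.
have [cf Hcf] : exists cf : 'rV[int]_m -> R, forall x0, x0 \in verts P ->
    dotp l' (toR x0) = dotp l' (toR (val v)) -> 0 <= cf x0 /\ toR x0 = toR (val v) + cf x0 *: toR w.
  have : forall x0, exists c, x0 \in verts P -> dotp l' (toR x0) = dotp l' (toR (val v)) ->
     0 <= c /\ toR x0 = toR (val v) + c *: toR w.
    move=> x0; have [[H1 H2]|H] := pselect (x0 \in verts P /\ dotp l' (toR x0) = dotp l' (toR (val v))).
      by have [c c0 e] := l'eq' x0 H1 H2; exists c.
    by exists 0 => a b; exfalso; apply: H.
  by move=> /choice[cf H]; exists cf => x0; exact: H.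
pose good x0 := (x0 \in verts P) && (dotp l' (toR x0) == dotp l' (toR (val v))).
have goodi : good (nth 0 s i).
  by rewrite /good iP /= -subr_eq0 -dotpBr -/(g i) l'i.
(* [L] is the position of the farthest vertex on the ray; the vertex that spans the ray shows that
   there is one. *)
have [L [u0 gu0 LE] Lmax] : exists2 L, (exists2 u0, good u0 & cf u0 = L) &
     forall x0, good x0 -> cf x0 <= L.
  pose vt (k : 'I_(size (verts P))) := nth 0 (verts P) k.
  have idx x0 : x0 \in verts P -> exists k, vt k = x0.
    rewrite -index_mem => xi; exists (Ordinal xi).
    by rewrite /vt /= nth_index// -index_mem.
  have [i1 i1E] := idx _ iP.
  have gi1 : good (vt i1) by rewrite i1E.
  have [i0 gi0 Hi0] := arg_maxP (fun k => cf (vt k)) (gi1 : [pred k | good (vt k)] i1).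
  exists (cf (vt i0)); first by exists (vt i0).
  move=> x0 gx0; have [k1 kE] : exists k, vt k = x0 by apply: idx; case/andP: gx0.
  by rewrite -kE; apply: Hi0; rewrite /= kE.
have wne : toR w != 0.
  apply: contraNneq iv => w0; apply/eqP/toR_inj/eqP; rewrite -subr_eq0.
  by rewrite -/(g i) gw w0 scaler0.
have L0 : 0 < L.
  have [iv1 iv2] : 0 <= cf (nth 0 s i) /\ toR (nth 0 s i) = toR (val v) + cf (nth 0 s i) *: toR w.
    by apply: Hcf; [|case/andP: goodi => _ /eqP].
  apply: lt_le_trans (Lmax _ goodi); rewrite lt_neqAle iv1 andbT eq_sym.
  apply: contraNneq iv => c0; apply/eqP/toR_inj; by rewrite iv2 c0 scale0r addr0.
have vmax y : polytope P y -> dotp l' y <= dotp l' (toR (val v)).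
  exact: polytope_dotp_le.
have : edge_vector (conv_hull R (verts P)) (val v) w.
  split=> //; exists L => //; split.
    exists (toR (val v)); exists 0; first by rewrite /= in_itv/= lexx ltW.
    by rewrite scale0r addr0.
  exists l'; apply/seteqP; split => y /=.
    move=> [c]; rewrite in_itv/= => /andP[c0 cL] <-; split.
      case/andP: gu0 => u0P /eqP u0e; have [_] := Hcf _ u0P u0e; rewrite LE => u0E.
      have -> : toR (val v) + c *: toR w = (c / L) *: toR u0 + (1 - c / L) *: toR (val v).
        rewrite u0E scalerDr scalerA divfK ?gt_eqF//.
        by rewrite [RHS]addrAC -scalerDl addrCA subrr addr0 scale1r.
      apply: polytope_seg; [exact: polytope_vert|apply: polytope_vert; exact: valP|].
      by rewrite divr_ge0// ?(ltW L0)//= ler_pdivrMr// mul1r.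
    by move=> z Pz; rewrite dotpDr dotpZr l'w mulr0 addr0; exact: vmax.
  move=> [[t [t0 t1 yE]] ymax].
  (* Conversely, a point of the face is a convex combination of vertices; those with positive weight
     maximise [l'], hence lie on the ray at positions between [0] and [L]. *)
  have ge i0 : 0 <= t i0 * (dotp l' (toR (val v)) - dotp l' (toR (nth 0 (verts P) i0))).
    by rewrite mulr_ge0// subr_ge0 l'le'// mem_nth.
  have gt i0 : 0 < t i0 -> good (nth 0 (verts P) i0).
    move=> ti; rewrite /good mem_nth//=.
    have : \sum_i t i * (dotp l' (toR (val v)) - dotp l' (toR (nth 0 (verts P) i))) == 0.
      have : dotp l' (toR (val v)) - dotp l' y = 0.
        apply/eqP; rewrite eq_le subr_le0 subr_ge0 ymax /=.
          by apply: vmax; exists t.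
        by apply: polytope_vert; exact: valP.
      move=> e; under eq_bigr do rewrite mulrBr.
      rewrite sumrB -mulr_suml t1 mul1r; apply/eqP.
      rewrite -[RHS]e yE dotp_sumr; congr (_ - _).
      by apply: eq_bigr => k1 _; rewrite dotpZr.
    rewrite psumr_eq0 => [/allP/(_ i0 (mem_index_enum _))|k1 _]; last exact: ge.
    by rewrite /= mulf_eq0 gt_eqF//= subr_eq0 eq_sym.
  pose c i0 := if 0 < t i0 then cf (nth 0 (verts P) i0) else 0.
  have cE i0 : [/\ 0 <= c i0, c i0 <= L & t i0 *: toR (nth 0 (verts P) i0) =
      t i0 *: toR (val v) + (t i0 * c i0) *: toR w].
    rewrite /c; case: ifPn => ti.
      have gi := gt _ ti; case/andP: (gi) => a /eqP b; have [c0 e] := Hcf _ a b.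
      by split; [|exact: Lmax|rewrite e scalerDr scalerA].
    have -> : t i0 = 0 by apply/eqP; rewrite eq_le t0 andbT leNgt.
    by split=> //; [exact: ltW|rewrite mul0r !scale0r addr0].
  exists (\sum_i0 t i0 * c i0).
    rewrite /= in_itv/= sumr_ge0/=; last by move=> i0 _; rewrite mulr_ge0//; case: (cE i0).
    rewrite -[L]mul1r -t1 mulr_suml; apply: ler_sum => i0 _.
    by rewrite ler_wpM2l//; case: (cE i0).
  rewrite yE; under [RHS]eq_bigr => i0 _ do (have [_ _ ->] := cE i0).
  by rewrite big_split /= -!scaler_suml t1 scale1r.
move/(edgesP (valP v)) => [j0 wE] j1.
rewrite gw wE edge_coordRZ edge_coordR_toR edge_coord_row !mxE.
by rewrite mulr_ge0// ?(ltW kR)// ler0z.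
Qed.

End DelzantPolytope.

(** * Sections with real weights *)

Section PowR.
Variable R : realType.

Lemma powR_add_ge0 (x r s : R) : 0 <= r -> 0 <= s -> x `^ (r + s) = x `^ r * x `^ s.
Proof.
move=> r0 s0; have [e|n] := eqVneq (r + s) 0; last by rewrite powRD// (negbTE n).
move/eqP: (e); rewrite paddr_eq0// => /andP[/eqP re /eqP se].
by rewrite re se addr0 !powRr0 mulr1.
Qed.

Lemma powR_sum_ge0 (x : R) n (e : 'I_n -> R) : (forall i, 0 <= e i) ->
  x `^ (\sum_i e i) = \prod_i x `^ e i.
Proof.
move=> e0; suff [] : 0 <= \sum_i e i /\ x `^ (\sum_i e i) = \prod_i x `^ e i by [].
elim/big_rec2: _ => [|i y1 y2 _ [y0 <-]]; first by rewrite powRr0.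
by split; [rewrite addr_ge0|rewrite powR_add_ge0].
Qed.

Lemma powR_prod n (x : 'I_n -> R) (t : R) : (forall i, 0 <= x i) ->
  (\prod_i x i) `^ t = \prod_i x i `^ t.
Proof.
move=> x0; suff [] : 0 <= \prod_i x i /\ (\prod_i x i) `^ t = \prod_i x i `^ t by [].
elim/big_rec2: _ => [|i y1 y2 _ [y0 <-]]; first by rewrite powR1 ler01.
by split; [rewrite mulr_ge0|rewrite powRM].
Qed.

Lemma powR_exprz (x : R) (n : int) : 0 <= x -> 0 <= n -> x `^ n%:~R = x ^ n.
Proof. by case: n => // n x0 _; rewrite -pmulrn powR_mulrn. Qed.

End PowR.

(** * Changes of chart and norms of sections *)

Section Charts.
Variables (R : realType) (m : nat) (P : delzant R m).
Local Notation C := R[i].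
Local Notation toR := (toR R).
Implicit Types (v w : vertex P) (eta : 'rV[C]_m).

Definition nsq (eta : 'rV[C]_m) : 'rV[R]_m := \row_j normsq (eta 0 j).

Lemma nsq_ge0 eta j : 0 <= nsq eta 0 j.
Proof. by rewrite mxE normsq_ge0. Qed.

Lemma nsq_eq0 eta j : (nsq eta 0 j == 0) = (eta 0 j == 0).
Proof. by rewrite mxE normsq_eq0. Qed.

Lemma toric_eq (z z' : toric P) : proj_point z = proj_point z' -> z = z'.
Proof.
case: z z' => [p pP] [p' pP'] /= e; subst p'.
by have -> : pP = pP' by exact: Prop_irrelevance.
Qed.

Lemma coordsK (z : toric P) : chart (coords z).1 (coords z).2 = z.
Proof. by apply: toric_eq; rewrite /= /coords; case: cid. Qed.

Lemma chart_eqP v eta v' eta' : chart v eta = chart v' eta' ->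
  exists2 c : C, c != 0 & forall a, hcoord v' eta' a = c * hcoord v eta a.
Proof.
move=> /(congr1 (@proj_point _ _ _)) /= E.
have : punctured_line (hcoord v' eta') (hcoord v' eta').
  by exists 1; rewrite /= ?oner_eq0//; apply/funext => a; rewrite mul1r.
rewrite -E => -[c /= c0 e]; exists c => // a.
by rewrite -e.
Qed.

Lemma chart_eq v eta v' eta' (c : C) : c != 0 ->
  (forall a, hcoord v' eta' a = c * hcoord v eta a) -> chart v eta = chart v' eta'.
Proof.
move=> c0 H; apply: toric_eq; apply/seteqP; split => Z /= [d /= d0 <-].
  exists (d / c); first by rewrite /= mulf_neq0// invr_eq0.
  by apply/funext => a; rewrite H mulrA divfK.
exists (d * c); first by rewrite /= mulf_neq0.
by apply/funext => a; rewrite H mulrA.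
Qed.

Lemma vert_lattice v : lattice_points P 1 (val v).
Proof. by exists (toR (val v)); rewrite ?scale1r//; apply: polytope_vert; exact: valP. Qed.

Lemma hcoord_lattice v eta a : lattice_points P 1 a ->
  hcoord v eta a = monomial eta (edge_coord v (a - val v)).
Proof. by move=> aP; rewrite /hcoord; case: asboolP. Qed.

Lemma hcoord_self v eta : hcoord v eta (val v) = 1.
Proof.
by rewrite hcoord_lattice ?subrr ?edge_coord0 ?monomial0//; exact: vert_lattice.
Qed.

Lemma lattice_polytope N (a : 'rV[int]_m) : (0 < N)%N -> lattice_points P N a ->
  polytope P (N%:R^-1 *: toR a).
Proof.
move=> N0 [x Px ->]; rewrite scalerA mulVf ?scale1r//.
by rewrite pnatr_eq0 -lt0n.
Qed.

(** By [edge_cone], [s_a / s_v^N] has no pole in the chart of [v]. *)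
Lemma lattice_coord_ge0 N v (a : 'rV[int]_m) j : (0 < N)%N -> lattice_points P N a ->
  0 <= edge_coord v (a - val v *+ N) 0 j.
Proof.
move=> N0 aP; have := edge_cone v j (lattice_polytope N0 aP).
have -> : N%:R^-1 *: toR a - toR (val v) = N%:R^-1 *: toR (a - val v *+ N).
  by rewrite toRB toRMn scalerBr scalerA mulVf ?scale1r// pnatr_eq0 -lt0n.
rewrite edge_coordRZ edge_coordR_toR mxE pmulr_rge0 ?invr_gt0 ?ltr0n//.
by rewrite mxE ler0z.
Qed.

Lemma lattice1_coord_ge0 v (a : 'rV[int]_m) j : lattice_points P 1 a ->
  0 <= edge_coord v (a - val v) 0 j.
Proof. by move=> aP; have := @lattice_coord_ge0 1 v a j isT aP. Qed.

(** Where [eta 0 j] vanishes, nonvanishing of the section of [w] forces the [j]-th edge coordinate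
    of [w - v] to be [0]. As [w] plus an edge vector is again a lattice point of [P], the edge
    vectors at [w] then have nonnegative exponents in [eta 0 j], and all the monomials multiply as
    on the torus. *)
Lemma chart_change v w eta : monomial eta (edge_coord v (val w - val v)) != 0 ->
  chart v eta =
  chart w (\row_i monomial eta (edge_coord v (row i (edges P (val w))))).
Proof.
set c := monomial _ _ => c0.
have zs : forall j, eta 0 j != 0 \/ edge_coord v (val w - val v) 0 j = 0.
  exact/monomial_neq0.
have eN i j : eta 0 j != 0 \/ 0 <= edge_coord v (row i (edges P (val w))) 0 j.
  have [?|wj] := zs j; first by left.
  right; have := lattice1_coord_ge0 v j (edge_lattice w i).
  by rewrite addrAC edge_coordD mxE wj add0r.
apply/esym; apply: (@chart_eq w _ v eta c) => // a.
rewrite /hcoord; case: asboolP => [aP|_]; last by rewrite mulr0.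
set A : 'M[int]_m := edges P (val w) *m invmx (edges P (val v)).
have -> : (\row_i monomial eta (edge_coord v (row i (edges P (val w))))) =
   (\row_i monomial eta (row i A)).
  by apply/rowP => i; rewrite !mxE /A row_mul.
rewrite monomial_mul; last first.
  move=> j; have [e0|e0] := eqVneq (eta 0 j) 0; [right|by left].
  split=> i; last exact: lattice1_coord_ge0.
  by have [|] := eN i j; rewrite ?e0 ?eqxx// /edge_coord -row_mul mxE.
have bE : edge_coord w (a - val w) *m A = edge_coord v (a - val w).
  by rewrite /A mulmxA edge_coordK.
rewrite bE /c -monomialD; last first.
  move=> j; have [?|wj] := zs j; [by left|right].
  rewrite wj lexx; split => //.
  have -> : a - val w = (a - val v) - (val w - val v) by rewrite opprB addrA subrK.
  by rewrite edge_coordB mxE [X in _ + X]mxE wj subr0; exact: lattice1_coord_ge0.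
congr (monomial eta _); rewrite -edge_coordD; congr (edge_coord v _).
by rewrite [RHS]addrC addrA subrK.
Qed.

(* Use the chart of a vertex at which the homogeneous coordinate is maximal. *)
Lemma chart_disc (z : toric P) : exists v eta, z = chart v eta /\ forall j, nsq eta 0 j <= 1.
Proof.
rewrite -(coordsK z); set v0 := (coords z).1; set eta0 := (coords z).2.
have [v _ vmax] := arg_maxP (fun v : vertex P => normsq (hcoord v0 eta0 (val v)))
  (erefl : xpredT v0).
have hv : 0 < normsq (hcoord v0 eta0 (val v)).
  by apply: lt_le_trans (vmax v0 isT); rewrite hcoord_self normsq1 ltr01.
have hv0 : hcoord v0 eta0 (val v) != 0 by rewrite -normsq_eq0 gt_eqF.
rewrite hcoord_lattice in hv0; last exact: vert_lattice.
have E := chart_change hv0.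
set eta := \row_i _ in E.
exists v, eta; split => // j.
(* Relative to [v], the vertex [v + k w^j] has homogeneous coordinate [eta_j ^ k]; maximality at [v]
   bounds its modulus by [1]. *)
have [k k0 uP] := edge_end v j.
have [c c0 cE] := chart_eqP E.
have vle : normsq (hcoord v eta (val v + row j (edges P (val v)) *+ k)) <= 1.
  have /= := vmax (SeqSub uP) isT.
  have := hcoord_self v eta; rewrite cE => h1.
  rewrite cE normsqM => h2.
  have c1 : normsq c * normsq (hcoord v0 eta0 (val v)) = 1 by rewrite -normsqM h1 normsq1.
  by rewrite -c1 ler_wpM2l// normsq_ge0.
move: vle; rewrite hcoord_lattice; last exact: (vert_lattice (SeqSub uP)).
rewrite addrAC subrr add0r edge_coordMn edge_coord_row normsq_monomial.
have eE i : (delta_mx 0 j *+ k : 'rV[int]_m) 0 i = (i == j)%:R *+ k.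
  by rewrite mulmxnE mxE.
rewrite (bigD1 j)//= big1 ?mulr1; last first.
  by move=> i ij; rewrite eE (negbTE ij) mul0rn expr0z.
rewrite eE eqxx -mulrnA mul1n natz => H.
by rewrite mxE -(@expr_le1 _ k)// normsq_ge0.
Qed.

Variable h0 : metric P.

(* The squared norm of a section with real weight [x], at a point of the chart
   [v] with squared moduli [q]; for a lattice point [a] of [N P], the [N]-th
   power of its value at [a / N] is [|s_a|^2]. *)
Definition secn v (q x : 'rV[R]_m) : R :=
  (\prod_j q 0 j `^ edge_coordR v (x - toR (val v)) 0 j) * wgt h0 v q.

Lemma wgt_gt0 v q : 0 < wgt h0 v q.
Proof. exact: weight_gt0. Qed.

Lemma secn_ge0 v q x : 0 <= secn v q x.
Proof. by rewrite mulr_ge0 ?prodr_ge0 ?(ltW (wgt_gt0 _ _))// => j _; rewrite powR_ge0. Qed.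

Lemma secn_neq0 v q x : (secn v q x != 0) <->
  (forall j, q 0 j != 0 \/ edge_coordR v (x - toR (val v)) 0 j = 0).
Proof.
rewrite /secn mulf_eq0 negb_or (gt_eqF (wgt_gt0 _ _)) andbT; split.
  move=> /prodf_neq0 H j; have := H j isT; rewrite powR_eq0 negb_and negbK.
  by move=> /orP[|/eqP]; [left|right].
move=> H; apply/prodf_neq0 => j _; rewrite powR_eq0 negb_and negbK.
by have [->|->] := H j; rewrite ?eqxx ?orbT.
Qed.

Lemma secn_monomial N v eta (a : 'rV[int]_m) : (0 < N)%N -> lattice_points P N a ->
  normsq (monomial eta (edge_coord v (a - val v *+ N))) * weight h0 v eta ^+ N =
  secn v (nsq eta) (N%:R^-1 *: toR a) ^+ N.
Proof.
move=> N0 aP; rewrite /secn exprMn -weight_abs; congr (_ * _).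
rewrite normsq_monomial -prodrXl; apply: eq_bigr => j _.
rewrite -powR_mulrn ?powR_ge0// -powRrM.
have -> : nsq eta 0 j = normsq (eta 0 j) by rewrite mxE.
rewrite -powR_exprz ?normsq_ge0//; last exact: lattice_coord_ge0.
congr (_ `^ _).
have -> : N%:R^-1 *: toR a - toR (val v) = N%:R^-1 *: toR (a - val v *+ N).
  by rewrite toRB toRMn scalerBr scalerA mulVf ?scale1r// pnatr_eq0 -lt0n.
rewrite edge_coordRZ edge_coordR_toR [RHS]mulrC.
rewrite [X in _ * X]mxE [X in _ * (_ * X)]mxE mulrA divff ?mul1r//.
by rewrite pnatr_eq0 -lt0n.
Qed.

Lemma secn_hcoord v eta (a : 'rV[int]_m) : lattice_points P 1 a ->
  secn v (nsq eta) (toR a) = normsq (hcoord v eta a) * weight h0 v eta.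
Proof.
move=> aP; have := @secn_monomial 1 v eta a isT aP.
by rewrite mulr1n !expr1 invr1 scale1r hcoord_lattice.
Qed.

(** Log-affinity in the weight, written with powers so as to include the value [0]. The points lie
    in [P] so that the exponents are nonnegative and [0 ^ (a + b) = 0 ^ a * 0 ^ b]. *)
Lemma secn_convex v (q : 'rV[R]_m) n (t : 'I_n -> R) (x : 'I_n -> 'rV[R]_m) :
  (forall j, 0 <= q 0 j) -> (forall i, 0 <= t i) -> \sum_i t i = 1 ->
  (forall i, polytope P (x i)) ->
  secn v q (\sum_i t i *: x i) = \prod_i secn v q (x i) `^ t i.
Proof.
move=> q0 t0 t1 xP; rewrite /secn.
under [RHS]eq_bigr => i _.
  rewrite powRM ?(ltW (wgt_gt0 _ _)) ?prodr_ge0//; last by move=> j _; rewrite powR_ge0.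
  rewrite powR_prod; last by move=> j; rewrite powR_ge0.
  over.
rewrite big_split /=; congr (_ * _); last first.
  by rewrite -powR_sum_ge0// t1 powRr1// ltW// wgt_gt0.
rewrite exchange_big /=; apply: eq_bigr => j _.
have -> : edge_coordR v (\sum_i t i *: x i - toR (val v)) 0 j =
   \sum_i edge_coordR v (x i - toR (val v)) 0 j * t i.
  have -> : \sum_i t i *: x i - toR (val v) = \sum_i t i *: (x i - toR (val v)).
    under [RHS]eq_bigr do rewrite scalerBr.
    by rewrite sumrB -scaler_suml t1 scale1r.
  rewrite /edge_coordR mulmx_suml summxE; apply: eq_bigr => i _.
  by rewrite -scalemxAl mxE mulrC.
rewrite powR_sum_ge0; first by apply: eq_bigr => i _; rewrite powRrM.
by move=> i; rewrite mulr_ge0// edge_cone.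
Qed.

(** Log-affinity reduces the independence of the chart to the vertices of [P], where it is
    [weight_glue]. *)
Lemma secn_chart v eta v' eta' x : chart v eta = chart v' eta' -> polytope P x ->
  secn v (nsq eta) x = secn v' (nsq eta') x.
Proof.
move=> E [t [t0 t1 ->]].
have PV (i : 'I_(size (verts P))) : nth 0 (verts P) i \in verts P by rewrite mem_nth.
have PP (i : 'I_(size (verts P))) : polytope P (toR (nth 0 (verts P) i)) by exact: polytope_vert.
rewrite (secn_convex v (nsq_ge0 eta) t0 t1 PP) (secn_convex v' (nsq_ge0 eta') t0 t1 PP).
- apply: eq_bigr => i _; congr (_ `^ _).
  have LP := vert_lattice (SeqSub (PV i)).
  rewrite !secn_hcoord//.
  have [c c0 cE] := chart_eqP E.
  rewrite (weight_glue h0 E) cE normsqM mulrCA mulrA; congr (_ * _).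
  have := cE (val v); rewrite hcoord_self mulr1 => <-.
  by congr (normsq _ * _); rewrite hcoord_lattice//; exact: vert_lattice.
Qed.

Definition sec (z : toric P) (x : 'rV[R]_m) : R :=
  secn (coords z).1 (nsq (coords z).2) x.

Lemma sec_chart v eta x : polytope P x -> sec (chart v eta) x = secn v (nsq eta) x.
Proof. by move=> Px; apply: (secn_chart _ Px); rewrite coordsK. Qed.

Lemma sec_ge0 z x : 0 <= sec z x.
Proof. exact: secn_ge0. Qed.

Lemma section_normsqE N (a : 'rV[int]_m) z : (0 < N)%N -> lattice_points P N a ->
  section_normsq h0 N a z = sec z (N%:R^-1 *: toR a) ^+ N.
Proof.
move=> N0 aP; rewrite /section_normsq /sec; case: (coords z) => v eta /=.
exact: secn_monomial.
Qed.

Lemma sec_vertex v eta : secn v (nsq eta) (toR (val v)) = weight h0 v eta.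
Proof.
by rewrite secn_hcoord ?hcoord_self ?normsq1 ?mul1r//; exact: vert_lattice.
Qed.

End Charts.

(** * The symplectic potential *)

Section Convexity.
Variable R : realType.

Lemma derive_le_mono (f g : R -> R) (strict : bool) :
  (forall t, is_derive t (1:R) (f : R -> R^o) (g t)) ->
  (forall t, if strict then 0 < g t else 0 <= g t) ->
  forall a b, a < b -> if strict then f a < f b else f a <= f b.
Proof.
move=> df g0 a b ab.
have [||c _ E] := @MVT_segment R f g a b.
- exact: ltW.
- by apply: derivable_within_continuous => t _; have [] := df t.
have ba : 0 < b - a by rewrite subr_gt0.
case: strict g0 => g0; first by rewrite -subr_gt0 E mulr_gt0.
by rewrite -subr_ge0 E mulr_ge0// ltW.
Qed.

Lemma convex_tangent (f f1 f2 : R -> R) (a b : R) :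
  (forall t, is_derive t (1:R) (f : R -> R^o) (f1 t)) ->
  (forall t, is_derive t (1:R) (f1 : R -> R^o) (f2 t)) ->
  (forall t, 0 <= f2 t) -> f a + f1 a * (b - a) <= f b.
Proof.
move=> d1 d2 f2_0.
have mono s t : s <= t -> f1 s <= f1 t.
  rewrite le_eqVlt => /orP[/eqP ->//|st].
  exact: (@derive_le_mono f1 f2 false).
have mv s t : s <= t -> exists2 c, s <= c <= t & f t - f s = f1 c * (t - s).
  move=> st; have [|c cst E] := @MVT_segment R f f1 s t st.
  - by apply: derivable_within_continuous => r _; have [] := d1 r.
  - by exists c => //; rewrite in_itv in cst.
rewrite -lerBrDl; have [ab|ba] := leP a b.
  have [c /andP[ac _] ->] := mv a b ab.
  by rewrite ler_wpM2r ?subr_ge0// mono.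
have [c /andP[_ ca] E] := mv b a (ltW ba).
rewrite -lerN2 opprB E -mulrN opprB ler_wpM2r ?subr_ge0 ?(ltW ba)//.
exact: mono.
Qed.

Lemma cvg_row n T (F : set_system T) (f : 'I_n -> T -> R) (l : 'I_n -> R) :
  Filter F -> (forall j, f j x @[x --> F] --> l j) ->
  (\row_j f j x : 'rV[R]_n) @[x --> F] --> \row_j l j.
Proof.
move=> FF H.
have E (g : 'I_n -> R) : \row_j g j = \sum_j g j *: delta_mx 0 j :> 'rV[R]_n.
  by rewrite [LHS]row_sum_delta; apply: eq_bigr => j _; rewrite mxE.
have -> : (fun x => \row_j f j x : 'rV[R]_n) = (fun x => \sum_j f j x *: delta_mx 0 j).
  by apply/funext => x; exact: E.
rewrite E; apply: (@cvg_big 'rV[R]_n); first exact: add_continuous.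
move=> j _; exact: (cvgZ (H j) (cvg_cst _)).
Qed.

End Convexity.

(** * The Legendre transform over the open orbit *)

Section Potential.
Variables (R : realType) (m : nat) (P : delzant R m) (h0 : metric P).
Local Notation C := R[i].
Local Notation toR := (toR R).
Implicit Types (v w : vertex P) (eta : 'rV[C]_m) (q x rho : 'rV[R]_m).

Lemma wgt_continuous v : continuous (wgt h0 v).
Proof.
have [c _] := @weight_smooth _ _ _ h0 v [::].
suff H (q : 'rV[R]_m) : {for q, continuous (wgt h0 v)} by exact: H.
pose k (q : 'rV[R]_m) : 'rV[R]_m * 'rV[R]_m := (\row_j Num.sqrt (q 0 j), 0).
have ck : {for q, continuous k}.
  have c1 : (fun q : 'rV[R]_m => \row_j Num.sqrt (q 0 j) : 'rV[R]_m) @ q --> (\row_j Num.sqrt (q 0 j) : 'rV[R]_m).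
    apply: (@cvg_row R m _ (nbhs q) (fun j (q : 'rV[R]_m) => Num.sqrt (q 0 j)) _ (nbhs_filter q)) => j.
    apply: (@continuous_comp _ _ _ (fun q : 'rV[R]_m => q 0 j)).
      exact: coord_continuous.
    exact: sqrt_continuous.
  have c2 := @cst_continuous 'rV[R]_m 'rV[R]_m 0 q.
  exact: (cvg_pair c1 c2).
exact: (continuous_comp ck (c _)).
Qed.

(** Squared moduli of a closed unit polydisc. As every point of [M] has such coordinates in some
    chart ([chart_discE]), the finitely many copies of this compact set stand for the compactness of
    [M]. *)
Definition disc : set 'rV[R]_m := [set q | forall j, q 0 j \in `[0, 1]].

Lemma disc_compact : compact disc.
Proof.
by have := @rV_compact R m (fun=> `[0, 1]%classic) (fun _ => @segment_compact _ _ _).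
Qed.

Lemma disc_nonempty : disc !=set0.
Proof. by exists 0 => j; rewrite mxE in_itv/= lexx ler01. Qed.

Lemma wgt_bounds : exists c C0 : R, 0 < c /\ forall v q, disc q -> c <= wgt h0 v q <= C0.
Proof.
have H v : exists c C0 : R, 0 < c /\ forall q, disc q -> c <= wgt h0 v q <= C0.
  have cw := continuous_subspaceT (@wgt_continuous v) (A := disc).
  have [a aD amin] := compact_EVT_min disc_nonempty disc_compact cw.
  have [b bD bmax] := compact_EVT_max disc_nonempty disc_compact cw.
  exists (wgt h0 v a), (wgt h0 v b); split; first exact: wgt_gt0.
  by move=> q qD; rewrite amin ?bmax// inE.
have /choice[c Hc] := H.
have /choice[C0 HC] := Hc.
exists (\big[Num.min/1]_v c v), (\big[Num.max/0]_v C0 v); split.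
  elim/big_ind: _ => // [x y x0 y0|v _]; first by rewrite lt_min x0.
  by have [] := HC v.
move=> v q qD; have [_ /(_ q qD)/andP[H1 H2]] := HC v.
apply/andP; split.
  by apply: le_trans H1; rewrite (bigD1 v)//= ge_min lexx.
by apply: (le_trans H2); rewrite (bigD1 v)//= le_max lexx.
Qed.

Lemma chart_discE (z : toric P) : exists v eta, z = chart v eta /\ disc (nsq eta).
Proof.
have [v [eta [zE H]]] := chart_disc z; exists v, eta; split => // j.
by rewrite in_itv /= nsq_ge0 H.
Qed.

Lemma secn_le_wgt v q x : polytope P x -> disc q -> secn h0 v q x <= wgt h0 v q.
Proof.
move=> Px qD; rewrite /secn ler_piMl ?(ltW (wgt_gt0 _ _ _))//.
apply: prodr_ile1 => j _; rewrite powR_ge0 /=.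
have := qD j; rewrite in_itv /= => /andP[q0 q1].
have e0 := edge_cone v j Px.
have <- : 1 `^ edge_coordR v (x - toR (val v)) 0 j = 1 by rewrite powR1.
by rewrite ge0_ler_powR// nnegrE.
Qed.

(** On the polydisc every monomial factor is at most [1], which leaves the weight as an upper bound.
    The lower bound is available only at the vertex whose polydisc contains [z], where the monomial
    factor equals [1]. *)
Lemma sec_bounds : exists c C0 : R, [/\ 0 < c,
  forall z x, polytope P x -> sec h0 z x <= C0 &
  forall z, exists v : vertex P, c <= sec h0 z (toR (val v))].
Proof.
have [c [C0 [c0 H]]] := wgt_bounds; exists c, C0; split=> //.
  move=> z x Px; have [v [eta [-> qD]]] := chart_discE z.
  rewrite sec_chart//; apply: (le_trans (secn_le_wgt _ Px qD)).
  by have /andP[] := H v _ qD.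
move=> z; have [v [eta [-> qD]]] := chart_discE z; exists v.
rewrite sec_chart; last by apply: polytope_vert; exact: valP.
by rewrite sec_vertex weight_abs; have /andP[] := H v _ qD.
Qed.

(* Squared moduli in the chart of [v] of the point [e^(rho/2 + i theta)]. *)
Definition expq v rho : 'rV[R]_m := \row_j expR (dotp rho (toR (row j (edges P (val v))))).

Lemma exp_coord_neq0 rho theta j : exp_coord rho theta 0 j != 0.
Proof.
rewrite -normsq_eq0 mxE /normsq /= !exprMn -mulrDr cos2Dsin2 mulr1.
by rewrite expf_neq0// gt_eqF// expR_gt0.
Qed.

Lemma normsq_exp_coord rho theta j : normsq (exp_coord rho theta 0 j) = expR (rho 0 j).
Proof.
rewrite mxE /normsq /= !exprMn -mulrDr cos2Dsin2 mulr1 expr2 -expRD.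
by rewrite -splitr.
Qed.

Lemma val_vertex0 : val (vertex0 P) = 0. Proof. by []. Qed.

Lemma torus_chart v (z : 'rV[C]_m) : (forall j, z 0 j != 0) ->
  torus_point P z = chart v (\row_j monomial z (row j (edges P (val v)))).
Proof.
move=> z0; rewrite /torus_point.
set eta := \row_j monomial z (row j (edges P 0)).
have eta0 j : eta 0 j != 0.
  by rewrite mxE; apply/monomial_neq0 => i; left.
rewrite (@chart_change _ _ _ (vertex0 P) v eta); last first.
  by apply/monomial_neq0 => j; left.
congr chart; apply/rowP => i; rewrite !mxE /eta monomial_mul; last by move=> j; left.
congr monomial; exact: edge_coordK.
Qed.

Lemma nsq_torus v rho theta :
  nsq (\row_j monomial (exp_coord rho theta) (row j (edges P (val v)))) = expq v rho.
Proof.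
apply/rowP => j; rewrite !mxE normsq_monomial.
under eq_bigr do rewrite normsq_exp_coord.
rewrite /dotp expR_sum; apply: eq_bigr => i _.
by rewrite expRM !mxE powR_intmul// expR_ge0.
Qed.

Lemma torus_expq v rho theta : exists2 eta,
  torus_point P (exp_coord rho theta) = chart v eta & nsq eta = expq v rho.
Proof.
exists (\row_j monomial (exp_coord rho theta) (row j (edges P (val v)))).
  by apply: torus_chart => j; exact: exp_coord_neq0.
exact: nsq_torus.
Qed.

Lemma chart_torus v eta : (forall j, eta 0 j != 0) ->
  exists rho theta, chart v eta = torus_point P (exp_coord rho theta).
Proof.
move=> eta0.
have uE := edges_unit v.
have [z z0 zE] : exists2 z : 'rV[C]_m, (forall j, z 0 j != 0) &
    \row_j monomial z (row j (edges P (val v))) = eta.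
  exists (\row_i monomial eta (row i (invmx (edges P (val v))))).
    by move=> j; rewrite mxE; apply/monomial_neq0 => i; left.
  exact: monomial_unimodular.
have /choice[th Hth] := fun j => polar (z0 j).
exists (\row_j ln (normsq (z 0 j))), (\row_j th j).
have -> : exp_coord (\row_j ln (normsq (z 0 j))) (\row_j th j) = z.
  apply/rowP => j; rewrite [RHS]Hth /exp_coord !mxE.
  suff -> : expR (ln (normsq (z 0 j)) / 2) = Num.sqrt (normsq (z 0 j)) by [].
  have n0 : 0 < normsq (z 0 j) by rewrite lt_neqAle normsq_ge0 eq_sym normsq_eq0 z0.
  rewrite -[in RHS](lnK n0).
  rewrite {2}(splitr (ln _)) expRD -expr2 sqrtr_sqr ger0_norm// expR_ge0.
by rewrite (torus_chart v z0) zE.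
Qed.

Lemma chart_pos v q : (forall j, 0 < q 0 j) -> exists2 rho, expq v rho = q &
  exists eta, nsq eta = q /\ chart v eta = torus_point P (exp_coord rho 0).
Proof.
move=> q0.
pose rho : 'rV[R]_m := (\row_j ln (q 0 j)) *m (invmx (map_mx intr (edges P (val v))))^T.
have E : expq v rho = q.
  apply/rowP => j; rewrite mxE -[RHS](lnK (q0 j)); congr expR.
  have -> : dotp rho (toR (row j (edges P (val v)))) =
     (rho *m (map_mx intr (edges P (val v)))^T) 0 j.
    by rewrite mxE; apply: eq_bigr => i _; rewrite !mxE.
  by rewrite /rho -mulmxA -trmx_mul mulmxV ?edgesR_unit// trmx1 mulmx1 mxE.
exists rho => //; have [eta H1 H2] := torus_expq v rho 0.
by exists eta; split; [rewrite -E|exact: esym].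
Qed.

Lemma secn_expq v rho x :
  secn h0 v (expq v rho) x = expR (dotp x rho - dotp (toR (val v)) rho) * wgt h0 v (expq v rho).
Proof.
rewrite /secn; congr (_ * _).
rewrite -dotpBl.
have -> : dotp (x - toR (val v)) rho =
   \sum_j dotp rho (toR (row j (edges P (val v)))) * edge_coordR v (x - toR (val v)) 0 j.
  rewrite -{1}[x - _](edge_coordRK v) dotpC mulmx_sum_row dotp_sumr.
  apply: eq_bigr => j _; rewrite dotpZr mulrC; congr (dotp _ _ * _).
  by rewrite /Defs.toR map_row.
by rewrite expR_sum; apply: eq_bigr => j _; rewrite mxE expRM.
Qed.

Lemma lattice0 : lattice_points P 1 0.
Proof. by exists 0; [exact: polytope0|rewrite toR0 scaler0]. Qed.

Lemma polytope_0 : polytope P 0. Proof. exact: polytope0. Qed.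

Lemma phi_openE z : phi_open h0 z = - ln (sec h0 z 0).
Proof.
by rewrite /phi_open section_normsqE ?expr1 ?toR0 ?scaler0//; exact: lattice0.
Qed.

(** The bridge to the Legendre transform: the quantity maximised in [symp_pot] is [ln sec] at a
    point of the open orbit. *)
Lemma sec_torus rho theta x : polytope P x ->
  sec h0 (torus_point P (exp_coord rho theta)) x = expR (dotp x rho - phi_rho h0 rho).
Proof.
move=> Px.
have S y th : polytope P y -> sec h0 (torus_point P (exp_coord rho th)) y =
    expR (dotp y rho) * wgt h0 (vertex0 P) (expq (vertex0 P) rho).
  move=> Py; have [eta -> E] := torus_expq (vertex0 P) rho th.
  by rewrite sec_chart// E secn_expq val_vertex0 toR0 dotp0l subr0.
have -> : phi_rho h0 rho = - ln (wgt h0 (vertex0 P) (expq (vertex0 P) rho)).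
  by rewrite /phi_rho phi_openE [X in ln X](S 0 0 polytope_0) dotp0l expR0 mul1r.
rewrite [LHS](S x theta Px).
by rewrite opprK expRD lnK// posrE wgt_gt0.
Qed.

Lemma phi_open_torus rho theta :
  phi_open h0 (torus_point P (exp_coord rho theta)) = phi_rho h0 rho.
Proof.
by rewrite phi_openE sec_torus ?dotp0l ?sub0r ?expRK ?opprK//; exact: polytope_0.
Qed.

Lemma secn_expqE v rho x : polytope P x ->
  secn h0 v (expq v rho) x = expR (dotp x rho - phi_rho h0 rho).
Proof.
move=> Px; have [eta E <-] := torus_expq v rho 0.
by rewrite -sec_chart// -E sec_torus.
Qed.

Lemma expR_le_exists : exists C0 : R, forall x rho, polytope P x -> dotp x rho - phi_rho h0 rho <= C0.
Proof.
have [c [C0 [c0 HC _]]] := sec_bounds.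
have C0p : 0 < C0.
  have := HC (torus_point P (exp_coord 0 0)) 0 polytope_0.
  by rewrite sec_torus//; [apply: lt_le_trans; rewrite expR_gt0|exact: polytope_0].
exists (ln C0) => x rho Px.
by rewrite -ler_expR lnK// -(sec_torus rho 0 Px) HC.
Qed.

Definition pot x : R := fine (symp_pot h0 x).

Lemma symp_potE x : polytope P x -> symp_pot h0 x = (pot x)%:E.
Proof.
move=> Px; rewrite /pot fineK// fin_numE; apply/andP; split.
  rewrite gt_eqF//; apply: (@lt_le_trans _ _ (dotp x 0 - phi_rho h0 0)%:E); first exact: ltNyr.
  by apply: ereal_sup_ubound; exists 0.
have [C0 HC] := expR_le_exists.
rewrite lt_eqF//; apply: (@le_lt_trans _ _ C0%:E); last exact: ltry.
by apply: ge_ereal_sup => _ [rho _ <-]; rewrite lee_fin HC.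
Qed.

Lemma pot_ge x rho : polytope P x -> dotp x rho - phi_rho h0 rho <= pot x.
Proof.
move=> Px; rewrite -lee_fin -symp_potE//.
by apply: ereal_sup_ubound; exists rho.
Qed.

Lemma pot_le x (c : R) : polytope P x ->
  (forall rho, dotp x rho - phi_rho h0 rho <= c) -> pot x <= c.
Proof.
move=> Px H; rewrite -lee_fin -symp_potE//.
by apply: ge_ereal_sup => _ [rho _ <-]; rewrite lee_fin.
Qed.

Lemma pot_adherent x (e : R) : polytope P x -> 0 < e ->
  exists rho, pot x - e < dotp x rho - phi_rho h0 rho.
Proof.
move=> Px e0; apply: contrapT => H.
have : pot x <= pot x - e.
  by apply: pot_le => // rho; rewrite leNgt; apply/negP => H'; apply: H; exists rho.
by move=> ?; lra.
Qed.


End Potential.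

(** * Norms off the open orbit, and convexity along one-parameter subgroups *)

Section PotentialBound.
Variables (R : realType) (m : nat) (P : delzant R m) (h0 : metric P).
Local Notation C := R[i].
Local Notation toR := (toR R).
Local Notation pot := (pot h0).
Implicit Types (v w : vertex P) (eta : 'rV[C]_m) (q x rho : 'rV[R]_m).

(** When the norm is nonzero, the vanishing coordinates have exponent [0]. Replacing them by a small
    [s > 0] then changes the weight only, which is continuous, and reaches the open orbit. *)
Lemma secn_le_pot v q x : polytope P x -> (forall j, 0 <= q 0 j) ->
  secn h0 v q x <= expR (pot x).
Proof.
move=> Px q0; rewrite leNgt; apply/negP => lt.
have s0 : secn h0 v q x != 0 by rewrite gt_eqF// (lt_trans _ lt)// expR_gt0.
have H := (proj1 (secn_neq0 h0 v q x)) s0.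
pose qs (s : R) : 'rV[R]_m := \row_j (if q 0 j == 0 then s else q 0 j).
have qs0 : qs 0 = q by apply/rowP => j; rewrite mxE; case: eqP.
have cq : {for 0, continuous qs}.
  apply: (@cvg_row R m _ (nbhs (0:R)) (fun j s => if q 0 j == 0 then s else q 0 j) _ (nbhs_filter (0:R))) => j /=.
  by case: eqP => _; [exact: cvg_id|exact: cvg_cst].
have cw : wgt h0 v \o qs @ 0 --> wgt h0 v (qs 0).
  by apply: continuous_comp; [exact: cq|exact: wgt_continuous].
rewrite qs0 in cw.
have E s : secn h0 v (qs s) x = (\prod_j q 0 j `^ edge_coordR v (x - toR (val v)) 0 j) * wgt h0 v (qs s).
  rewrite /secn; congr (_ * _); apply: eq_bigr => j _; rewrite mxE.
  by case: eqP => // e; have [|->] := H j; rewrite ?e ?eqxx// !powRr0.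
have cs : (fun s => secn h0 v (qs s) x) @ 0 --> secn h0 v q x.
  under eq_cvg do rewrite E.
  exact: (cvgM (cvg_cst _) cw).
have [r r0 Hr] : exists2 r, 0 < r & expR (pot x) < secn h0 v (qs r) x.
  have /cvgrPdist_lt/(_ (secn h0 v q x - expR (pot x))) := cs.
  rewrite subr_gt0 => /(_ lt) /nbhs_ballP[d /= d0 Hd].
  exists (d / 2); first by rewrite divr_gt0.
  have := Hd (d / 2); rewrite -ball_normE /= sub0r normrN gtr0_norm ?divr_gt0//.
  rewrite ltr_pdivrMr// mulr_natr mulr2n ltrDl => /(_ d0).
  by move=> /ltr_normlP[_]; rewrite ltrD2l ltrN2.
have [|rho E' _] := @chart_pos _ _ P v (qs r).
  move=> j; rewrite mxE; case: eqP => // /eqP qj; by rewrite lt_neqAle eq_sym qj q0.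
move: Hr; rewrite -E' secn_expqE// ltr_expR ltNge; apply/negP; rewrite negbK.
exact: pot_ge.
Qed.

Lemma sec_le_pot z x : polytope P x -> sec h0 z x <= expR (pot x).
Proof. by move=> Px; apply: secn_le_pot => // j; exact: nsq_ge0. Qed.

(* [- log |s_v|^2] along the curve [q_j e^(c_j t)] in the chart of [v]. *)
Definition curve v q (c : 'rV[R]_m) (t : R) : R :=
  - ln (wgt h0 v (\row_j (q 0 j * expR (c 0 j * t)))).

Lemma curveE v q c t : (forall j, 0 <= q 0 j) ->
  curve v q c t = logw h0 v (\row_j ((\row_k Num.sqrt (q 0 k)) 0 j *
      expR ((\row_k (c 0 k / 2)) 0 j * t)), \row_j 0).
Proof.
move=> q0; rewrite /curve /logw weight_abs; congr (- ln (wgt _ _ _)).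
apply/rowP => j; rewrite !mxE /normsq /= ?mxE expr0n addr0 exprMn sqr_sqrtr//.
rewrite expr2 -expRD -mulrDl -splitr.
by [].
Qed.

(** [D] is the gradient of the potential in logarithmic coordinates. It is chosen before [c], so
    that the initial slope is linear in [c]; [mu_tangent] relies on this. *)
Lemma curve_derive v q : (forall j, 0 <= q 0 j) -> exists D : 'rV[R]_m, forall c,
  exists g1 g2 : R -> R, [/\ forall t, is_derive t (1:R) (curve v q c : R -> R^o) (g1 t),
    forall t, is_derive t (1:R) (g1 : R -> R^o) (g2 t),
    forall t, 0 <= g2 t,
    forall j, q 0 j != 0 -> c 0 j != 0 -> forall t, 0 < g2 t &
    g1 0 = dotp c D].
Proof.
move=> q0; pose r : 'rV[R]_m := \row_k Num.sqrt (q 0 k).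
exists (\row_j (r 0 j / 2 * dRe j (logw h0 v) (r, 0))) => c.
pose c' : 'rV[R]_m := \row_k (c 0 k / 2).
have rot := @logw_rot _ _ _ h0 v.
have C2l := @logw_C2 _ _ _ h0 v.
exists (rad_d1 (logw h0 v) r c'), (rad_d2 (logw h0 v) r c').
have gt0 j t : q 0 j != 0 -> c 0 j != 0 -> 0 < rad_d2 (logw h0 v) r c' t.
  move=> qj cj; apply: (@rad_d2_gt0 _ _ _ h0 v r c' t j).
    by rewrite mxE gt_eqF// sqrtr_gt0 lt_neqAle eq_sym qj q0.
  by rewrite mxE mulf_neq0// invr_eq0.
split.
- move=> t; have -> : curve v q c = fun t => logw h0 v (\row_j (r 0 j * expR (c' 0 j * t)), \row_j 0).
    by apply/funext => s; rewrite curveE.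
  exact: rad_derive1.
- by move=> t; exact: rad_derive2.
- move=> t; have [[j /andP[qj cj]]|H] := pselect (exists j, (q 0 j != 0) && (c 0 j != 0)).
    exact/ltW/(gt0 j).
  rewrite /rad_d2 big1// => j _; rewrite big1// => k _.
  have [->|cj] := eqVneq (c' 0 j) 0; first by rewrite !mul0r.
  have [rj|rj] := eqVneq (r 0 j) 0; first by rewrite rj mul0r mulr0 !mul0r.
  exfalso; apply: H; exists j; apply/andP; split.
    by apply: contraNneq rj => qj; rewrite mxE qj sqrtr0.
  by apply: contraNneq cj => e; rewrite mxE e mul0r.
- by move=> j qj cj t; exact: (gt0 j).
- rewrite /rad_d1 /dotp; apply: eq_bigr => j _.
  have -> : (\row_j0 (r 0 j0 * expR (c' 0 j0 * 0)), \row__ 0) = (r, 0) :> 'rV[R]_m * 'rV[R]_m.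
    by congr pair; apply/rowP => k; rewrite !mxE ?mulr0 ?expR0 ?mulr1.
  rewrite mulr0 expR0 mulr1 [in RHS]mxE [c' 0 j]mxE.
  by rewrite mulrA -!mulrA; congr (_ * _); rewrite mulrCA.
Qed.

End PotentialBound.

(** * Continuity of the potential and the moment map *)

Section UpperSemicontinuity.
Variable R : realType.

(** Stated along a filter in order to serve for product filters restricted to the polydisc and to
    [P]. *)
Definition usc_along T (F : set_system T) (f : T -> R) (l : R) :=
  forall b, l < b -> \forall t \near F, f t < b.

Lemma within_cvg T (F : set_system T) (D : set T) U (f : T -> U) (G : set_system U) :
  Filter F -> f @ F --> G -> f @ within D F --> G.
Proof.
move=> FF fl A GA; have : F (f @^-1` A) by exact: fl.
by move=> FA; apply: (@filterS _ F _ (f @^-1` A)) FA => t.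
Qed.

Lemma cvg_usc T (F : set_system T) {FF : Filter F} (f : T -> R) (l : R) :
  f @ F --> l -> usc_along F f l.
Proof.
move=> fl b lb; have /cvgrPdist_lt/(_ (b - l)) := fl.
rewrite subr_gt0 => /(_ lb); apply: filterS => t.
by rewrite distrC => /ltr_normlP[]; rewrite ltrD2r.
Qed.

Lemma uscM T (F : set_system T) {FF : Filter F} (f g : T -> R) (a b : R) :
  (forall t, 0 <= f t) -> (forall t, 0 <= g t) -> 0 <= a -> 0 <= b ->
  usc_along F f a -> usc_along F g b -> usc_along F (fun t => f t * g t) (a * b).
Proof.
move=> f0 g0 a0 b0 uf ug c abc.
(* With [e <= 1], [(a + e) * (b + e) <= a * b + e * (a + b + 1)], and [e * (a + b + 2) <= c - a * b]
   keeps this below [c]. *)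
pose e := Num.min 1 ((c - a * b) / (a + b + 2)).
have ab2 : 0 < a + b + 2 by rewrite ltr_wpDl// addr_ge0.
have e0 : 0 < e by rewrite lt_min ltr01 divr_gt0// subr_gt0.
have e1 : e <= 1 by rewrite ge_min lexx.
have e2 : e * (a + b + 2) <= c - a * b.
  by rewrite -ler_pdivlMr// ge_min lexx orbT.
have fa : \forall t \near F, f t < a + e by apply: uf; rewrite ltrDl.
have gb : \forall t \near F, g t < b + e by apply: ug; rewrite ltrDl.
near=> t.
have ft : f t < a + e by near: t.
have gt : g t < b + e by near: t.
apply: (@le_lt_trans _ _ ((a + e) * (b + e))).
  by apply: ler_pM => //; exact: ltW.
nra.
Unshelve. all: by end_near. Qed.

Lemma usc_prod T (F : set_system T) {FF : Filter F} n (f : 'I_n -> T -> R) (a : 'I_n -> R) :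
  (forall i t, 0 <= f i t) -> (forall i, 0 <= a i) ->
  (forall i, usc_along F (f i) (a i)) -> usc_along F (fun t => \prod_i f i t) (\prod_i a i).
Proof.
move=> f0 a0 uf; elim: (index_enum _) => [|i r IH].
  rewrite big_nil => b b1; apply: filterE => t; by rewrite big_nil.
rewrite big_cons => b bb.
have p1 t : 0 <= \prod_(j <- r) f j t by exact: prodr_ge0.
have p2 : 0 <= \prod_(j <- r) a j by exact: prodr_ge0.
have /(_ FF) := uscM (f0 i) p1 (a0 i) p2 (uf i) IH bb.
by apply: filterS => t; rewrite big_cons.
Qed.

Lemma powR_cvg T (F : set_system T) {FF : Filter F} (x e : T -> R) (x0 e0 : R) :
  x @ F --> x0 -> e @ F --> e0 -> 0 < x0 -> (fun t => x t `^ e t) @ F --> x0 `^ e0.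
Proof.
move=> cx ce x0p.
have xp : \forall t \near F, 0 < x t.
  have /cvgrPdist_lt/(_ x0 x0p) := cx; apply: filterS => t.
  by move=> /ltr_normlP[_]; rewrite ltrBlDl -ltrBlDr subrr.
have E : {near F, (fun t => expR (e t * ln (x t))) =1 (fun t => x t `^ e t)}.
  by apply: filterS xp => t xt; rewrite /powR gt_eqF.
rewrite /powR gt_eqF//.
apply: (cvg_trans (near_eq_cvg E)).
apply: cvg_comp; last exact: continuous_expR.
apply: cvgM => //.
by apply: cvg_comp cx _; exact: continuous_ln.
Qed.

Lemma powR_le1 (x e : R) : 0 <= x <= 1 -> 0 <= e -> x `^ e <= 1.
Proof.
move=> /andP[x0 x1] e0; have <- : 1 `^ e = 1 by rewrite powR1.
by rewrite ge0_ler_powR// nnegrE.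
Qed.

Lemma powR_anti (x e f : R) : 0 <= x <= 1 -> 0 < e -> e <= f -> x `^ f <= x `^ e.
Proof.
move=> x01 e0 ef.
rewrite -(subrK e f) powR_add_ge0 ?subr_ge0 ?(ltW e0)//.
by rewrite ler_piMl ?powR_ge0// powR_le1// subr_ge0.
Qed.

(* With the convention [0 ^ 0 = 1], [x ^ e] is only upper semicontinuous at [(0, 0)]. *)
Lemma powR_usc T (F : set_system T) {FF : Filter F} (x e : T -> R) (x0 e0 : R) :
  x @ F --> x0 -> e @ F --> e0 -> 0 <= x0 -> 0 <= e0 ->
  (\forall t \near F, 0 <= x t) -> (\forall t \near F, 0 <= e t) ->
  usc_along F (fun t => x t `^ e t) (x0 `^ e0).
Proof.
move=> cx ce x00 e00 nx ne.
have [x0p|x0p] := ltP 0 x0.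
  by apply: cvg_usc; exact: powR_cvg.
have {x00 x0p} x0E : x0 = 0 by apply/eqP; rewrite eq_le x0p.
rewrite x0E in cx *.
have xlt d : 0 < d -> \forall t \near F, x t < d.
  move=> d0; have /cvgrPdist_lt/(_ d d0) := cx; apply: filterS => t.
  by rewrite sub0r normrN => /ltr_normlP[].
move=> b; have [->|e0n] := eqVneq e0 0.
  rewrite powRr0 => b1; near=> t.
  apply: le_lt_trans b1; apply: powR_le1; last by near: t.
  apply/andP; split; first by near: t.
  by apply: ltW; near: t; exact: xlt.
have e0p : 0 < e0 by rewrite lt_neqAle eq_sym e0n.
rewrite powR0// => b0.
have e2 : 0 < e0 / 2 by rewrite divr_gt0.
have ne2 : \forall t \near F, e0 / 2 < e t.
  have /cvgrPdist_lt/(_ _ e2) := ce; apply: filterS => t.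
  by move=> /ltr_normlP[_]; rewrite ltrBlDl -ltrBlDr {1}(splitr e0) addrK.
near=> t.
have t0 : 0 <= x t by near: t.
apply: (@le_lt_trans _ _ (x t `^ (e0 / 2))).
  apply: powR_anti => //; last by apply: ltW; near: t.
  by rewrite t0; apply: ltW; near: t; exact: xlt.
have -> : b = (b `^ (e0 / 2)^-1) `^ (e0 / 2).
  by rewrite -powRrM mulVf ?gt_eqF// powRr1// ltW.
apply: gt0_ltr_powR; rewrite ?nnegrE ?powR_ge0//.
by near: t; apply: xlt; rewrite powR_gt0.
Unshelve. all: by end_near. Qed.

End UpperSemicontinuity.

(** * Continuity of the potential on the polytope *)

Section PotentialContinuity.
Variables (R : realType) (m : nat) (P : delzant R m) (h0 : metric P).
Local Notation C := R[i].
Local Notation toR := (toR R).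
Local Notation pot := (pot h0).
Implicit Types (v w : vertex P) (eta : 'rV[C]_m) (q x rho : 'rV[R]_m).

Lemma polytope_compact : compact (polytope P).
Proof.
have -> : polytope P = cvx [set: 'I_(size (verts P))]%SET (fun i => toR (nth 0 (verts P) i)).
  apply/seteqP; split => x.
    by move=> [t [t0 t1 xE]]; exists t; split => // i; rewrite inE.
  by move=> [t [t0 _ t1 xE]]; exists t.
exact: compact_cvx.
Qed.

Lemma polytope_convex y z (t : R) : polytope P y -> polytope P z -> 0 <= t <= 1 ->
  polytope P (y + t *: (z - y)).
Proof.
move=> Py Pz /andP[t0 t1].
have -> : y + t *: (z - y) = (1 - t) *: y + (1 - (1 - t)) *: z.
  by rewrite subKr scalerBr scalerBl scale1r addrA addrAC.
by apply: polytope_seg => //; rewrite subr_ge0 t1 gerBl t0.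
Qed.

Lemma polytope_closed : closed (polytope P).
Proof. by apply: compact_closed; [exact: norm_hausdorff|exact: polytope_compact]. Qed.

Lemma cvg_coord n T (F : set_system T) {FF : Filter F} (f : T -> 'rV[R]_n) (l : 'rV[R]_n) j :
  f @ F --> l -> (fun t => f t 0 j) @ F --> l 0 j.
Proof.
move=> fl; apply: (@cvg_comp _ _ _ f (fun q : 'rV[R]_n => q 0 j) F (nbhs l) _ fl).
exact: coord_continuous.
Qed.

Lemma cvg_dotp T (F : set_system T) {FF : Filter F} (f : T -> 'rV[R]_m) (l rho : 'rV[R]_m) :
  f @ F --> l -> (fun t => dotp (f t) rho) @ F --> dotp l rho.
Proof.
move=> fl; apply: cvg_big; first exact: add_continuous.
by move=> j _; apply: cvgM; [exact: cvg_coord|exact: cvg_cst].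
Qed.

Lemma cvg_edge_coordR T (F : set_system T) {FF : Filter F} (f : T -> 'rV[R]_m) (l : 'rV[R]_m) v j :
  f @ F --> l -> (fun t => edge_coordR v (f t - toR (val v)) 0 j) @ F --> edge_coordR v (l - toR (val v)) 0 j.
Proof.
move=> fl; rewrite /edge_coordR mxE; under eq_cvg do rewrite mxE.
apply: cvg_big; first exact: add_continuous.
move=> k _; apply: cvgM; last exact: cvg_cst.
by apply: cvg_coord; apply: cvgB; [exact: fl|exact: cvg_cst].
Qed.

Lemma secn_usc T (F : set_system T) {FF : Filter F} v (Q X : T -> 'rV[R]_m) q x :
  Q @ F --> q -> X @ F --> x -> (forall j, 0 <= q 0 j) -> polytope P x ->
  (\forall t \near F, forall j, 0 <= Q t 0 j) -> (\forall t \near F, polytope P (X t)) ->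
  usc_along F (fun t => secn h0 v (Q t) (X t)) (secn h0 v q x).
Proof.
move=> cQ cX q0 Px nQ nX; apply: uscM.
- by move=> t; apply: prodr_ge0 => j _; exact: powR_ge0.
- by move=> t; exact/ltW/wgt_gt0.
- by apply: prodr_ge0 => j _; exact: powR_ge0.
- exact/ltW/wgt_gt0.
- apply: usc_prod => [j t|j|j]; try exact: powR_ge0.
  apply: powR_usc.
  + exact: cvg_coord.
  + exact: cvg_edge_coordR.
  + exact: q0.
  + exact: edge_cone.
  + by apply: filterS nQ => t; exact.
  + by apply: filterS nX => t; exact: edge_cone.
- apply: cvg_usc; apply: (@cvg_comp _ _ _ Q (wgt h0 v) F (nbhs q) _ cQ).
  exact: wgt_continuous.
Qed.

Lemma disc_nsq v q x : polytope P x -> disc q -> exists z, secn h0 v q x = sec h0 z x.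
Proof.
move=> Px qD; exists (chart v (\row_j (Num.sqrt (q 0 j))%:C%C)).
rewrite sec_chart//; congr secn; apply/rowP => j; rewrite !mxE normsq_real sqr_sqrtr//.
by have := qD j; rewrite in_itv => /andP[].
Qed.

Lemma sec_disc z x : polytope P x -> exists v q, disc q /\ sec h0 z x = secn h0 v q x.
Proof.
by move=> Px; have [v [eta [-> qD]]] := chart_discE z; exists v, (nsq eta); rewrite sec_chart.
Qed.

Lemma disc_ge0 q : disc q -> forall j, 0 <= q 0 j.
Proof. by move=> qD j; have := qD j; rewrite in_itv => /andP[]. Qed.

(** Upper semicontinuity spreads the strict inequality to a neighbourhood of each [q], and
    compactness of the polydisc makes the neighbourhood in [i] uniform. A variable [X] with constant
    [b] yields [pot_usc]; a constant [X] with variable [b] yields [sec_attained]. *)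
Lemma near_secn_lt I (F : set_system I) {FF : Filter F} (X : I -> 'rV[R]_m) (b : I -> R) x b0 :
  X @ F --> x -> polytope P x -> (\forall i \near F, polytope P (X i)) ->
  (b @ F --> b0) -> (forall v q, disc q -> secn h0 v q x < b0) ->
  \forall i \near F, forall z, sec h0 z (X i) < b i.
Proof.
move=> cX Px nX cb H.
have Hv v : \forall i \near F, forall q, disc q -> secn h0 v q (X i) < b i.
  apply: (proj2 (near_covering_withinP _) (proj1 (compact_near_coveringP _) (@disc_compact R m))) => q qD.
  pose G := filter_prod (nbhs q) F.
  have lt := H v q qD; pose mid := (secn h0 v q x + b0) / 2.
  have m1 : secn h0 v q x < mid by rewrite /mid; lra.
  have m2 : mid < b0 by rewrite /mid; lra.
  have nb : \forall i \near F, mid < b i.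
    have /cvgrPdist_lt/(_ (b0 - mid)) := cb.
    rewrite subr_gt0 => /(_ m2); apply: filterS => i /ltr_normlP[_].
    by rewrite ltrD2l ltrN2.
  have FG : Filter G by exact: filter_prod_filter.
  have c1 : (fun p : 'rV[R]_m * I => p.1) @ G --> q by exact: cvg_fst.
  pose G' := within [set p : 'rV[R]_m * I | disc p.1] G.
  have FG' : Filter G' by exact: within_filter.
  have cQ : (fun p : 'rV[R]_m * I => p.1) @ G' --> q by exact: within_cvg c1.
  have cX2 : (fun p : 'rV[R]_m * I => X p.2) @ G' --> x.
    by apply: within_cvg; apply: (@cvg_comp _ _ _ snd X G F); [exact: cvg_snd|].
  have Q0 : G' (fun p : 'rV[R]_m * I => forall j, 0 <= p.1 0 j).
    by rewrite /G' /within /=; apply: filterE => p pD j; exact: disc_ge0.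
  have nsnd (A : set I) : F A -> G' (fun p => A p.2).
    move=> FA; have : G (fun p : 'rV[R]_m * I => A p.2).
      exists (setT, A); first by split => //; exact: filterT.
      by move=> [a i] [].
    by apply: filterS => p.
  have PX : G' (fun p : 'rV[R]_m * I => polytope P (X p.2)) by exact: nsnd nX.
  have := @secn_usc _ G' FG' v fst (fun p => X p.2) q x cQ cX2 (disc_ge0 qD) Px Q0 PX mid m1.
  move=> U.
  have nb2 : G' (fun p : 'rV[R]_m * I => mid < b p.2) by exact: nsnd nb.
  have H3 : G' ((fun p => secn h0 v p.1 (X p.2) < mid) `&` (fun p => mid < b p.2)) by exact: filterI.
  have H4 : G (fun p => disc p.1 -> secn h0 v p.1 (X p.2) < b p.2).
    by apply: (@filterS _ G _ _ _ _ H3) => p /= H' pD; have [h1 h2] := H' pD; exact: (lt_trans h1 h2).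
  exact: H4.
have : \forall i \near F, forall v q, disc q -> secn h0 v q (X i) < b i.
  exact: filter_forall.
have := nX; apply: filterS2 => i PXi Hi z.
by have [v [q [qD ->]]] := sec_disc z PXi; exact: Hi.
Qed.

Lemma secn_disc_le_pot v q x : polytope P x -> disc q -> secn h0 v q x <= expR (pot x).
Proof. by move=> Px qD; apply: secn_le_pot => // j; exact: disc_ge0. Qed.

Lemma pot_le_sec x (b : R) : polytope P x -> 0 < b -> (forall z, sec h0 z x <= b) -> pot x <= ln b.
Proof.
move=> Px b0 H; apply: pot_le => // rho.
by rewrite -ler_expR lnK// -(sec_torus h0 rho 0 Px).
Qed.

Lemma pot_usc x e : polytope P x -> 0 < e ->
  \forall y \near x, polytope P y -> pot y <= pot x + e.
Proof.
move=> Px e0.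
pose F := within (polytope P) (nbhs x).
have FF : Filter F by exact: within_filter.
have c1 : id @ F --> x by apply: within_cvg; exact: cvg_id.
have nP : \forall y \near F, polytope P (id y) by rewrite near_withinE; exact: filterE.
have c2 : (fun _ : 'rV[R]_m => expR (pot x + e)) @ F --> expR (pot x + e) by exact: cvg_cst.
have H v q : disc q -> secn h0 v q x < expR (pot x + e).
  move=> qD; apply: (le_lt_trans (secn_disc_le_pot v Px qD)).
  by rewrite ltr_expR ltrDl.
have /(_ FF) := near_secn_lt c1 Px nP c2 H.
rewrite near_withinE; apply: filterS => y Hy Py.
rewrite -[leRHS]expRK; apply: pot_le_sec => //; first exact: expR_gt0.
by move=> z; apply: ltW; exact: Hy.
Qed.

(** [pot] is a supremum of affine functions: a [rho] nearly optimal at [x] still serves nearby. *)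
Lemma pot_lsc x e : polytope P x -> 0 < e ->
  \forall y \near x, polytope P y -> pot x - e <= pot y.
Proof.
move=> Px e0; have [rho Hrho] := pot_adherent h0 Px e0.
have cd : (fun y => dotp y rho) @ x --> dotp x rho.
  by apply: (@cvg_dotp _ (nbhs x) (nbhs_filter x) id x rho); exact: cvg_id.
pose d := dotp x rho - phi_rho h0 rho - (pot x - e).
have d0 : 0 < d by rewrite subr_gt0.
have /cvgrPdist_lt/(_ d d0) := cd; apply: filterS => y /ltr_normlP[_ lt] Py.
apply: le_trans (pot_ge h0 rho Py).
by move: lt; rewrite /d => ?; lra.
Qed.

(** If all values were strictly smaller, [near_secn_lt] would keep them uniformly below
    [expR (pot x) - e], against the definition of [pot] as a supremum. *)
Lemma sec_attained x : polytope P x -> exists z, sec h0 z x = expR (pot x).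
Proof.
move=> Px; apply: contrapT => H.
have lt z : sec h0 z x < expR (pot x).
  rewrite lt_neqAle sec_le_pot// andbT; apply/eqP => e; apply: H; by exists z.
pose F := (0:R)^'+.
have FPF : ProperFilter F by exact: at_right_proper_filter.
have FF : Filter F by exact: filter_filter.
have c1 : (fun _ : R => x) @ F --> x by exact: cvg_cst.
have nP : \forall e \near F, polytope P x by exact: filterE.
have c2 : (fun e : R => expR (pot x) - e) @ F --> expR (pot x) - 0.
  apply: cvgB; first exact: cvg_cst.
  exact: cvg_within.
have Hq v q : disc q -> secn h0 v q x < expR (pot x) - 0.
  by move=> qD; rewrite subr0; have [z ->] := disc_nsq v Px qD; exact: lt.
have near1 : \forall e \near F, forall z, sec h0 z x < expR (pot x) - e by exact: near_secn_lt c1 Px nP c2 Hq.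
have near2 : \forall e \near F, 0 < e by exact: nbhs_right_gt.
have [e [He e0]] : exists e : R, (forall z, sec h0 z x < expR (pot x) - e) /\ 0 < e.
  exact: filter_ex (filterI near1 near2).
have ee : 0 < expR (pot x) - e.
  have := He (torus_point P (exp_coord 0 0)); apply: le_lt_trans; exact: sec_ge0.
have := pot_le_sec Px ee (fun z => ltW (He z)).
rewrite -ler_expR lnK// => ?; lra.
Qed.

End PotentialContinuity.

Lemma growth_arith (R : realType) (lc a b d f f' C K : R) : lc <= a + b - f' ->
  f + d <= f' -> a - f <= C -> K <= d - b -> K <= C - lc.
Proof. by move=> *; lra. Qed.

Lemma tangent_arith (R : realType) (a a' f f' : R) : f + (a' - a) <= f' -> a' - f' <= a - f.
Proof. by move=> *; lra. Qed.

(** * The moment map as a zero of the rate *)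

Section MomentMap.
Variables (R : realType) (m : nat) (P : delzant R m) (h0 : metric P).
Variables (mu0 : toric P -> 'rV[R]_m) (hmu0 : is_moment_map h0 mu0).
Local Notation C := R[i].
Local Notation toR := (toR R).
Local Notation pot := (pot h0).
Implicit Types (v w : vertex P) (eta : 'rV[C]_m) (q x rho : 'rV[R]_m).

Lemma phi_rhoE rho : phi_rho h0 rho = - ln (wgt h0 (vertex0 P) (expq (vertex0 P) rho)).
Proof.
have := secn_expqE h0 (vertex0 P) rho (polytope_0 P).
rewrite secn_expq val_vertex0 toR0 !dotp0l subr0 expR0 mul1r sub0r => ->.
by rewrite expRK opprK.
Qed.

Lemma phi_rho_curve rho c t : phi_rho h0 (rho + t *: c) =
  curve h0 (vertex0 P) (expq (vertex0 P) rho)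
    (\row_j dotp c (toR (row j (edges P (val (vertex0 P)))))) t.
Proof.
rewrite phi_rhoE /curve; congr (- ln (wgt _ _ _)); apply/rowP => j.
by rewrite !mxE dotpDl dotpZl expRD mulrC [t * _]mulrC mulrC.
Qed.

(** [is_moment_map] fixes only the slopes in the coordinate directions; as slopes are linear in the
    direction by [curve_derive], [mu0] represents all of them, and convexity puts [phi_rho] above
    its tangents. *)
Lemma mu_tangent rho theta c :
  phi_rho h0 rho + dotp c (mu0 (torus_point P (exp_coord rho theta))) <= phi_rho h0 (rho + c).
Proof.
have q0 : forall j, 0 <= expq (vertex0 P) rho 0 j by move=> j; rewrite mxE expR_ge0.
have [D HD] := curve_derive h0 (vertex0 P) q0.
pose k c := \row_j dotp c (toR (row j (edges P (val (vertex0 P))))) : 'rV[R]_m.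
have muE j : mu0 (torus_point P (exp_coord rho theta)) 0 j = dotp (k (delta_mx 0 j)) D.
  have [_ ->] := hmu0.
  have [g1 [g2 [d1 _ _ _ <-]]] := HD (k (delta_mx 0 j)).
  suff : is_derive rho (delta_mx 0 j : 'rV[R]_m) (phi_rho h0 : _ -> R^o) (g1 0) by case.
  apply/is_derive_lineP.
  have -> : (fun h : R => phi_rho h0 (rho + h *: delta_mx 0 j) : R^o) =
    curve h0 (vertex0 P) (expq (vertex0 P) rho) (k (delta_mx 0 j)).
    by apply/funext => t; rewrite phi_rho_curve.
  exact: d1.
have -> : dotp c (mu0 (torus_point P (exp_coord rho theta))) = dotp (k c) D.
  rewrite {1}/dotp; under eq_bigr do rewrite muE /dotp mulr_sumr.
  rewrite exchange_big /= /dotp; apply: eq_bigr => i _.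
  under eq_bigr do rewrite mulrA; rewrite -mulr_suml; congr (_ * _).
  rewrite mxE /dotp; apply: eq_bigr => j _; rewrite mxE /dotp (bigD1 j)//= big1.
    by rewrite addr0 !mxE !eqxx mul1r.
  by move=> l lj; rewrite !mxE (negbTE lj) andbF mul0r.
have [g1 [g2 [d1 d2 g2_0 _ <-]]] := HD (k c).
have := convex_tangent 0 1 d1 d2 g2_0.
by rewrite -!phi_rho_curve scale0r scale1r addr0 subr0 mulr1.
Qed.

(** If [mu0] left [P], a separating [l] would make [phi_rho] grow along [l] faster than every vertex
    pairing, while by [sec_bounds] some vertex section keeps norm at least [c]. *)
Lemma mu_torus_polytope rho theta : polytope P (mu0 (torus_point P (exp_coord rho theta))).
Proof.
set x := mu0 _; apply: contrapT => Px.
have [l Hl] := separation (@polytope_compact R m P) (@polytope_convex _ _ P) Px.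
have [c [_ [c0 _ Hc]]] := sec_bounds h0.
have [C0 HC] := expR_le_exists h0.
pose gap := \big[Num.min/1]_(v : vertex P) (dotp l x - dotp l (toR (val v))).
have gapv v : gap <= dotp l x - dotp l (toR (val v)).
  by rewrite /gap (bigD1 v)//= ge_min lexx.
have gap0 : 0 < gap.
  rewrite /gap; elim/big_ind: _ => // [a b a0 b0|v _]; first by rewrite lt_min a0.
  by rewrite subr_gt0 Hl//; apply: polytope_vert; exact: valP.
(* [K] exceeds [C0 - ln c], and [t] is large enough for the separation gap to produce an excess of
   [K]. *)
pose K := `|C0 - ln c| + 1.
have K0 : 0 < K by rewrite ltr_wpDl.
pose t := K / gap.
have t0 : 0 < t by rewrite divr_gt0.
have [v] := Hc (torus_point P (exp_coord (rho + t *: l) 0)).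
have Pv : polytope P (toR (val v)) by apply: polytope_vert; exact: valP.
rewrite sec_torus// -[c]lnK// ler_expR dotpC dotpDl dotpZl => H1.
have H2 := mu_tangent rho theta (t *: l).
rewrite -/x dotpZl in H2.
have H3 := HC (toR (val v)) rho Pv.
rewrite dotpC in H3.
have H4 : K <= t * (dotp l x - dotp l (toR (val v))).
  apply: (@le_trans _ _ (t * gap)); first by rewrite /t divfK ?gt_eqF.
  by rewrite ler_wpM2l ?(ltW t0).
have H5 : C0 - ln c < K by rewrite /K ltr_pwDr// ler_norm.
rewrite mulrBr in H4.
by have := growth_arith H1 H2 H3 H4; rewrite leNgt H5.
Qed.

(** The tangent inequality says that [rho] itself maximises [dotp x rho - phi_rho rho]. *)
Lemma mu_torus_pot rho theta :
  let x := mu0 (torus_point P (exp_coord rho theta)) in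
  pot x = dotp x rho - phi_rho h0 rho.
Proof.
move=> x; have Px : polytope P x by exact: mu_torus_polytope.
apply: le_anti; apply/andP; split; last exact: pot_ge.
apply: (pot_le Px) => rho'.
have H := mu_tangent rho theta (rho' - rho).
rewrite -/x dotpBl in H.
have E : rho + (rho' - rho) = rho' by rewrite addrC subrK.
rewrite E (dotpC rho') (dotpC rho) in H.
exact: tangent_arith H.
Qed.

(** Approach from the open orbit. Continuity of [mu0] and closedness of [P] give the first half. For
    the second, fix [rho]: were [dotp (mu0 z) rho - phi_rho rho] above [ln (sec z (mu0 z))], upper
    semicontinuity would keep a strict gap at nearby torus points, against [mu_torus_pot] and
    [pot_ge]. *)
Lemma mu_polytope_sec z : polytope P (mu0 z) /\ sec h0 z (mu0 z) = expR (pot (mu0 z)).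
Proof.
rewrite -(coordsK z); set v := (coords z).1; set eta := (coords z).2.
(* The vanishing coordinates are replaced by the real number [s], so that [s > 0] lies in the open
   orbit. *)
pose p (s : R) : 'rV[R]_m * 'rV[R]_m :=
  (\row_j (if eta 0 j == 0 then s else complex.Re (eta 0 j)), \row_j complex.Im (eta 0 j)).
have pE s j : cplx (p s) 0 j = if eta 0 j == 0 then s%:C%C else eta 0 j.
  rewrite !mxE /=; case: eqP => [->|_] //.
  by case: (eta 0 j).
have p0 : cplx (p 0) = eta.
  by apply/rowP => j; rewrite pE; case: eqP.
have cp : {for 0, continuous p}.
  have c1 : (fun s : R => \row_j (if eta 0 j == 0 then s else complex.Re (eta 0 j)) : 'rV[R]_m) @ (0:R) -->
     (\row_j (if eta 0 j == 0 then 0 else complex.Re (eta 0 j)) : 'rV[R]_m).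
    apply: (@cvg_row R m _ (nbhs (0:R)) (fun j s => if eta 0 j == 0 then s else complex.Re (eta 0 j)) _ (nbhs_filter (0:R))) => j.
    by case: eqP => _; [exact: cvg_id|exact: cvg_cst].
  have c2 := @cst_continuous R 'rV[R]_m (\row_j complex.Im (eta 0 j)) (0:R).
  exact: (cvg_pair c1 c2).
have cmu : (fun s => mu0 (chart v (cplx (p s)))) @ (0:R) --> mu0 (chart v eta).
  rewrite -[X in chart v X]p0; have [cm _] := hmu0.
  exact: (continuous_comp cp (cm v _)).
pose F := (0:R)^'+.
have FPF : ProperFilter F by exact: at_right_proper_filter.
have FF : Filter F by exact: filter_filter.
have cmuF : (fun s => mu0 (chart v (cplx (p s)))) @ F --> mu0 (chart v eta).
  exact: within_cvg cmu.
have pos : \forall s \near F, 0 < s by exact: nbhs_right_gt.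
have tor s : 0 < s -> exists rho theta, chart v (cplx (p s)) = torus_point P (exp_coord rho theta).
  move=> s0; apply: chart_torus => j; rewrite pE; case: ifPn => // _.
  by rewrite eq_complex /= eqxx andbT gt_eqF.
have nP : \forall s \near F, polytope P (mu0 (chart v (cplx (p s)))).
  apply: filterS pos => s /tor[rho [theta ->]]; exact: mu_torus_polytope.
have Pmu : polytope P (mu0 (chart v eta)).
  apply: (@closed_cvg _ _ F FPF (fun s => mu0 (chart v (cplx (p s)))) (polytope P)) cmuF => //.
  exact: polytope_closed.
split=> //; apply/eqP; rewrite eq_le sec_le_pot//=.
have cn : (fun s => nsq (cplx (p s))) @ F --> nsq eta.
  apply: within_cvg; rewrite -[X in _ --> nsq X]p0.
  have E s : nsq (cplx (p s)) = \row_j (if eta 0 j == 0 then s * s else normsq (eta 0 j)).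
    apply/rowP => j; rewrite mxE [RHS]mxE pE; case: eqP => // _.
    by rewrite normsq_real expr2.
  rewrite E; under eq_cvg do rewrite E.
  apply: (@cvg_row R m _ (nbhs (0:R)) (fun j s => if eta 0 j == 0 then s * s else normsq (eta 0 j)) _ (nbhs_filter (0:R))) => j.
  by case: eqP => _; [apply: cvgM; exact: cvg_id|exact: cvg_cst].
(* One [rho] at a time, as [pot] is a supremum; positivity is carried along so that [ln] can be
   undone. *)
suff H rho : dotp (mu0 (chart v eta)) rho - phi_rho h0 rho <= ln (sec h0 (chart v eta) (mu0 (chart v eta))) /\
    0 < sec h0 (chart v eta) (mu0 (chart v eta)).
  have [_ s0] := H 0.
  rewrite -[leRHS]lnK// ler_expR; apply: pot_le => // rho; by have [] := H rho.
suff H1 : expR (dotp (mu0 (chart v eta)) rho - phi_rho h0 rho) <= sec h0 (chart v eta) (mu0 (chart v eta)).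
  have s0 : 0 < sec h0 (chart v eta) (mu0 (chart v eta)) by apply: lt_le_trans H1; exact: expR_gt0.
  by split=> //; rewrite -ler_expR lnK.
rewrite leNgt; apply/negP; rewrite sec_chart// => lt.
set a := expR _ in lt; set b := secn _ _ _ _ in lt.
pose mid := (a + b) / 2.
have m1 : b < mid by rewrite /mid; lra.
have m2 : mid < a by rewrite /mid; lra.
have n0 : \forall s \near F, forall j, 0 <= nsq (cplx (p s)) 0 j.
  by apply: filterE => s; exact: nsq_ge0.
have /(_ FF) n1 := secn_usc cn cmuF (nsq_ge0 eta) Pmu n0 nP m1.
have ca : (fun s => expR (dotp (mu0 (chart v (cplx (p s)))) rho - phi_rho h0 rho)) @ F --> a.
  apply: cvg_comp; last exact: continuous_expR.
  by apply: cvgB; [exact: cvg_dotp|exact: cvg_cst].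
have n2 : \forall s \near F, mid < expR (dotp (mu0 (chart v (cplx (p s)))) rho - phi_rho h0 rho).
  have /cvgrPdist_lt/(_ (a - mid)) := ca.
  by rewrite subr_gt0 => /(_ m2); apply: filterS => s /ltr_normlP[_]; rewrite ltrD2l ltrN2.
have [s [[[h1 h2] h3] h4]] := filter_ex (filterI (filterI (filterI n1 n2) pos) nP).
have [rho' [theta E]] := tor s h3.
have h5 : secn h0 v (nsq (cplx (p s))) (mu0 (chart v (cplx (p s)))) =
   expR (pot (mu0 (chart v (cplx (p s))))).
  rewrite -(sec_chart h0 v _ h4) E (sec_torus h0 rho' theta (mu_torus_polytope rho' theta)).
  by rewrite mu_torus_pot.
move: h1; rewrite h5 => h1.
have := lt_trans h1 h2; rewrite ltNge ler_expR => /negP; apply.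
exact: pot_ge.
Qed.

End MomentMap.

(** * The [L^2] norms of the monomials *)

Section IteratedIntegral.
Variable R : realType.
Local Open Scope ereal_scope.

(* The integral of a nonnegative function is a supremum over simple functions
   below it, so it is monotone even without measurability. *)
Lemma integral_mono (f g : R -> \bar R) : (forall x, 0 <= f x) -> (forall x, f x <= g x) ->
  \int[@lebesgue_measure R]_(x in setT) f x <= \int[@lebesgue_measure R]_(x in setT) g x.
Proof.
move=> f0 fg; have g0 x : 0 <= g x by exact: le_trans (f0 x) (fg x).
rewrite !ge0_integralTE//.
apply: ereal_sup_le => _ /= [h hf <-]; exists h => // x.
exact: le_trans (hf x) (fg x).
Qed.

Lemma lebesgue_int_ge0 n (f : 'rV[R]_n -> \bar R) : (forall x, 0 <= f x) ->
  0 <= lebesgue_int f.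
Proof.
elim: n f => [|n IH] f f0 /=; first exact: f0.
by apply: integral_ge0 => t _; exact: IH.
Qed.

Lemma lebesgue_int_mono n (f g : 'rV[R]_n -> \bar R) : (forall x, 0 <= f x) ->
  (forall x, f x <= g x) -> lebesgue_int f <= lebesgue_int g.
Proof.
elim: n f g => [|n IH] f g f0 fg /=; first exact: fg.
by apply: integral_mono => t; [exact: lebesgue_int_ge0|exact: IH].
Qed.

Local Close Scope ereal_scope.

Definition cube n (u : 'rV[R]_n) (r : R) : set 'rV[R]_n :=
  [set x | forall j, (`|x 0 j - u 0 j| <= r)%R].

Lemma lebesgue_int_cube n (u : 'rV[R]_n) (r c : R) : (0 <= r)%R -> (0 <= c)%R ->
  lebesgue_int (fun x => (c * \1_(cube u r) x)%:E) = (c * (2 * r) ^+ n)%:E.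
Proof.
move=> r0; elim: n u c => [|n IH] u c c0 /=.
  rewrite expr0; congr (_ * _)%:E; rewrite indicE mem_set// => j.
  by have := ltn_ord j.
pose u' : 'rV[R]_n := \row_j u 0 (lift 0 j).
have E (t : R) (x : 'rV[R]_n) : (\1_(cube u r) (row_mx (t%:M : 'rV[R]_1) x : 'rV[R]_(1 + n)) : R) =
   (\1_(`[u 0 0 - r, u 0 0 + r]%classic) t * \1_(cube u' r) x)%R.
  rewrite !indicE -natrM mulnb; congr (_%:R : R)%R; congr nat_of_bool.
  have e0 : (row_mx (t%:M : 'rV[R]_1) x : 'rV[R]_(1 + n)) 0 0 = t.
    have -> : (0 : 'I_(1 + n)) = lshift n 0 by apply/val_inj.
    by rewrite row_mxEl mxE eqxx mulr1n.
  have e1 j : (row_mx (t%:M : 'rV[R]_1) x : 'rV[R]_(1 + n)) 0 (lift 0 j) = x 0 j.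
    have -> : lift 0 j = rshift 1 j :> 'I_(1 + n) by apply/val_inj.
    by rewrite row_mxEr.
  apply/idP/andP => [/set_mem H|[/set_mem Ht /set_mem Hx]].
    split; apply/mem_set => /=.
      by have := H 0; rewrite e0 in_itv /= ler_distl => /andP[-> ->].
    by move=> j; have := H (lift 0 j); rewrite e1 mxE.
  apply/mem_set => j; case: (unliftP 0 j) => [k ->|->].
    by rewrite e1; have := Hx k; rewrite mxE.
  by rewrite e0 ler_distl; move: Ht; rewrite /= in_itv /=.
under eq_integral => t _.
  under eq_fun do rewrite E mulrA.
  rewrite IH; last by rewrite mulr_ge0// indicE.
  rewrite mulrAC; over.
rewrite /=.
under eq_integral do rewrite EFinM.
rewrite ge0_integralZl_EFin//; last 2 first.
- by apply/measurable_EFinP; exact: measurable_indic.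
- by rewrite mulr_ge0// exprn_ge0// mulr_ge0.
rewrite integral_indic// setIT.
rewrite -[X in (_ * X)%E]/(lebesgue_measure `[u 0 0 - r, u 0 0 + r]%classic).
rewrite lebesgue_measure_itv /= lte_fin.
case: ifPn => [_|].
  rewrite -EFinD -EFinM exprSr mulrA; congr (_ * _)%:E.
  by rewrite opprB addrC subrKA; ring.
(* A degenerate interval leaves [r = 0]; both sides vanish because the dimension is positive. *)
rewrite -leNgt => h; have -> : r = 0 by apply/eqP; rewrite eq_le r0 andbT; lra.
by rewrite mule0 mulr0 exprS mul0r mulr0.
Qed.

End IteratedIntegral.

Section PositiveDefinite.
Variable R : realType.
Local Notation C := R[i].

(** Gaussian elimination with the positive pivot [a]: the determinant is [a] times that of the Schur
    complement [S], which is positive definite again. *)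
Lemma posdef_det n (A : 'M[C]_n) : posdef A -> 0 < \det A.
Proof.
elim: n A => [|n IH] A pA; first by rewrite det_mx00 ltr01.
have quad (c : 'rV[C]_n.+1) : \sum_j \sum_k c 0 j * (c 0 k)^*%C * A j k =
    ((c *m A) *m map_mx conjc c^T) 0 0.
  rewrite mxE.
  under [RHS]eq_bigr do rewrite !mxE mulr_suml.
  rewrite exchange_big /=; apply: eq_bigr => j _; apply: eq_bigr => k _.
  by rewrite mulrAC.
pose a := A 0 0.
have a0 : 0 < a.
  have := pA (delta_mx 0 0).
  rewrite quad -rowE => /(_ _)/wrap[|].
    apply/eqP => /rowP/(_ 0); rewrite !mxE eqxx => /eqP; by rewrite oner_eq0.
  rewrite mxE (bigD1 0)//= big1 ?addr0; last first.
    by move=> i i0; rewrite !mxE (negbTE i0) conjc0 mulr0.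
  by rewrite !mxE !eqxx conjc1 mulr1.
rewrite -[A]/(A : 'M[C]_(1 + n)).
set ul := ulsubmx (A : 'M[C]_(1 + n)); set ur := ursubmx (A : 'M[C]_(1 + n)).
set dl := dlsubmx (A : 'M[C]_(1 + n)); set dr := drsubmx (A : 'M[C]_(1 + n)).
have AE : A = block_mx ul ur dl dr :> 'M[C]_(1 + n) by rewrite submxK.
have ulE : ul = a%:M.
  apply/matrixP => i j; rewrite !mxE !ord1 eqxx mulr1n /a.
  by congr (A _ _); apply/val_inj.
pose L : 'M[C]_(1 + n) := block_mx 1%:M 0 (- (a^-1 *: dl)) 1%:M.
pose S := dr - a^-1 *: (dl *m ur).
have LA : L *m block_mx ul ur dl dr = block_mx ul ur 0 S.
  rewrite /L mulmx_block !mul1mx !mul0mx !addr0; congr block_mx.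
    rewrite ulE mulNmx mul_mx_scalar scalerA divff ?gt_eqF// scale1r.
    by rewrite addNr.
  by rewrite mulNmx -scalemxAl addrC.
have dL : \det L = 1 by rewrite /L det_lblock !det1 mulr1.
have -> : \det A = a * \det S.
  rewrite -[\det A]mul1r -dL -det_mulmx {1}AE LA det_ublock ulE.
  by rewrite det_scalar expr1.
rewrite mulr_gt0//; apply: IH => c c0.
(* [c] is completed so that the first entry of [d *m A] vanishes; the form of [A] at [d] is then
   that of [S] at [c]. *)
pose d : 'rV[C]_(1 + n) := row_mx (- (a^-1 *: (c *m dl))) c.
have d0 : d != 0.
  by apply: contraNneq c0 => /(congr1 rsubmx); rewrite row_mxKr linear0 => ->.
have := pA d d0; rewrite quad.
have -> : d *m (A : 'M[C]_(1 + n)) = row_mx (0 : 'rV[C]_1) (c *m S) :> 'rV[C]_(1 + n).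
  rewrite AE /d mul_row_block; congr row_mx.
    rewrite ulE mulNmx mul_mx_scalar scalerA divff ?gt_eqF// scale1r.
    by rewrite addNr.
  rewrite /S mulmxBr mulNmx -scalemxAl -scalemxAr mulmxA addrC.
  by [].
have -> : map_mx conjc d^T = col_mx (map_mx conjc (- (a^-1 *: (c *m dl)))^T) (map_mx conjc c^T) :> 'M[C]_(1 + n, 1).
  by rewrite /d tr_row_mx map_col_mx.
rewrite (@mul_row_col _ _ 1) mul0mx add0r.
suff -> : ((c *m S) *m map_mx conjc c^T) 0 0 = \sum_j \sum_k c 0 j * (c 0 k)^*%C * S j k by [].
rewrite mxE; under eq_bigr do rewrite !mxE mulr_suml.
rewrite exchange_big /=; apply: eq_bigr => j _; apply: eq_bigr => k _.
by rewrite mulrAC.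
Qed.

End PositiveDefinite.

(** * Positivity and bounds of the volume density *)

Section VolumeDensity.
Variables (R : realType) (m : nat) (P : delzant R m) (h0 : metric P).
Local Notation C := R[i].
Local Notation V := ('rV[R]_m * 'rV[R]_m)%type.

Lemma vol_density_gt0 (v : vertex P) p : 0 < vol_density h0 v p.
Proof.
rewrite /vol_density mulr_gt0 ?exprn_gt0//.
have := posdef_det (@weight_curv _ _ _ h0 v p).
by rewrite ltcE => /andP[].
Qed.

(** Only the real part of the determinant is wanted, but an induction through products involves both
    parts. *)
Definition cplx_continuous (f : V -> C) :=
  continuous (fun p => complex.Re (f p) : R) /\ continuous (fun p => complex.Im (f p) : R).

Lemma cplx_continuousM f g : cplx_continuous f -> cplx_continuous g ->
  cplx_continuous (fun p => f p * g p).
Proof.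
move=> [f1 f2] [g1 g2].
have E1 : (fun p => complex.Re (f p * g p) : R) = (fun p => complex.Re (f p) * complex.Re (g p) - complex.Im (f p) * complex.Im (g p)).
  by apply/funext => p; case: (f p) => a b; case: (g p) => c d.
have E2 : (fun p => complex.Im (f p * g p) : R) = (fun p => complex.Re (f p) * complex.Im (g p) + complex.Im (f p) * complex.Re (g p)).
  by apply/funext => p; case: (f p) => a b; case: (g p) => c d.
split.
  rewrite E1 => p; apply: cvgB; apply: cvgM.
  - exact: f1. - exact: g1. - exact: f2. - exact: g2.
rewrite E2 => p; apply: cvgD; apply: cvgM.
- exact: f1. - exact: g2. - exact: f2. - exact: g1.
Qed.

Lemma cplx_continuousD f g : cplx_continuous f -> cplx_continuous g ->
  cplx_continuous (fun p => f p + g p).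
Proof.
move=> [f1 f2] [g1 g2].
have E1 : (fun p => complex.Re (f p + g p) : R) = (fun p => complex.Re (f p) + complex.Re (g p)).
  by apply/funext => p; case: (f p) => a b; case: (g p) => c d.
have E2 : (fun p => complex.Im (f p + g p) : R) = (fun p => complex.Im (f p) + complex.Im (g p)).
  by apply/funext => p; case: (f p) => a b; case: (g p) => c d.
split.
  by rewrite E1 => p; apply: cvgD; [exact: f1|exact: g1].
by rewrite E2 => p; apply: cvgD; [exact: f2|exact: g2].
Qed.

Lemma cplx_continuous_cst c : cplx_continuous (fun _ => c).
Proof. by split; exact: cst_continuous. Qed.

Lemma cplx_continuous_det n (A : V -> 'M[C]_n) :
  (forall i j, cplx_continuous (fun p => A p i j)) -> cplx_continuous (fun p => \det (A p)).
Proof.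
move=> H; rewrite /determinant.
elim: (index_enum _) => [|s r IH].
  by under eq_fun do rewrite big_nil; exact: cplx_continuous_cst.
under eq_fun do rewrite big_cons.
apply: cplx_continuousD => //.
apply: cplx_continuousM; first exact: cplx_continuous_cst.
elim: (index_enum _) => [|i r' IH'].
  by under eq_fun do rewrite big_nil; exact: cplx_continuous_cst.
under eq_fun do rewrite big_cons.
exact: cplx_continuousM.
Qed.

Lemma vol_density_continuous (v : vertex P) : continuous (vol_density h0 v : V -> R).
Proof.
have [C1l C2l] := @logw_C2 _ _ _ h0 v.
have D2 u w : continuous ('D_w ('D_u (logw h0 v)) : V -> R).
  by have [_ +] := C2l u w; exact.
have : cplx_continuous (fun p => \det (levi (logw h0 v) p)).
  apply: cplx_continuous_det => j k; split.
    have -> : (fun p => complex.Re (levi (logw h0 v) p j k) : R) =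
      (fun p => (dRe j (dRe k (logw h0 v)) p + dIm j (dIm k (logw h0 v)) p) * 4^-1).
      by apply/funext => p; rewrite mxE.
    move=> p; apply: cvgM; last exact: cvg_cst.
    by apply: cvgD; exact: D2.
  have -> : (fun p => complex.Im (levi (logw h0 v) p j k) : R) =
      (fun p => (dRe j (dIm k (logw h0 v)) p - dIm j (dRe k (logw h0 v)) p) * 4^-1).
    by apply/funext => p; rewrite mxE.
  move=> p; apply: cvgM; last exact: cvg_cst.
  by apply: cvgB; exact: D2.
move=> [cR _] p; apply: cvgM; first exact: cvg_cst.
exact: cR.
Qed.

Lemma cube_compact n (u : 'rV[R]_n) (r : R) : compact (cube u r).
Proof.
have := @rV_compact R n (fun j => `[u 0 j - r, u 0 j + r]%classic) (fun _ => @segment_compact _ _ _).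
suff -> : [set v : 'rV[R]_n | forall i, `[u 0 i - r, u 0 i + r]%classic (v 0 i)] = cube u r by [].
by apply/seteqP; split => x H j; have := H j; rewrite /= in_itv /= ler_distl.
Qed.

Lemma vol_density_bounds : exists c C0 : R, 0 < c /\ forall (v : vertex P) p,
  cube 0 1 p.1 -> cube 0 1 p.2 -> c <= vol_density h0 v p <= C0.
Proof.
have cK : compact (cube (0 : 'rV[R]_m) 1 `*` cube (0 : 'rV[R]_m) 1) by apply: compact_setX; exact: cube_compact.
have K0 : cube (0 : 'rV[R]_m) 1 `*` cube (0 : 'rV[R]_m) 1 !=set0.
  by exists (0, 0); split => j; rewrite subrr normr0 ler01.
have H v : exists c C0 : R, 0 < c /\ forall p, (cube 0 1 `*` cube 0 1) p -> c <= vol_density h0 v p <= C0.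
  have cw := continuous_subspaceT (@vol_density_continuous v) (A := cube 0 1 `*` cube 0 1).
  have [a aD amin] := compact_EVT_min K0 cK cw.
  have [b bD bmax] := compact_EVT_max K0 cK cw.
  exists (vol_density h0 v a), (vol_density h0 v b); split; first exact: vol_density_gt0.
  move=> q qD; have qD' : q \in cube 0 1 `*` cube 0 1 by apply: mem_set.
  by apply/andP; split; [apply: amin|apply: bmax].
have /choice[c Hc] := H.
have /choice[C0 HC] := Hc.
exists (\big[Num.min/1]_v c v), (\big[Num.max/0]_v C0 v); split.
  elim/big_ind: _ => // [x y x0 y0|v _]; first by rewrite lt_min x0.
  by have [] := HC v.
move=> v p p1 p2; have [_ /(_ p (conj p1 p2))/andP[H1 H2]] := HC v.
apply/andP; split.
  by apply: le_trans H1; rewrite (bigD1 v)//= ge_min lexx.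
by apply: (le_trans H2); rewrite (bigD1 v)//= le_max lexx.
Qed.

End VolumeDensity.

Section IntegralC.
Variables (R : realType) (m : nat).
Local Notation V := ('rV[R]_m * 'rV[R]_m)%type.

Lemma lebesgue_intC_cube (u w : 'rV[R]_m) (r c : R) : 0 <= r -> 0 <= c ->
  lebesgue_intC (fun p : V => (c * \1_(cube u r) p.1 * \1_(cube w r) p.2)%:E) =
  (c * (2 * r) ^+ m * (2 * r) ^+ m)%:E.
Proof.
move=> r0 c0; rewrite /lebesgue_intC /=.
under eq_fun => x.
  rewrite lebesgue_int_cube//; last by rewrite mulr_ge0// indicE.
  rewrite mulrAC; over.
by rewrite lebesgue_int_cube// ?mulr_ge0// ?exprn_ge0// ?mulr_ge0// mulrAC.
Qed.

Lemma lebesgue_intC_mono (f g : V -> \bar R) : (forall p, 0 <= f p)%E ->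
  (forall p, f p <= g p)%E -> (lebesgue_intC f <= lebesgue_intC g)%E.
Proof.
move=> f0 fg; apply: lebesgue_int_mono => x.
  exact: lebesgue_int_ge0.
by apply: lebesgue_int_mono => y.
Qed.

Lemma lebesgue_intC_ge0 (f : V -> \bar R) : (forall p, 0 <= f p)%E -> (0 <= lebesgue_intC f)%E.
Proof. by move=> f0; apply: lebesgue_int_ge0 => x; exact: lebesgue_int_ge0. Qed.

End IntegralC.

(** * Upper and lower bounds for the integrals *)

Section NormIntegrals.
Variables (R : realType) (m : nat) (P : delzant R m) (h0 : metric P).
Local Notation C := R[i].
Local Notation toR := (toR R).
Local Notation pot := (pot h0).
Local Notation V := ('rV[R]_m * 'rV[R]_m)%type.
Implicit Types (v w : vertex P) (eta : 'rV[C]_m) (q x rho : 'rV[R]_m) (p : V).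

Lemma piece_disc v eta : piece v eta -> disc (nsq eta).
Proof.
move=> H j; rewrite in_itv /= nsq_ge0 /=.
have [k k0 uP] := edge_end v j.
have : normsq (monomial eta (edge_coord v (row j (edges P (val v)) *+ k))) <= 1.
  have /= := H (SeqSub uP); rewrite addrAC subrr add0r.
  by case: ifP => _ // /ltW.
rewrite edge_coordMn edge_coord_row normsq_monomial.
have eE i : (delta_mx 0 j *+ k : 'rV[int]_m) 0 i = (i == j)%:R *+ k.
  by rewrite mulmxnE mxE.
rewrite (bigD1 j)//= big1 ?mulr1; last first.
  by move=> i ij; rewrite eE (negbTE ij) mul0rn expr0z.
rewrite eE eqxx -mulrnA mul1n natz => H1.
by rewrite mxE -(@expr_le1 _ k)// normsq_ge0.
Qed.

Lemma disc_cube p : disc (nsq (cplx p)) -> cube 0 1 p.1 /\ cube 0 1 p.2.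
Proof.
move=> H; have Hj j : p.1 0 j ^+ 2 + p.2 0 j ^+ 2 <= 1.
  by have := H j; rewrite in_itv /= !mxE /normsq /= => /andP[].
have sq (a b : R) : a ^+ 2 + b ^+ 2 <= 1 -> `|a| <= 1.
  move=> ab; rewrite -(@expr_le1 _ 2)// real_normK ?num_real//.
  by apply: le_trans ab; rewrite lerDl sqr_ge0.
split=> j; rewrite mxE subr0; first exact: sq (Hj j).
by apply: sq; rewrite addrC; exact: Hj.
Qed.

Definition Qintegrand (N : nat) (a : 'rV[int]_m) v p : R :=
  section_normsq h0 N a (chart v (cplx p)) * vol_density h0 v p * \1_(piece v) (cplx p).

Lemma QintegrandE N a v p : (0 < N)%N -> lattice_points P N a ->
  Qintegrand N a v p = secn h0 v (nsq (cplx p)) (N%:R^-1 *: toR a) ^+ N *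
    vol_density h0 v p * \1_(piece v) (cplx p).
Proof.
move=> N0 aP; rewrite /Qintegrand section_normsqE// sec_chart//.
exact: lattice_polytope.
Qed.

Lemma Qintegrand_ge0 N a v p : (0 < N)%N -> lattice_points P N a -> 0 <= Qintegrand N a v p.
Proof.
move=> N0 aP; rewrite QintegrandE//; apply: mulr_ge0; last by rewrite indicE.
apply: mulr_ge0; last exact/ltW/vol_density_gt0.
by apply: exprn_ge0; exact: secn_ge0.
Qed.

Lemma integral_M_upper : exists2 K : R, 0 < K & forall N a, (0 < N)%N -> lattice_points P N a ->
  (integral_M h0 (section_normsq h0 N a) <= (K * expR (pot (N%:R^-1 *: toR a)) ^+ N)%:E)%E.
Proof.
have [c [C0 [c0 HC]]] := vol_density_bounds h0.
have C0p : 0 < C0.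
  have := HC (vertex0 P) (0, 0) _ _; move=> /(_ _ _)/wrap[||].
  - by move=> j; rewrite subrr normr0.
  - by move=> j; rewrite subrr normr0.
  by move=> /andP[h1 h2]; apply: (lt_le_trans c0); exact: le_trans h1 h2.
(* The density bound times the volumes [2 ^+ m] of the two cubes, for real and imaginary parts, that
   contain every piece. *)
pose B := C0 * 2 ^+ m * 2 ^+ m.
have B0 : 0 < B by rewrite !mulr_gt0// exprn_gt0.
exists (#|{: vertex P}|%:R * B).
  by rewrite mulr_gt0// ltr0n; apply/card_gt0P; exists (vertex0 P).
move=> N a N0 aP; set U := expR _ ^+ N.
have Px := lattice_polytope N0 aP.
have U0 : 0 <= U by rewrite exprn_ge0// expR_ge0.
have H v : (lebesgue_intC (fun p => (Qintegrand N a v p)%:E) <= (B * U)%:E)%E.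
  have -> : B * U = (C0 * U) * (2 * 1) ^+ m * (2 * 1) ^+ m by rewrite !mulr1 /B; ring.
  rewrite -(lebesgue_intC_cube 0 0)//; last by rewrite mulr_ge0// ltW.
  apply: lebesgue_intC_mono => p; rewrite lee_fin; first exact: Qintegrand_ge0.
  rewrite QintegrandE//; have [pp|pp] := pselect (piece v (cplx p)); last first.
    rewrite [X in _ * X]indicE memNset// mulr0.
    by rewrite !mulr_ge0// ?indicE// ltW.
  have pD := piece_disc pp; have [p1 p2] := disc_cube pD.
  rewrite !indicE !mem_set// !mulr1 mulrC.
  have /andP[h1 h2] := HC v p p1 p2.
  apply: ler_pM => //; first exact: (ltW (vol_density_gt0 h0 v p)).
    by rewrite exprn_ge0// secn_ge0.
  by rewrite lerXn2r ?nnegrE ?secn_ge0 ?expR_ge0//; exact: secn_disc_le_pot.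
rewrite /integral_M.
apply: (@le_trans _ _ (\sum_(v : vertex P) (B * U)%:E)%E).
  by apply: lee_sum => v _; exact: H.
rewrite sumEFin lee_fin sumr_const -[leLHS]mulr_natl.
by rewrite mulrA.
Qed.

(* The integrand of [Qnorm] at [a / N = x] is within [e^(-N e)] of its maximum on
   the whole cube. *)
Definition good_cube (e r : R) x := exists v p0, forall p, cube p0.1 r p.1 -> cube p0.2 r p.2 ->
  piece v (cplx p) /\ expR (pot x - e) <= secn h0 v (nsq (cplx p)) x.

(** Only the cube is kept from the whole integral; [K] depends on [r] but neither on [N] nor on
    [a]. *)
Lemma integral_M_lower_good e r : 0 < r -> exists2 K : R, 0 < K & forall N a,
  (0 < N)%N -> lattice_points P N a -> good_cube e r (N%:R^-1 *: toR a) ->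
  ((K * expR (pot (N%:R^-1 *: toR a) - e) ^+ N)%:E <= integral_M h0 (section_normsq h0 N a))%E.
Proof.
move=> r0; have [c [C0 [c0 HC]]] := vol_density_bounds h0.
exists (c * (2 * r) ^+ m * (2 * r) ^+ m).
  by rewrite !mulr_gt0// exprn_gt0// mulr_gt0.
move=> N a N0 aP [v [p0 Hp]].
set U := expR _ ^+ N.
have U0 : 0 <= U by rewrite exprn_ge0// expR_ge0.
have ge0 w : (0 <= lebesgue_intC (fun p => (Qintegrand N a w p)%:E))%E.
  by apply: lebesgue_intC_ge0 => p; rewrite lee_fin; exact: Qintegrand_ge0.
rewrite /integral_M (bigD1 v)//=.
apply: (@le_trans _ _ (lebesgue_intC (fun p => (Qintegrand N a v p)%:E))); last first.
  by apply: leeDl; apply: sume_ge0 => w _; exact: ge0.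
have -> : c * (2 * r) ^+ m * (2 * r) ^+ m * U = (c * U) * (2 * r) ^+ m * (2 * r) ^+ m by ring.
rewrite -(lebesgue_intC_cube p0.1 p0.2) ?(ltW r0)//; last by rewrite mulr_ge0// ltW.
apply: lebesgue_intC_mono => p; rewrite lee_fin.
  by rewrite !mulr_ge0// ?indicE// ltW.
rewrite QintegrandE//.
have [p1|p1] := pselect (cube p0.1 r p.1); last first.
  rewrite [\1_(cube p0.1 r) _]indicE memNset// mulr0 mul0r -QintegrandE//.
  exact: Qintegrand_ge0.
have [p2|p2] := pselect (cube p0.2 r p.2); last first.
  rewrite [\1_(cube p0.2 r) _]indicE memNset// mulr0 -QintegrandE//.
  exact: Qintegrand_ge0.
have [pp ge] := Hp p p1 p2.
have [k1 k2] := disc_cube (piece_disc pp).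
have /andP[h1 _] := HC v p k1 k2.
rewrite !indicE !mem_set// !mulr1 mulrC.
apply: ler_pM => //; first exact: ltW.
by rewrite lerXn2r ?nnegrE ?expR_ge0 ?secn_ge0.
Qed.

End NormIntegrals.

Lemma ltr_dist_lower (R : realType) (a b c : R) : `|a - b| < a - c -> c < b.
Proof. by move=> /ltr_normlP[_]; rewrite ltrD2l ltrN2. Qed.

Lemma quarter_arith (R : realType) (a b e : R) : 0 < e -> a <= b + e / 4 -> a - e <= b - e / 4.
Proof. by move=> *; lra. Qed.

Section GoodCubes.
Variables (R : realType) (m : nat) (P : delzant R m) (h0 : metric P).
Local Notation C := R[i].
Local Notation toR := (toR R).
Local Notation pot := (pot h0).
Local Notation V := ('rV[R]_m * 'rV[R]_m)%type.
Implicit Types (v w : vertex P) (eta : 'rV[C]_m) (q x rho : 'rV[R]_m) (p : V).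

Lemma secn_cvg T (F : set_system T) {FF : Filter F} v (Q X : T -> 'rV[R]_m) q x :
  Q @ F --> q -> X @ F --> x -> (forall j, 0 < q 0 j) ->
  (fun t => secn h0 v (Q t) (X t)) @ F --> secn h0 v q x.
Proof.
move=> cQ cX q0; apply: cvgM; last first.
  apply: (@cvg_comp _ _ _ Q (wgt h0 v) F (nbhs q) _ cQ).
  exact: wgt_continuous.
apply: cvg_big; first exact: mul_continuous.
move=> j _; apply: powR_cvg => //; first exact: cvg_coord.
exact: cvg_edge_coordR.
Qed.

Lemma nsq_cplx_continuous p : (fun p : V => nsq (cplx p)) @ p --> nsq (cplx p).
Proof.
have E (p' : V) : nsq (cplx p') = \row_j (p'.1 0 j * p'.1 0 j + p'.2 0 j * p'.2 0 j).
  by apply/rowP => j; rewrite !mxE /normsq /= !expr2.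
rewrite E; have -> : (fun p : V => nsq (cplx p)) = (fun p : V => \row_j (p.1 0 j * p.1 0 j + p.2 0 j * p.2 0 j)).
  by apply/funext => p'; exact: E.
apply: (@cvg_row R m _ (nbhs p) (fun j (p : V) => p.1 0 j * p.1 0 j + p.2 0 j * p.2 0 j) _ (nbhs_filter p)) => j.
have c1 : (fun p : V => p.1 0 j) @ p --> p.1 0 j.
  by apply: (@cvg_coord R m V (nbhs p) (nbhs_filter p) fst p.1 j); exact: cvg_fst.
have c2 : (fun p : V => p.2 0 j) @ p --> p.2 0 j.
  by apply: (@cvg_coord R m V (nbhs p) (nbhs_filter p) snd p.2 j); exact: cvg_snd.
exact: (cvgD (cvgM c1 c1) (cvgM c2 c2)).
Qed.

(* Moving [rho] slightly along a functional exposing a maximal vertex makes this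
   vertex the unique maximum, so that the point lies in the interior of a piece. *)
Lemma generic_rho x e : polytope P x -> 0 < e -> exists v rho,
  pot x - e < dotp x rho - phi_rho h0 rho /\
  forall w, w != v -> dotp (toR (val w)) rho < dotp (toR (val v)) rho.
Proof.
move=> Px e0; have [rho0 H0] := pot_adherent h0 Px e0.
have [v _ vmax] := arg_maxP (fun v : vertex P => dotp (toR (val v)) rho0)
  (erefl : xpredT (vertex0 P)).
have [l Hl] := vertex_functional v.
exists v.
have q0 : forall j, 0 <= expq (vertex0 P) rho0 0 j by move=> j; rewrite mxE expR_ge0.
have [D /(_ (\row_j dotp l (toR (row j (edges P (val (vertex0 P)))))))] := curve_derive h0 (vertex0 P) q0.
move=> [g1 [_ [d1 _ _ _ _]]].
have cphi : (fun t : R => phi_rho h0 (rho0 + t *: l)) @ (0:R) --> phi_rho h0 (rho0 + 0 *: l).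
  under eq_cvg do rewrite phi_rho_curve.
  rewrite phi_rho_curve; have [dd _] := d1 0.
  by apply: differentiable_continuous; apply/derivable1_diffP.
have cdot : (fun t : R => dotp x (rho0 + t *: l)) @ (0:R) --> dotp x (rho0 + 0 *: l).
  under eq_cvg do rewrite dotpDr dotpZr.
  rewrite dotpDr dotpZr; apply: cvgD; first exact: cvg_cst.
  by apply: cvgM; [exact: cvg_id|exact: cvg_cst].
have cg : (fun t : R => dotp x (rho0 + t *: l) - phi_rho h0 (rho0 + t *: l)) @ (0:R) -->
    dotp x (rho0 + 0 *: l) - phi_rho h0 (rho0 + 0 *: l) by exact: cvgB cdot cphi.
rewrite scale0r addr0 in cg.
pose d := dotp x rho0 - phi_rho h0 rho0 - (pot x - e).
have d0 : 0 < d by rewrite subr_gt0.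
have /cvgrPdist_lt/(_ d d0)/nbhs_ballP[s /= s0 Hs] := cg.
have s2 : 0 < s / 2 by rewrite divr_gt0.
exists (rho0 + (s / 2) *: l); split.
  have bs : ball (0:R) s (s / 2).
    rewrite -ball_normE /= sub0r normrN gtr0_norm//.
    by rewrite ltr_pdivrMr// mulr_natr mulr2n ltrDl.
  exact: ltr_dist_lower (Hs _ bs).
move=> w wv; rewrite !dotpDr !dotpZr; apply: ler_ltD; first exact: vmax.
rewrite ltr_pM2l// ![dotp _ l]dotpC; apply: Hl; first exact: valP.
by apply: contraNneq wv => /val_inj ->.
Qed.

(** Being strictly inside the piece of [v] and having a nearly maximal integrand are open conditions
    on the weight and the point, and [pot] rises by at most [e / 4] nearby. The joint neighbourhood
    in [x'] and [r] is the form that the compactness argument of [good_cube_uniform] takes. *)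
Lemma good_cube_near e x : polytope P x -> 0 < e ->
  \forall x' \near x & r \near (0:R)^'+, polytope P x' -> good_cube h0 e r x'.
Proof.
move=> Px e0; have e4 : 0 < e / 4 by rewrite divr_gt0.
have [v [rho [H1 H2]]] := generic_rho Px e4.
pose q := expq v rho.
have q0 j : 0 < q 0 j by rewrite mxE expR_gt0.
pose p0 : V := (\row_j Num.sqrt (q 0 j), 0).
have p0E : nsq (cplx p0) = q.
  by apply/rowP => j; rewrite !mxE /normsq /= expr0n addr0 sqr_sqrtr// ?expR_ge0.
have cN := @nsq_cplx_continuous p0; rewrite p0E in cN.
have n1 w : w != v -> \forall p \near p0, secn h0 v (nsq (cplx p)) (toR (val w)) < wgt h0 v (nsq (cplx p)).
  move=> wv.
  have c1 := @secn_cvg V (nbhs p0) (nbhs_filter p0) v (fun p => nsq (cplx p)) (fun _ => toR (val w)) q (toR (val w)) cN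
    (@cst_continuous V 'rV[R]_m (toR (val w)) p0) q0.
  have c2 : (fun p : V => wgt h0 v (nsq (cplx p))) @ p0 --> wgt h0 v q.
    by apply: (@cvg_comp _ _ _ (fun p : V => nsq (cplx p)) (wgt h0 v) _ (nbhs q) _ cN); exact: wgt_continuous.
  have c3 : (fun p : V => wgt h0 v (nsq (cplx p)) - secn h0 v (nsq (cplx p)) (toR (val w))) @ p0 -->
    wgt h0 v q - secn h0 v q (toR (val w)) by exact: cvgB c2 c1.
  have lt : 0 < wgt h0 v q - secn h0 v q (toR (val w)).
    rewrite subr_gt0 secn_expq gtr_pMl ?wgt_gt0//.
    by rewrite -expR0 ltr_expR subr_lt0 H2.
  have /cvgrPdist_lt/(_ _ lt) := c3; apply: filterS => p.
  by move=> /ltr_normlP[_]; rewrite ltrBlDl -ltrBlDr subrr subr_gt0.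
have nall : \forall p \near p0, forall w, w != v -> secn h0 v (nsq (cplx p)) (toR (val w)) < wgt h0 v (nsq (cplx p)).
  apply: (@filter_forall V (seq_sub (verts P)) (fun w p => w != v ->
    secn h0 v (nsq (cplx p)) (toR (val w)) < wgt h0 v (nsq (cplx p))) (nbhs p0)) => w.
  have [->|wv] := eqVneq w v; first exact: filterE.
  by apply: filterS (n1 w wv).
pose G := filter_prod (nbhs x) (nbhs p0).
have FG : Filter G by exact: filter_prod_filter.
have cs : (fun z : 'rV[R]_m * V => secn h0 v (nsq (cplx z.2)) z.1) @ G --> secn h0 v q x.
  apply: (@secn_cvg _ G FG v (fun z => nsq (cplx z.2)) fst) => //; last exact: cvg_fst.
  by apply: (@cvg_comp _ _ _ snd (fun p : V => nsq (cplx p)) G (nbhs p0) _ _ cN); exact: cvg_snd.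
have sx : secn h0 v q x = expR (dotp x rho - phi_rho h0 rho) by exact: secn_expqE.
have n3 : G (fun z => expR (pot x - e / 4) < secn h0 v (nsq (cplx z.2)) z.1).
  have lt : 0 < secn h0 v q x - expR (pot x - e / 4) by rewrite subr_gt0 sx ltr_expR.
  have /cvgrPdist_lt/(_ _ lt) := cs; apply: filterS => z.
  by move=> /ltr_normlP[_]; rewrite ltrD2l ltrN2.
have [[A B] /= [nA nB] AB] := n3.
have nu := pot_usc h0 Px e4.
have nBall : nbhs p0 (B `&` (fun p : V => forall w, w != v ->
    secn h0 v (nsq (cplx p)) (toR (val w)) < wgt h0 v (nsq (cplx p)))) by exact: filterI.
have /nbhs_ballP[r0 /= r00 Hr] := nBall.
exists (A `&` [set y | polytope P y -> pot y <= pot x + e / 4], [set r : R | 0 < r < r0]) => /=.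
  split; first exact: filterI.
  near=> r; apply/andP; split; first by near: r; exact: nbhs_right_gt.
  by near: r; exact: nbhs_right_lt.
move=> [y r] /= [[Ay Hy] /andP[rp rr0]] Py.
exists v, p0 => p k1 k2.
have bp : ball p0 r0 p.
  have b1 (a b : 'rV[R]_m) : cube a r b -> ball a r0 b.
    move=> ab; rewrite -ball_normE /= /Num.norm /= mx_normrE.
    apply: bigmax_lt => // -[i j] _ /=; rewrite !mxE distrC ord1.
    exact: le_lt_trans (ab j) rr0.
  by split; exact: b1.
have [Bp Hp] := Hr p bp.
split.
  move=> w; have [->|wv] := eqVneq w v.
    by rewrite ltnn subrr edge_coord0 monomial0 normsq1.
  have lt : normsq (monomial (cplx p) (edge_coord v (val w - val v))) < 1.
    have := Hp w wv; rewrite secn_hcoord; last exact: vert_lattice.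
    by rewrite (hcoord_lattice _ _ (vert_lattice w)) weight_abs gtr_pMl ?wgt_gt0.
  by cbv zeta; case: ltnP => _; [exact: lt|exact: ltW].
have /ltW := AB (y, p) (conj Ay Bp) => /=; apply: le_trans.
by rewrite ler_expR; exact: quarter_arith e0 (Hy Py).
Unshelve. all: by end_near. Qed.

Lemma good_cube_uniform e : 0 < e -> exists2 r, 0 < r & forall x, polytope P x -> good_cube h0 e r x.
Proof.
move=> e0.
pose F := (0:R)^'+.
have FPF : ProperFilter F by exact: at_right_proper_filter.
have H : F (fun r => polytope P `<=` (fun x => polytope P x -> good_cube h0 e r x)).
  have nc := proj1 (compact_near_coveringP _) (@polytope_compact R m P).
  have FF : Filter F by exact: filter_filter.
  apply: (nc R F (fun r x => polytope P x -> good_cube h0 e r x) FF) => x Px.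
  exact: good_cube_near.
have H2 : F (fun r => 0 < r) by exact: nbhs_right_gt.
have [r [Hr r0]] := filter_ex (filterI H H2).
by exists r => // x Px; exact: (Hr x Px Px).
Qed.

Lemma Qnorm_bounds e : 0 < e -> exists K1 K2 : R, [/\ 0 < K1, 0 < K2 & forall N a,
  (0 < N)%N -> lattice_points P N a ->
  K1 * expR (pot (N%:R^-1 *: toR a) - e) ^+ N <= Qnorm h0 N a <=
  K2 * expR (pot (N%:R^-1 *: toR a)) ^+ N].
Proof.
move=> e0; have [K2 K20 H2] := integral_M_upper h0.
have [r r0 Hr] := good_cube_uniform e0.
have [K1 K10 H1] := integral_M_lower_good h0 e r0.
exists K1, K2; split=> // N a N0 aP.
have u := H2 N a N0 aP.
have l := H1 N a N0 aP (Hr _ (lattice_polytope N0 aP)).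
(* Both bounds are finite, so [fine] in [Qnorm] returns the true integral. *)
have fin : integral_M h0 (section_normsq h0 N a) \is a fin_num.
  rewrite fin_numE; apply/andP; split.
    by rewrite gt_eqF//; apply: lt_le_trans l; exact: ltNyr.
  by rewrite lt_eqF//; apply: le_lt_trans u _; exact: ltry.
by rewrite /Qnorm -!lee_fin fineK// l u.
Qed.

End GoodCubes.

(** * The rate function *)

Section ConvexBounded.
Variables (R : realType) (f f1 f2 : R -> R).
Hypothesis d1 : forall t, is_derive t (1:R) (f : R -> R^o) (f1 t).
Hypothesis d2 : forall t, is_derive t (1:R) (f1 : R -> R^o) (f2 t).

Lemma convex_bounded_slope (M : R) : (forall t, 0 <= f2 t) ->
  (forall t, 0 <= t -> f t <= M) -> forall s, f1 s <= 0.
Proof.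
move=> f2_0 fM s; rewrite leNgt; apply/negP => f1s.
pose K := `|M - f s| + 1.
have K0 : 0 < K by rewrite ltr_wpDl.
(* [|s|] makes [s + D] nonnegative, and [K / f1 s] lets the tangent at [s] rise by at least
   [K > M - f s]. *)
pose D := `|s| + K / f1 s.
have t0 : 0 <= s + D.
  rewrite /D addrA addr_ge0//; last by rewrite divr_ge0// ltW.
  by have := ler_norm (- s); rewrite normrN -subr_ge0 opprK addrC.
have := convex_tangent s (s + D) d1 d2 f2_0.
have := fM _ t0.
have KD : K <= f1 s * D.
  by rewrite /D mulrDr [X in _ + X]mulrC divfK ?gt_eqF// lerDr mulr_ge0// ltW.
have KM : M - f s < K by rewrite /K ltr_pwDr// ler_norm.
rewrite addrAC subrr add0r => h1 h2.
have := lt_le_trans KM KD; rewrite ltrBlDl => h3.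
by have := lt_le_trans h3 (le_trans h2 h1); rewrite ltxx.
Qed.

(** The slopes increase strictly and are never positive, so they are negative before [1]. *)
Lemma strictly_convex_bounded (M : R) : (forall t, 0 < f2 t) ->
  (forall t, 0 <= t -> f t <= M) -> f 1 < f 0.
Proof.
move=> f2_0 fM.
have s1 := convex_bounded_slope (fun t => ltW (f2_0 t)) fM 1.
have [|c c01 E] := @MVT R f f1 0 1 ltr01 (fun t _ => d1 t).
  by apply: derivable_within_continuous => t _; have [] := d1 t.
rewrite -subr_lt0 E subr0 mulr1; apply: lt_le_trans s1.
by apply: (@derive_le_mono R f1 f2 true) => //; move: c01; rewrite in_itv => /andP[].
Qed.

(** A convex function with a finite limit at infinity has no positive slope, so it decreases to its
    limit. *)
Lemma convex_limit_le (L : R) : (forall t, 0 <= f2 t) ->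
  (forall e, 0 < e -> exists T, forall t, T <= t -> `|f t - L| <= e) -> L <= f 0.
Proof.
move=> f2_0 HL.
have [T1 HT1] := HL 1 ltr01.
have sl s : f1 s <= 0.
  rewrite leNgt; apply/negP => f1s.
  pose D := `|s| + `|T1| + (`|L - f s| + 2) / f1 s.
  have tT : T1 <= s + D.
    have h := ler_norm (- s); rewrite normrN in h.
    have h2 : 0 <= (`|L - f s| + 2) / f1 s by rewrite divr_ge0 ?(ltW f1s)// addr_ge0.
    move: h h2 (ler_norm T1); rewrite /D; move: (_ / _) => u; move: `|s| `|T1|.
    by clear; move=> a b; lra.
  have := convex_tangent s (s + D) d1 d2 f2_0.
  have := HT1 _ tT.
  move=> /ler_normlP[_ h1] h2.
  have KD : `|L - f s| + 2 <= f1 s * D.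
    rewrite /D mulrDr [X in _ <= _ + X]mulrC divfK ?gt_eqF// lerDr.
    by rewrite mulr_ge0// ?addr_ge0// ltW.
  have KM := ler_norm (L - f s).
  rewrite addrAC subrr add0r in h2.
  lra.
apply/ler_addgt0Pl => e e0.
have [T HT] := HL e e0.
have := HT (Num.max T 0); rewrite le_max lexx => /(_ isT) /ler_normlP[h1 _].
have mono : f (Num.max T 0) <= f 0.
  have := @convex_tangent R f f1 f2 (Num.max T 0) 0 d1 d2 f2_0.
  rewrite sub0r mulrN => h2.
  apply: le_trans h2; rewrite lerBrDr gerDl.
  by rewrite mulr_le0_ge0// le_max lexx orbT.
rewrite opprB in h1; lra.
Qed.

End ConvexBounded.

Lemma rate_arith (R : realType) (a b c d e l t : R) :
  l = t * d + (1 - t) * e -> a <= t * b + (1 - t) * c ->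
  a - l <= t * (b - d) + (1 - t) * (c - e).
Proof. by move=> -> h; rewrite !mulrBr addrACA -opprD lerB. Qed.

Lemma ln_powR_comb (R : realType) (x y t s : R) : 0 < x -> 0 < y ->
  ln (x `^ t * y `^ s) = t * ln x + s * ln y.
Proof. by move=> x0 y0; rewrite lnM ?posrE ?powR_gt0// !ln_powR. Qed.

(** * One formula for the rate on all orbits *)

Section Rate.
Variables (R : realType) (m : nat) (P : delzant R m) (h0 : metric P).
Local Notation C := R[i].
Local Notation toR := (toR R).
Local Notation pot := (pot h0).
Implicit Types (v w : vertex P) (eta : 'rV[C]_m) (q x rho : 'rV[R]_m).

(** The same expression on every orbit; the case distinction is there because [ln] takes a finite
    default value at [0]. *)
Definition rate (z : toric P) x : \bar R :=
  if sec h0 z x == 0 then +oo%E else (symp_pot h0 x - (ln (sec h0 z x))%:E)%E.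

Lemma rateE z x : polytope P x -> sec h0 z x != 0 ->
  rate z x = (pot x - ln (sec h0 z x))%:E.
Proof. by move=> Px s0; rewrite /rate (negbTE s0) symp_potE. Qed.

Lemma sec_gt0 z x : sec h0 z x != 0 -> 0 < sec h0 z x.
Proof. by move=> s0; rewrite lt_neqAle eq_sym s0 sec_ge0. Qed.

Lemma rate_ge0 z x : polytope P x -> (0 <= rate z x)%E.
Proof.
move=> Px; rewrite /rate; case: eqVneq => // s0.
rewrite symp_potE// -EFinB lee_fin subr_ge0 -ler_expR lnK ?posrE ?sec_gt0//.
exact: sec_le_pot.
Qed.

(** Removes both the infinite value and the logarithm, leaving a comparison to which semicontinuity
    of [sec] and [pot] applies. *)
Lemma rate_gtE z x (a : R) : polytope P x ->
  (a%:E < rate z x)%E = (sec h0 z x < expR (pot x - a)).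
Proof.
move=> Px; rewrite /rate; case: eqVneq => [->|s0].
  by rewrite ltry expR_gt0.
rewrite symp_potE// -EFinB lte_fin ltrBrDr -ltrBrDl.
by rewrite -[LHS]ltr_expR lnK// posrE sec_gt0.
Qed.

Lemma rate_openP : rate_open h0 rate.
Proof.
move=> rho theta x Px z.
have sz := sec_torus h0 rho theta Px; rewrite -/z in sz.
have pz := phi_open_torus h0 rho theta; rewrite -/z in pz.
clearbody z.
have s0 : sec h0 z x != 0 by rewrite sz; exact: lt0r_neq0 (expR_gt0 _).
rewrite (rateE Px s0) sz expRK pz (symp_potE h0 Px).
move: (phi_rho h0 rho) (dotp x rho) (pot x) => a b c.
by rewrite opprB addrA addrAC.
Qed.

Lemma sec_comb z x y (t : R) : polytope P x -> polytope P y -> 0 <= t <= 1 ->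
  sec h0 z (t *: x + (1 - t) *: y) = sec h0 z x `^ t * sec h0 z y `^ (1 - t).
Proof.
move=> Px Py /andP[t0 t1].
pose a (i : 'I_2) := if i == 0 then t else 1 - t.
pose p (i : 'I_2) := if i == 0 then x else y.
have -> : t *: x + (1 - t) *: y = \sum_i a i *: p i.
  by rewrite big_ord_recl big_ord1 /a /p /=.
rewrite /sec secn_convex.
- by rewrite big_ord_recl big_ord1 /a /p /=.
- by move=> j; exact: nsq_ge0.
- by move=> i; rewrite /a; case: ifP; rewrite ?subr_ge0.
- by rewrite big_ord_recl big_ord1 /a /= addrC subrK.
- by move=> i; rewrite /p; case: ifP.
Qed.

Lemma pot_convex x y (t : R) : polytope P x -> polytope P y -> 0 <= t <= 1 ->
  pot (t *: x + (1 - t) *: y) <= t * pot x + (1 - t) * pot y.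
Proof.
move=> Px Py t01; have /andP[t0 t1] := t01.
apply: pot_le; first exact: polytope_seg.
move=> rho; rewrite dotpDl !dotpZl.
have -> : t * dotp x rho + (1 - t) * dotp y rho - phi_rho h0 rho =
  t * (dotp x rho - phi_rho h0 rho) + (1 - t) * (dotp y rho - phi_rho h0 rho).
  by move: (phi_rho h0 rho) (dotp x rho) (dotp y rho) => a b c; ring.
by apply: lerD; apply: ler_wpM2l; rewrite ?subr_ge0//; exact: pot_ge.
Qed.

Lemma rate_convex z : convex_on (polytope P) (rate z).
Proof.
move=> x y t Px Py t01; have /andP[t0 t1] := t01.
have [->|tn0] := eqVneq t 0.
  by rewrite scale0r add0r subr0 scale1r mul0e add0e mul1e.
have [->|tn1] := eqVneq t 1.
  by rewrite subrr scale0r addr0 scale1r mul0e adde0 mul1e.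
have tp : 0 < t by rewrite lt_neqAle eq_sym tn0.
have tp1 : 0 < 1 - t by rewrite subr_gt0 lt_neqAle tn1.
have r0x : (0 <= t%:E * rate z x)%E by rewrite mule_ge0// rate_ge0.
have r0y : (0 <= (1 - t)%:E * rate z y)%E by rewrite mule_ge0 ?rate_ge0// lee_fin ltW.
have [sx|sx] := eqVneq (sec h0 z x) 0.
  have -> : rate z x = +oo%E by rewrite /rate sx eqxx.
  have yn := negbT (gt_eqF (lt_le_trans (ltNyr (0 : R)) r0y)).
  by rewrite gt0_muley ?lte_fin// (addye yn) leey.
have [sy|sy] := eqVneq (sec h0 z y) 0.
  have -> : rate z y = +oo%E by rewrite /rate sy eqxx.
  have xn := negbT (gt_eqF (lt_le_trans (ltNyr (0 : R)) r0x)).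
  by rewrite gt0_muley ?lte_fin// (addey xn) leey.
have sc := sec_comb z Px Py t01.
rewrite !rateE//; last 2 first.
- exact: polytope_seg.
- by rewrite sc mulf_neq0// powR_eq0 negb_and ?sx ?sy.
rewrite -!EFinM -EFinD lee_fin.
apply: rate_arith (pot_convex Px Py t01).
by rewrite sc; apply: ln_powR_comb; exact: sec_gt0.
Qed.

Lemma rate_near z x (a : R) : polytope P x -> (a%:E < rate z x)%E ->
  \forall y \near x, polytope P y -> (a%:E < rate z y)%E.
Proof.
move=> Px ax.
rewrite rate_gtE// in ax.
(* [b] splits the gap: [sec z y] stays below [b], and [pot y] loses at most [d], which keeps [b] at
   most [expR (pot y - a)]. *)
pose b := (sec h0 z x + expR (pot x - a)) / 2.
have b1 : sec h0 z x < b by rewrite /b; lra.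
have b2 : b < expR (pot x - a) by rewrite /b; lra.
have b0 : 0 < b by apply: le_lt_trans b1; exact: sec_ge0.
pose d := pot x - a - ln b.
have d0 : 0 < d by rewrite subr_gt0 -ltr_expR lnK.
pose F := within (polytope P) (nbhs x).
have FF : Filter F by exact: within_filter.
have cq : (fun _ : 'rV[R]_m => nsq (coords z).2) @ F --> nsq (coords z).2 by exact: cvg_cst.
have cx : id @ F --> x by apply: within_cvg; exact: cvg_id.
have nq : F (fun _ => forall j, 0 <= nsq (coords z).2 0 j).
  by apply: filterE => _; exact: nsq_ge0.
have nP : F (polytope P) by rewrite /F /within /=; exact: filterE.
have n1 : F (fun y => sec h0 z y < b).
  exact: (@secn_usc R m P h0 _ F FF (coords z).1 _ id _ x cq cx (@nsq_ge0 _ _ _) Px nq nP b b1).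
have n2 := pot_lsc h0 Px d0.
rewrite /F /within /= in n1.
have := @filterI _ (nbhs x) (nbhs_filter x) _ _ n1 n2.
apply: filterS => y [H1 H2] Py.
rewrite rate_gtE//; apply: (lt_le_trans (H1 Py)).
rewrite -[b]lnK// ler_expR; have := H2 Py; rewrite /d.
move: (pot x) (pot y) (ln b); clear; move=> ? ? ? ?; lra.
Qed.

Lemma rate_lsc z : lower_semicontinuous (rate z : subspace (polytope P) -> \bar R).
Proof.
move=> x a ax; have [Px|nPx] := pselect (polytope P x); last first.
  (* Points outside [P] are isolated in the subspace topology. *)
  exists [set x]; last by move=> y ->.
  have := @nbhs_subspaceP _ (polytope P) x; case => // _.
  by [].
have H := rate_near Px ax.
exists [set y | (a%:E < rate z y)%E]; last by [].
by have := @nbhs_subspaceP _ (polytope P) x; case.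
Qed.

Lemma rate_functionP z : rate_function (polytope P) (rate z).
Proof. by split; [move=> x; exact: rate_ge0|exact: rate_lsc]. Qed.

Variables (mu0 : toric P -> 'rV[R]_m) (hmu0 : is_moment_map h0 mu0).

Lemma rate_mu0 z : rate z (mu0 z) = 0%E.
Proof.
have [Px sx] := mu_polytope_sec hmu0 z.
rewrite rateE//; last by rewrite sx gt_eqF// expR_gt0.
by rewrite sx expRK subrr.
Qed.

(** A nonzero [eta_j] is multiplied by [t^(w^j)]. Taking [t_i = 2] at an index with [w^j_i <> 0],
    and [1] elsewhere, makes this factor of modulus other than [1], while the homogeneous coordinate
    at [v] stays [1] and rules out a rescaling. *)
Lemma torus_fixed_coords (z : toric P) : torus_fixed z -> (coords z).2 = 0.
Proof.
move=> tz; set v := (coords z).1; set eta := (coords z).2.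
apply/rowP => j; rewrite mxE; apply/eqP; apply: contrapT => /negP ej.
have [i Ei] : exists i, edges P (val v) j i != 0.
  apply: contrapT => H.
  have r0 : row j (edges P (val v)) = 0.
    apply/rowP => i; rewrite !mxE; apply/eqP; apply: contrapT => /negP h; apply: H; by exists i.
  have /rowP/(_ j) := edge_coord_row v j; rewrite r0 edge_coord0 !mxE !eqxx.
  by [].
pose t : 'rV[C]_m := \row_k (if k == i then 2 else 1).
have t0 k : t 0 k != 0 by rewrite mxE; case: ifP; rewrite ?oner_eq0// pnatr_eq0.
have := tz t t0; rewrite /act; rewrite -/v -/eta.
have -> : (let '(v0, eta0) := coords z in chart v0 (act_chart v0 t eta0)) = chart v (act_chart v t eta).
  by rewrite /v /eta; case: (coords z).
rewrite -{1}(coordsK z) -/v -/eta => /esym E.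
have [c c0 cE] := chart_eqP E.
have c1 : c = 1 by have := cE (val v); rewrite !hcoord_self mulr1.
have := cE (val v + row j (edges P (val v))).
have hc e' : hcoord v e' (val v + row j (edges P (val v))) = e' 0 j.
  rewrite hcoord_lattice; last exact: edge_lattice.
  by rewrite addrAC subrr add0r edge_coord_row monomial_delta.
rewrite !hc c1 mul1r mxE => /eqP; rewrite -subr_eq0 -{2}[eta 0 j]mul1r -mulrBl mulf_eq0 (negbTE ej) orbF.
rewrite subr_eq0 => /eqP m1.
have : normsq (monomial t (row j (edges P (val v)))) = 1 by rewrite m1 normsq1.
rewrite normsq_monomial (bigD1 i)//= big1 ?mulr1; last first.
  by move=> k ki; rewrite mxE (negbTE ki) normsq1 exp1rz.
rewrite !mxE eqxx.
have -> : normsq (2 : C) = 4 by rewrite /normsq /=; ring.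
move/eqP; rewrite -powR_intmul// => /eqP/(congr1 (@ln R)); rewrite ln_powR ln1 => /eqP.
rewrite mulf_eq0 intr_eq0 (negbTE Ei) /= => /eqP l4.
by have := @ln_gt0 R 4; rewrite l4 ltxx ltr1n => /(_ isT).
Qed.

Lemma rate_fixedP : rate_fixed mu0 rate.
Proof.
move=> z tz; have e0 := torus_fixed_coords tz; set v := (coords z).1.
have s0 x : polytope P x -> sec h0 z x != 0 -> x = toR (val v).
  move=> Px; rewrite /sec e0 => /(proj1 (secn_neq0 _ _ _ _)) H.
  apply/eqP; rewrite -subr_eq0 -[x - _](edge_coordRK v); apply/eqP.
  have -> : edge_coordR v (x - toR (val v)) = 0; last by rewrite mul0mx.
  apply/rowP => j; have [|->] := H j; last by rewrite mxE.
  by rewrite nsq_eq0 mxE eqxx.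
have [Px sx] := mu_polytope_sec hmu0 z.
have muE : mu0 z = toR (val v).
  by apply: s0 => //; rewrite sx gt_eqF// expR_gt0.
split.
- by exists (val v) => //; exact: valP.
- exact: rate_mu0.
- move=> x Qx xne; rewrite /rate; case: eqVneq => // sx0.
  by exfalso; apply: xne; rewrite muE; exact: s0.
Qed.

End Rate.

Lemma flow_arith (R : realType) (a b f s t : R) :
  - a <= t - (b - f) -> t <= s -> b - s <= a + f.
Proof. by lra. Qed.

Section Flow.
Variables (R : realType) (m : nat) (P : delzant R m) (h0 : metric P).
Local Notation C := R[i].
Local Notation toR := (toR R).
Local Notation pot := (pot h0).
Implicit Types (v w : vertex P) (eta : 'rV[C]_m) (q x rho c : 'rV[R]_m).

Lemma wgtE v q : wgt h0 v q = expR (- (- ln (wgt h0 v q))).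
Proof. by rewrite opprK lnK// posrE wgt_gt0. Qed.

Lemma secn_flow v q c x t : (forall j, 0 <= q 0 j) ->
  secn h0 v (\row_j (q 0 j * expR (c 0 j * t))) x =
  secn h0 v q x * expR (t * dotp c (edge_coordR v (x - toR (val v))) -
    (curve h0 v q c t - curve h0 v q c 0)).
Proof.
move=> q0; set y := edge_coordR v (x - toR (val v)).
have c0E : curve h0 v q c 0 = - ln (wgt h0 v q).
  rewrite /curve; congr (- ln (wgt _ _ _)); apply/rowP => j.
  by rewrite !mxE mulr0 expR0 mulr1.
rewrite /secn -/y.
have -> : \prod_j (\row_j (q 0 j * expR (c 0 j * t))) 0 j `^ y 0 j =
    (\prod_j q 0 j `^ y 0 j) * expR (t * dotp c y).
  rewrite mulr_sumr expR_sum -big_split; apply: eq_bigr => j _ /=.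
  rewrite mxE powRM ?expR_ge0// -expRM; congr (_ * expR _).
  by rewrite mulrAC mulrC.
rewrite -!mulrA; congr (_ * _).
have -> : wgt h0 v (\row_j (q 0 j * expR (c 0 j * t))) = expR (- curve h0 v q c t).
  exact: wgtE.
rewrite [wgt h0 v q]wgtE -c0E -!expRD; congr expR.
by rewrite opprB addrCA addKr.
Qed.

Lemma nsq_sqrt (q : 'rV[R]_m) : (forall j, 0 <= q 0 j) ->
  nsq (\row_j (Num.sqrt (q 0 j))%:C%C) = q.
Proof. by move=> q0; apply/rowP => j; rewrite !mxE normsq_real sqr_sqrtr. Qed.

Lemma dotp_edges v l x :
  dotp (\row_j dotp l (toR (row j (edges P (val v))))) (edge_coordR v x) = dotp l x.
Proof.
rewrite -[in RHS](edge_coordRK v x) mulmx_sum_row dotp_sumr; apply: eq_bigr => j _.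
rewrite mxE dotpZr mulrC; congr (_ * dotp l _).
by apply/rowP => k; rewrite !mxE.
Qed.

(* Along the one-parameter subgroup of [l], [- log sec (mu0 z)] is strictly
   convex unless [l] is orthogonal to the edges of the orbit of [z], minimal at
   [z], and bounded above towards the face where [l] is maximal. *)
Lemma face_normal (mu0 : toric P -> 'rV[R]_m) v eta l :
  is_moment_map h0 mu0 ->
  (forall y, polytope P y -> dotp l y <= dotp l (mu0 (chart v eta))) ->
  forall j, eta 0 j != 0 -> dotp l (toR (row j (edges P (val v)))) = 0.
Proof.
move=> hmu0; set x0 := mu0 _ => lmax j ej; apply/eqP; apply: contrapT => /negP cj.
have [Px0] := mu_polytope_sec hmu0 (chart v eta); rewrite -/x0 => s0.
rewrite sec_chart// in s0.
set q := nsq eta in s0; have q0 k : 0 <= q 0 k by exact: nsq_ge0.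
pose c : 'rV[R]_m := \row_j dotp l (toR (row j (edges P (val v)))).
pose k := dotp l (x0 - toR (val v)).
have [D /(_ c)[g1 [g2 [d1 d2 _ g2pos _]]]] := curve_derive h0 v q0.
have qj : q 0 j != 0 by rewrite nsq_eq0.
have cj' : c 0 j != 0 by rewrite mxE.
have pos := g2pos j qj cj'.
(* Up to a constant, [- ln sec] at the weight [x0] along the flow of [l]: that weight contributes
   the linear term [t * k]. *)
pose f t := curve h0 v q c t - t * k.
have dk t : is_derive t (1:R) (fun s : R => - (s * k) : R^o) (- k).
  apply: is_derive_eq; rewrite /GRing.scale /= /cst/= mulr0 add0r mulr1.
  by [].
have fd1 t : is_derive t (1:R) (f : R -> R^o) (g1 t - k).
  exact: is_derive_add (d1 t) (dk t).
have fd2 t : is_derive t (1:R) ((fun t => g1 t - k) : R -> R^o) (g2 t).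
  rewrite -[g2 t]addr0; exact: is_derive_add (d2 t) (is_derive_cst _ _ _).
have [b [C0 [b0 HC Hb]]] := sec_bounds h0.
have f0 : f 0 = curve h0 v q c 0 by rewrite /f mul0r subr0.
have flow x t : secn h0 v (\row_j (q 0 j * expR (c 0 j * t))) x =
    secn h0 v q x * expR (t * dotp l (x - toR (val v)) - (curve h0 v q c t - f 0)).
  by rewrite secn_flow// dotp_edges f0.
(* [z] already realises the supremum [expR (pot x0)], so no point of the curve does better. *)
have fmin t : f 0 <= f t.
  have : secn h0 v (\row_j (q 0 j * expR (c 0 j * t))) x0 <= expR (pot x0).
    by apply: secn_le_pot => // i; rewrite mxE mulr_ge0 ?expR_ge0.
  rewrite flow s0 -/k; rewrite -expRD ler_expR gerDl.
  by rewrite /f; move: (curve _ _ _ _ t) (f 0) (t * k) => A B T; clear; lra.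
(* Some vertex [u] has norm at least [b] at time [t] and had at most [C0] at time [0], while [l] is
   no larger at [u] than at [x0]. *)
have fmax t : 0 <= t -> f t <= ln (C0 / b) + f 0.
  move=> t0.
  pose qt : 'rV[R]_m := \row_j (q 0 j * expR (c 0 j * t)).
  have qt0 i : 0 <= qt 0 i by rewrite mxE mulr_ge0 ?expR_ge0.
  have [u] := Hb (chart v (\row_j (Num.sqrt (qt 0 j))%:C%C)).
  have Pu := polytope_vert (valP u).
  rewrite sec_chart// nsq_sqrt// /qt.
  rewrite flow; set E := expR _ => bE.
  have su : secn h0 v q (toR (val u)) <= C0 by rewrite -sec_chart// HC.
  have bE' : b <= C0 * E by apply: (le_trans bE); rewrite ler_wpM2r ?expR_ge0.
  have C0p : 0 < C0.
    by have := lt_le_trans b0 bE'; rewrite pmulr_lgt0 ?expR_gt0.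
  have lE : - ln (C0 / b) <= t * dotp l (toR (val u) - toR (val v)) - (curve h0 v q c t - f 0).
    rewrite -ler_expR -/E expRN lnK ?posrE ?divr_gt0// invf_div ler_pdivrMr//.
    by rewrite mulrC.
  have lk : t * dotp l (toR (val u) - toR (val v)) <= t * k.
    by rewrite ler_wpM2l// /k !dotpBr lerD2r lmax.
  exact: flow_arith lE lk.
have := strictly_convex_bounded fd1 fd2 pos fmax.
by rewrite ltNge fmin.
Qed.

End Flow.

(** * Faces *)

Section Faces.
Variables (R : realType) (m : nat) (P : delzant R m) (h0 : metric P).
Local Notation C := R[i].
Local Notation toR := (toR R).
Local Notation pot := (pot h0).
Implicit Types (v w : vertex P) (eta : 'rV[C]_m) (q x rho c : 'rV[R]_m).

Lemma sec_neq0 v eta x : polytope P x -> (sec h0 (chart v eta) x != 0) <->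
  (forall j, eta 0 j != 0 \/ edge_coordR v (x - toR (val v)) 0 j = 0).
Proof.
move=> Px; rewrite sec_chart//; split.
  by move=> /(proj1 (secn_neq0 _ _ _ _)) H j; have := H j; rewrite nsq_eq0.
by move=> H; apply/secn_neq0 => j; rewrite nsq_eq0.
Qed.

Section FaceOrbit.
Variables (mu0 : toric P -> 'rV[R]_m) (hmu0 : is_moment_map h0 mu0).
Variables (F : set 'rV[R]_m) (z : toric P).
Hypotheses (faceF : is_face (polytope P) F) (zF : rel_interior F (mu0 z)).

(** From left to right, the segment from [x] to [mu0 z] can be prolonged inside [F]; an edge
    coordinate that vanishes at [mu0 z] but not at [x] would become negative there, against
    [edge_cone]. The converse rests on [face_normal]. *)
Lemma faceP x : F x <-> polytope P x /\ sec h0 z x != 0.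
Proof.
have [_ [l FE]] := faceF.
have [Fmu [e e0 He]] := zF.
have [Pmu smu] := mu_polytope_sec hmu0 z.
have smu0 : sec h0 z (mu0 z) != 0 by rewrite smu; exact: lt0r_neq0 (expR_gt0 _).
have lmax : forall y, polytope P y -> dotp l y <= dotp l (mu0 z).
  by have := Fmu; rewrite FE => -[].
set v := (coords z).1; set eta := (coords z).2.
have zE : z = chart v eta by rewrite coordsK.
have lmax' : forall y, polytope P y -> dotp l y <= dotp l (mu0 (chart v eta)) by rewrite -zE.
have cmu : forall j, eta 0 j != 0 \/ edge_coordR v (mu0 z - toR (val v)) 0 j = 0.
  by apply/(sec_neq0 v eta Pmu); rewrite -zE.
split.
  move=> Fx; have Px : polytope P x by have := Fx; rewrite FE => -[].
  split=> //; rewrite zE; apply/(sec_neq0 v eta Px) => j.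
  have [|ej] := eqVneq (eta 0 j) 0; last by left.
  move=> ej; right.
  have mj : edge_coordR v (mu0 z - toR (val v)) 0 j = 0 by have [|//] := cmu j; rewrite ej eqxx.
  (* Keeps the prolonged point within [e] of [mu0 z]; the added [1] covers [x = mu0 z]. *)
  pose s := e / (2 * (`|mu0 z - x| + 1)).
  have n0 : 0 < `|mu0 z - x| + 1 by rewrite ltr_wpDl.
  have s0 : 0 < s by rewrite divr_gt0// mulr_gt0.
  have Fy : F (mu0 z + s *: (mu0 z - x)).
    apply: He.
      exists 2%N, (fun i : 'I_2 => if i == 0 then mu0 z else x),
        (fun i : 'I_2 => if i == 0 then 1 + s else - s); split.
      - by move=> i; case: ifP.
      - by rewrite big_ord_recl big_ord1 /= addrK.
      - by rewrite big_ord_recl big_ord1 /= scalerDl scale1r scalerBr scaleNr addrA.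
    rewrite addrAC subrr add0r normrZ gtr0_norm// /s.
    rewrite mulrAC ltr_pdivrMr ?mulr_gt0// ltr_pM2l//.
    apply: (@lt_le_trans _ _ (`|mu0 z - x| + 1)); first by rewrite ltrDl.
    by rewrite ler_peMl ?ler1n// ltW.
  have Py : polytope P (mu0 z + s *: (mu0 z - x)) by have := Fy; rewrite FE => -[].
  have := edge_cone v j Py.
  have -> : mu0 z + s *: (mu0 z - x) - toR (val v) =
    (mu0 z - toR (val v)) + s *: ((mu0 z - toR (val v)) - (x - toR (val v))).
    by rewrite opprB addrA subrK addrAC.
  have := edge_cone v j Px.
  set A := mu0 z - _ in mj *; set B := x - _.
  rewrite edge_coordRD edge_coordRZ edge_coordRB [in X in _ -> X -> _]mxE mj add0r.
  rewrite [in X in _ -> X -> _]mxE [in X in _ -> X -> _]mxE mj add0r [in X in _ -> X -> _]mxE.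
  rewrite mulrN oppr_ge0 pmulr_rle0// => h1 h2.
  by apply/eqP; rewrite eq_le h1 h2.
move=> [Px sx]; rewrite FE; split => // y Py; apply: (le_trans (lmax y Py)).
(* By [face_normal], [l] kills the edge directions with [eta 0 j != 0], so it is constant on the
   weights whose section does not vanish at [z]. *)
suff H u : (forall j, eta 0 j != 0 \/ edge_coordR v (u - toR (val v)) 0 j = 0) ->
    dotp l u = dotp l (toR (val v)).
  by rewrite (H _ cmu) H//; apply/(sec_neq0 v eta Px); rewrite -zE.
move=> Hu; apply/eqP; rewrite -subr_eq0 -dotpBr -(dotp_edges v).
apply/eqP; apply: big1 => j _; rewrite mxE.
have [ej|->] := Hu j; last by rewrite mulr0.
by rewrite (face_normal hmu0 lmax' ej) mul0r.
Qed.

(** The section of [w] does not vanish at [z], so [z] lies in the chart of [w]. If [eta_j = 0], the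
    [j]-th edge coordinate vanishes on [F] by [faceP], hence on its affine hull, whereas it is [1]
    at [w + w^j]; otherwise [w + w^j] itself lies in [F]. *)
Lemma face_chart w : F (toR (val w)) -> exists eta : 'rV[C]_m,
  z = chart w eta /\ forall j, (eta 0 j != 0) = face_dirs F w j.
Proof.
move=> Fw; have [Pw sw] := (faceP _).1 Fw.
pose eta' := \row_i monomial (coords z).2
  (edge_coord (coords z).1 (row i (edges P (val w)))).
have zE : z = chart w eta'.
  rewrite /eta' -chart_change ?coordsK//.
  apply/monomial_neq0 => j; have := sw; rewrite -[z]coordsK => /(sec_neq0 _ _ Pw)/(_ j).
  rewrite coordsK => -[|h]; [by left|right].
  by move: h; rewrite -toRB edge_coordR_toR mxE => /eqP; rewrite intr_eq0 => /eqP.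
clearbody eta'; exists eta'; split => // j.
have co x : F x -> eta' 0 j != 0 \/ edge_coordR w (x - toR (val w)) 0 j = 0.
  by move=> /faceP[Px]; rewrite zE => /(sec_neq0 _ _ Px).
apply/idP/idP => [ej|].
  have Px : polytope P (toR (val w + row j (edges P (val w)))).
    have := lattice_polytope (isT : (0 < 1)%N) (edge_lattice w j).
    by rewrite invr1 scale1r.
  apply/asboolP; exists 1%N, (fun=> toR (val w + row j (edges P (val w)))), (fun=> 1).
  split; rewrite ?big_ord1 ?scale1r// => _; apply/faceP; split => //.
  rewrite zE; apply/(sec_neq0 w eta' Px) => k.
  rewrite toRD addrAC subrr add0r edge_coordR_toR edge_coord_row !mxE eqxx /=.
  by have [->|] := eqVneq k j; [left|right].
move=> /asboolP[n [p [t [Fp t1 E]]]]; apply/negP => /eqP ej.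
have : edge_coordR w (toR (val w + row j (edges P (val w))) - toR (val w)) 0 j = 1.
  by rewrite toRD addrAC subrr add0r edge_coordR_toR edge_coord_row !mxE !eqxx.
rewrite E -[toR (val w)]scale1r -t1 scaler_suml -sumrB.
have -> : \sum_i (t i *: p i - t i *: toR (val w)) = \sum_i t i *: (p i - toR (val w)).
  by apply: eq_bigr => i _; rewrite scalerBr.
rewrite /edge_coordR mulmx_suml summxE big1 => [/esym/eqP|i _]; first by rewrite t1 oner_eq0.
rewrite -scalemxAl mxE -/(edge_coordR w _).
by have [|->] := co _ (Fp i); rewrite ?mulr0// ej eqxx.
Qed.

End FaceOrbit.

Section FacePotential.
Variables (F : set 'rV[R]_m) (w : vertex P).
Local Notation dirs := (face_dirs F w).

Definition face_supported x := forall j, ~~ dirs j -> edge_coordR w (x - toR (val w)) 0 j = 0.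

Lemma ln_secn q x : (forall j, 0 <= q 0 j) -> (forall j, dirs j -> q 0 j != 0) ->
  face_supported x ->
  ln (secn h0 w q x) = face_dotp F w x (\row_j ln (q 0 j)) + ln (wgt h0 w q).
Proof.
move=> q0 qd Fx.
have q0' j : dirs j -> 0 < q 0 j by move=> dj; rewrite lt_neqAle eq_sym qd//= q0.
have -> : secn h0 w q x = expR (face_dotp F w x (\row_j ln (q 0 j))) * wgt h0 w q.
  rewrite /secn; congr (_ * _); rewrite /face_dotp expR_sum [RHS]big_mkcond.
  apply: eq_bigr => j _; case: ifPn => [dj|dj]; last by rewrite Fx// powRr0.
  by rewrite mxE /powR (negbTE (qd _ dj)).
by rewrite lnM ?posrE ?expR_gt0 ?wgt_gt0// expRK.
Qed.

Lemma phi_face_chart eta : phi_face h0 w (chart w eta) = - ln (wgt h0 w (nsq eta)).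
Proof.
rewrite /phi_face section_normsqE//; last exact: vert_lattice.
rewrite invr1 scale1r expr1 sec_chart; last exact: polytope_vert (valP w).
by rewrite sec_vertex weight_abs.
Qed.

Definition face_q rho : 'rV[R]_m := \row_j (if dirs j then expR (rho 0 j) else 0).

Lemma face_pointE rho : face_point F w rho = chart w (\row_j (Num.sqrt (face_q rho 0 j))%:C%C).
Proof.
congr chart; apply/rowP => j; rewrite !mxE; case: ifP => _; last by rewrite sqrtr0.
congr (_%:C%C); have -> : expR (rho 0 j) = expR (rho 0 j / 2) ^+ 2.
  by rewrite expr2 -expRD -splitr.
by rewrite sqrtr_sqr ger0_norm// expR_ge0.
Qed.

Lemma face_q_ge0 rho j : 0 <= face_q rho 0 j.
Proof. by rewrite mxE; case: ifP => // _; exact: expR_ge0. Qed.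

Lemma face_term rho x : polytope P x -> face_supported x ->
  face_dotp F w x rho - phi_face h0 w (face_point F w rho) =
  ln (secn h0 w (face_q rho) x).
Proof.
move=> Px Fx; rewrite ln_secn//; last 2 first.
- exact: face_q_ge0.
- by move=> j dj; rewrite mxE dj; exact: lt0r_neq0 (expR_gt0 _).
rewrite face_pointE phi_face_chart nsq_sqrt; last exact: face_q_ge0.
rewrite opprK; congr (_ + _); apply: eq_bigr => j dj.
by rewrite mxE [face_q _ _ _]mxE dj expRK.
Qed.

(* Degenerating a point of the open orbit to the orbit of the face along the
   directions transversal to the face increases [|s_w|]. *)
Lemma wgt_degenerate rho :
  wgt h0 w (expq w rho) <= wgt h0 w (face_q (\row_j dotp rho (toR (row j (edges P (val w)))))).
Proof.
set q := expq w rho; set q' := face_q _.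
have q0 k : 0 <= q 0 k by rewrite mxE expR_ge0.
pose c : 'rV[R]_m := \row_j (if dirs j then 0 else -1).
have [D /(_ c)[g1 [g2 [d1 d2 g2_0 _ _]]]] := curve_derive h0 w q0.
have q'E j : q' 0 j = if dirs j then q 0 j else 0 by rewrite !mxE.
(* In the parameter [u = e^(-t)] the curve extends continuously to [u = 0], where it reaches [q'];
   this gives the limit for [convex_limit_le]. *)
pose path (u : R) : 'rV[R]_m := \row_j (if dirs j then q 0 j else q 0 j * u).
have path0 : path 0 = q' by apply/rowP => j; rewrite q'E mxE mulr0.
have cpath : path @ (0 : R) --> path 0.
  apply: (@cvg_row R m _ (nbhs (0:R)) (fun j u => if dirs j then q 0 j else q 0 j * u)
            (fun j => if dirs j then q 0 j else q 0 j * 0) (nbhs_filter (0:R))) => j.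
  case: ifP => _; first exact: cvg_cst.
  by apply: cvgM; [exact: cvg_cst|exact: cvg_id].
have cw : (fun u => - ln (wgt h0 w (path u))) @ (0:R) --> - ln (wgt h0 w q').
  apply: cvgN; rewrite -path0.
  apply: (@cvg_comp _ _ _ (fun u => wgt h0 w (path u)) (@ln R)); last first.
    by apply: continuous_ln; exact: wgt_gt0.
  by apply: (@cvg_comp _ _ _ path (wgt h0 w) _ (nbhs (path 0))) => //; exact: wgt_continuous.
have c0E : curve h0 w q c 0 = - ln (wgt h0 w q).
  rewrite /curve; congr (- ln (wgt _ _ _)); apply/rowP => j.
  by rewrite mxE mulr0 expR0 mulr1.
suff : - ln (wgt h0 w q') <= curve h0 w q c 0.
  by rewrite c0E lerN2 ler_ln ?posrE ?wgt_gt0.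
apply: (@convex_limit_le R (curve h0 w q c) g1 g2 d1 d2) => // e e0.
have /cvgrPdist_le/(_ e e0)/nbhs_ballP[r /= r0 Hr] := cw.
exists (- ln (r / 2)) => t tr.
have Et : expR (- t) < r.
  apply: (@le_lt_trans _ _ (r / 2)); last by rewrite ltr_pdivrMr// ltr_pMr// ltr1n.
  by rewrite -[r / 2]lnK ?posrE ?divr_gt0// ler_expR lerNl.
have := Hr (expR (- t)); rewrite /ball /= sub0r normrN gtr0_norm ?expR_gt0// => /(_ Et).
have -> : curve h0 w q c t = - ln (wgt h0 w (path (expR (- t)))); last by rewrite distrC.
congr (- ln (wgt _ _ _)); apply/rowP => j; rewrite !mxE.
by case: ifP; rewrite ?mul0r ?expR0 ?mulr1// mulN1r.
Qed.

(** On the face, [u_F] and [u_0] agree. Points of the orbit of [F] are points of [M], so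
    [secn_le_pot] gives one inequality. For the other, each [rho] is beaten by its degeneration to
    that orbit: the monomial factor is unchanged and the weight increases. *)
Lemma symp_pot_faceE x : polytope P x -> face_supported x ->
  symp_pot_face h0 F w x = symp_pot h0 x.
Proof.
move=> Px Fx; rewrite symp_potE//; apply/eqP; rewrite eq_le; apply/andP; split.
  apply: ge_ereal_sup => _ [rho _ <-]; rewrite lee_fin face_term//.
  have s0 : 0 < secn h0 w (face_q rho) x.
    rewrite lt_neqAle secn_ge0 andbT eq_sym; apply/secn_neq0 => j.
    have [dj|dj] := boolP (dirs j); last by right; exact: Fx.
    by left; rewrite mxE dj; exact: lt0r_neq0 (expR_gt0 _).
  rewrite -ler_expR lnK//; apply: secn_le_pot => //; exact: face_q_ge0.
rewrite -(symp_potE h0 Px); apply: ge_ereal_sup => _ [rho _ <-].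
pose rho' : 'rV[R]_m := \row_j dotp rho (toR (row j (edges P (val w)))).
apply: (@le_trans _ _ (face_dotp F w x rho' - phi_face h0 w (face_point F w rho'))%:E); last first.
  by apply: ereal_sup_ubound; exists rho'.
have q0 j : 0 < expq w rho 0 j by rewrite mxE expR_gt0.
rewrite lee_fin face_term// -ler_expR -(secn_expqE h0 w rho Px) lnK; last first.
  rewrite posrE.
  rewrite lt_neqAle secn_ge0 andbT eq_sym; apply/secn_neq0 => j.
  have [dj|dj] := boolP (dirs j); last by right; exact: Fx.
  by left; rewrite mxE dj; exact: lt0r_neq0 (expR_gt0 _).
rewrite /secn; apply: ler_pM; first by apply: prodr_ge0 => j _; exact: powR_ge0.
- exact/ltW/wgt_gt0.
- rewrite le_eqVlt; apply/orP; left; apply/eqP; apply: eq_bigr => j _; have [dj|dj] := boolP (dirs j).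
    by rewrite !mxE dj.
  by rewrite Fx// !powRr0.
- exact: wgt_degenerate.
Qed.

End FacePotential.

Lemma rate_faceP (mu0 : toric P -> 'rV[R]_m) : is_moment_map h0 mu0 ->
  rate_face h0 mu0 (rate h0).
Proof.
move=> hmu0 F w z faceF _ Fw zF.
have [eta [zE dE]] := face_chart hmu0 faceF zF Fw.
exists eta; split=> //.
- move=> x /(faceP hmu0 faceF zF)[Px sx].
  have Fx : face_supported F w x.
    move=> j; rewrite -dE negbK => ej; have := sx; rewrite zE => /(sec_neq0 _ _ Px)/(_ j).
    by rewrite ej; case.
  rewrite /rate (negbTE sx) symp_pot_faceE// zE phi_face_chart sec_chart//.
  rewrite (@ln_secn F w (nsq eta) x); last 3 first.
  + exact: nsq_ge0.
  + by move=> j; rewrite -dE nsq_eq0.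
  + exact: Fx.
  have -> : (\row_j ln (nsq eta 0 j)) = \row_j ln (normsq (eta 0 j)).
    by apply/rowP => j; rewrite !mxE.
  rewrite (symp_potE h0 Px).
  move: (pot x) (face_dotp _ _ _ _) (ln _) => a b c.
  by rewrite -[RHS]/((a - b + - c)%:E) -EFinB opprD addrA.
- move=> x Px nFx; rewrite /rate; case: eqVneq => // sx.
  by exfalso; apply: nFx; apply/(faceP hmu0 faceF zF).
Qed.

End Faces.

(** * The Laplace principle *)

Lemma discrete_probability d (T : measurableType d) (R : realType) n
    (w : nat -> {nonneg R}) (x : nat -> T) : \sum_(k < n) (w k)%:num = 1 ->
  exists Q : probability T R,
    (forall A, measurable A -> Q A = (\sum_(k < n) (w k)%:num%:E * \d_(x k) A)%E) /\
    forall (D : set T) (f : T -> R), measurable D -> (forall k, D (x k)) ->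
      (forall y, D y -> 0 <= f y) -> measurable_fun D f ->
      (\int[Q]_(y in D) (f y)%:E = (\sum_(k < n) (w k)%:num * f (x k))%:E)%E.
Proof.
move=> w1.
pose mk (k : nat) : {measure set T -> \bar R} := mscale (w k) (\d_(x k)).
pose M : {measure set T -> \bar R} := msum mk n.
have MT : M setT = 1%E.
  rewrite /M /= /msum -w1 -sumEFin; apply: eq_bigr => k _.
  by rewrite /mk /= /mscale /= diracT mule1.
pose QT := @Measure_isProbability.Build d T R M MT.
pose Q : probability T R := HB.pack (Measure.sort M) QT.
exists Q; split=> [A mA|D f mD Dx f0 mf].
  by [].
have -> : (\int[Q]_(y in D) (f y)%:E = \int[msum mk n]_(y in D) (f y)%:E)%E by [].
have mf' : measurable_fun D (EFin \o f) by exact/measurable_EFinP.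
have f0' y : D y -> (0 <= (f y)%:E)%E by move=> Dy; rewrite lee_fin f0.
rewrite ge0_integral_measure_sum// -sumEFin; apply: eq_bigr => k _.
rewrite ge0_integral_mscale//.
by rewrite integral_dirac// diracE mem_set// mul1e -EFinM.
Qed.

Section Measurability.
Variables (R : realType) (m : nat) (P : delzant R m).

Lemma measurable_polytope : measurable (polytope P : set (borel_rV R m)).
Proof.
rewrite -[polytope P]setCK; apply: measurableC; apply: sub_sigma_algebra.
by rewrite openC; exact: polytope_closed.
Qed.

Lemma measurable_within (h : 'rV[R]_m -> R) : {within polytope P, continuous h} ->
  measurable_fun (polytope P : set (borel_rV R m)) h.
Proof.
move=> /continuousP ch; apply: (measurability _ (RGenOpens.measurableE R)).
move=> _ [_ [a [b ->] <-]].
have /open_subspaceP[U oU UE] : open (h @^-1` `]a, b[ : set (subspace (polytope P))).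
  exact/ch/interval_open.
rewrite setIC -UE; apply: measurableI; last exact: measurable_polytope.
exact: sub_sigma_algebra.
Qed.

End Measurability.

(** * Lattice points of the dilated polytope *)

Section Lattice.
Variables (R : realType) (m : nat) (P : delzant R m) (h0 : metric P).
Local Notation toR := (toR R).
Local Notation pot := (pot h0).
Implicit Types (x y : 'rV[R]_m).

Lemma polytope_bounded : exists B : nat, forall x, polytope P x -> `|x| <= B%:R.
Proof.
have [M [_ HM]] := compact_bounded (@polytope_compact R m P).
have h : M < `|M| + 1 by rewrite ltr_pwDr// ler_norm.
exists (Num.truncn (`|M| + 1)).+1 => x Px.
apply: (le_trans (HM _ h x Px)); apply/ltW; exact: truncnS_gt.
Qed.

Definition lattice_seq N : seq 'rV[int]_m :=
  finmap.enum_fset (fset_set (lattice_points P N)).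

(** [P] lies in the positive orthant, so the coordinates of a lattice point of [N P] are integers
    from [0] to [N * B]. *)
Lemma lattice_card : exists B : nat, forall N, finite_set (lattice_points P N) /\
  (size (lattice_seq N) <= (N * B).+1 ^ m)%N.
Proof.
have [B HB] := polytope_bounded; exists B => N.
pose g (f : {ffun 'I_m -> 'I_(N * B).+1}) : 'rV[int]_m := \row_j (nat_of_ord (f j))%:Z.
pose s := [seq g f | f <- enum {ffun 'I_m -> 'I_(N * B).+1}].
have sub a : lattice_points P N a -> a \in s.
  move=> [x Px ax]; apply/mapP.
  have aj j : (0 <= a 0 j) && (a 0 j <= (N * B)%:Z).
    have E : (a 0 j)%:~R = N%:R * x 0 j :> R by have /rowP/(_ j) := ax; rewrite !mxE.
    rewrite -!(ler_int R) E mulr_ge0//=; last exact: polytope_ge0 Px j.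
    rewrite -[in leRHS]pmulrn natrM ler_wpM2l//.
    apply: (le_trans _ (HB x Px)); apply: (le_trans (ler_norm _)).
    by rewrite [leRHS]mx_normrE; apply: (le_bigmax _ (fun ij => `|x ij.1 ij.2|) (0, j)).
  exists [ffun j => inord (absz (a 0 j))]; first by rewrite mem_enum.
  apply/rowP => j; have /andP[a0 aB] := aj j.
  rewrite mxE ffunE inordK ?gez0_abs// ltnS -lez_nat gez0_abs//.
have fin : finite_set (lattice_points P N).
  by apply: (@sub_finite_set _ _ [set` s]) => //; exact: finite_seq.
split=> //.
rewrite -[leqRHS](_ : size s = _); last by rewrite size_map -cardE card_ffun !card_ord.
apply: uniq_leq_size; first exact: finmap.fset_uniq.
by move=> a; rewrite /lattice_seq in_fset_set// inE => /sub.
Qed.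

Lemma lattice_count (e : R) : 0 < e -> exists2 K : R, 0 < K & forall N,
  ((size (lattice_seq N))%:R <= K * expR (N%:R * e)).
Proof.
move=> e0; have [B HB] := lattice_card.
(* [K0] is such that [N * B + 1 <= K0 * (1 + N * d) <= K0 * expR (N * d)]. Dividing [e] by [m + 1]
   leaves room for the power [m] and covers [m = 0]. *)
pose d := e / m.+1%:R; have d0 : 0 < d by rewrite divr_gt0.
pose K0 := B%:R / d + 1; have K00 : 0 < K0 by rewrite ltr_wpDl// divr_ge0// ltW.
exists (K0 ^+ m); first exact: exprn_gt0.
move=> N; have [_ HN] := HB N.
apply: (@le_trans _ _ (((N * B).+1 ^ m)%N%:R)); first by rewrite ler_nat.
have h1 : (N * B).+1%:R <= K0 * expR (N%:R * d).
  apply: (@le_trans _ _ (K0 * (1 + N%:R * d))); last first.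
    by rewrite ler_pM2l// expR_ge1Dx.
  rewrite -natr1 natrM /K0 mulrDl mulrDr mulr1 mul1r.
  have -> : B%:R / d * (N%:R * d) = N%:R * B%:R :> R by field; rewrite gt_eqF.
  have : 0 <= B%:R / d by rewrite divr_ge0// ltW.
  have : 0 <= N%:R * d by rewrite mulr_ge0// ltW.
  by move: (B%:R / d) (N%:R * d) (N%:R * B%:R) => a b c; lra.
rewrite natrX; apply: (@le_trans _ _ ((K0 * expR (N%:R * d)) ^+ m)).
  by apply: lerXn2r => //; rewrite nnegrE ?ler0n// mulr_ge0 ?expR_ge0// ltW.
rewrite exprMn ler_pM2l ?exprn_gt0// -expRM_natl ler_expR.
rewrite mulrCA ler_wpM2l//.
rewrite /d mulrA ler_pdivrMr// mulrC ler_pM2l// ler_nat.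
exact: leqnSn.
Qed.

(* Round the barycentric coordinates of [N x] down and give the whole defect to
   one vertex; [x] is a convex combination of the results. *)
Lemma rounding : exists2 c : R, 0 <= c & forall N z x, (0 < N)%N -> polytope P x ->
  exists2 a, lattice_points P N a &
    `|N%:R^-1 *: toR a - x| <= c / N%:R /\ sec h0 z x <= sec h0 z (N%:R^-1 *: toR a).
Proof.
have [B HB] := polytope_bounded.
pose n := size (verts P).
(* The difference consists of the defect [G] given to one vertex and the fractional parts taken
   away. The [n] fractional parts are below [1] and sum to [G], so each contribution is at most
   [n * B / N]. *)
exists (2 * n%:R * B%:R) => [|N z x N0 [t [t0 t1 xE]]]; first by rewrite !mulr_ge0.
have Px : polytope P x by exists t.
rewrite -/n in t t0 t1 xE.
pose V (i : 'I_n) : 'rV[int]_m := nth 0 (verts P) i.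
have NR : 0 < N%:R :> R by rewrite ltr0n.
have PV i : polytope P (toR (V i)) by apply: polytope_vert; exact: mem_nth.
pose k i := Num.truncn (N%:R * t i).
pose f i := N%:R * t i - (k i)%:R.
have kf i : 0 <= f i < 1.
  have := truncn_itv (mulr_ge0 (ler0n R N) (t0 i)); rewrite -/(k i) => /andP[h1 h2].
  by rewrite subr_ge0 h1 ltrBlDl natr1.
have sk : (\sum_i k i <= N)%N.
  rewrite -(ler_nat R) natr_sum; apply: (@le_trans _ _ (\sum_i N%:R * t i)); last first.
    by rewrite -mulr_sumr t1 mulr1.
  apply: ler_sum => i _.
  by have /andP[] := kf i; rewrite subr_ge0.
pose G := (N - \sum_i k i)%N.
have sf : \sum_i f i = G%:R.
  by rewrite /f sumrB -mulr_sumr t1 mulr1 natrB// natr_sum.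
pose a i : 'rV[int]_m := \sum_j V j *+ k j + V i *+ G.
have toRa i : N%:R^-1 *: toR (a i) =
    \sum_j (N%:R^-1 * (k j)%:R) *: toR (V j) + (N%:R^-1 * G%:R) *: toR (V i).
  rewrite toRD toRMn scalerDr scalerA; congr (_ + _).
  have -> : toR (\sum_j V j *+ k j) = \sum_j (k j)%:R *: toR (V j).
    elim/big_rec2: _ => [|j y1 y2 _ <-]; first exact: toR0.
    by rewrite toRD toRMn.
  by rewrite scaler_sumr; apply: eq_bigr => j _; rewrite scalerA.
have xN : x = \sum_j (N%:R^-1 * (k j)%:R) *: toR (V j) + \sum_j (N%:R^-1 * f j) *: toR (V j).
  rewrite xE -big_split; apply: eq_bigr => j _ /=; rewrite -scalerDl -mulrDr /f.
  by rewrite addrC subrK mulKf// gt_eqF.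
have Pa i : polytope P (N%:R^-1 *: toR (a i)).
  exists (fun j => N%:R^-1 * (k j)%:R + (j == i)%:R * (N%:R^-1 * G%:R)); split.
  - by move=> j; rewrite addr_ge0// !mulr_ge0// invr_ge0 ltW.
  - have -> : \sum_j (N%:R^-1 * (k j)%:R + (j == i)%:R * (N%:R^-1 * G%:R)) =
        N%:R^-1 * (\sum_j k j)%N%:R + N%:R^-1 * G%:R :> R.
      rewrite big_split /= natr_sum mulr_sumr; congr (_ + _).
      rewrite (bigD1 i)//= eqxx mul1r big1 ?addr0// => j /negbTE->.
      by rewrite mul0r.
    by rewrite -mulrDr -natrD subnKC// mulVf// gt_eqF.
  - rewrite toRa; under [RHS]eq_bigr do rewrite scalerDl.
    rewrite big_split /=; congr (_ + _).
    rewrite [RHS](bigD1 i)//= eqxx mul1r big1 ?addr0// => j /negbTE->.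
    by rewrite mul0r scale0r.
have La i : lattice_points P N (a i).
  by exists (N%:R^-1 *: toR (a i)) => //; rewrite scalerA divff ?scale1r// gt_eqF.
have dist i : `|N%:R^-1 *: toR (a i) - x| <= 2 * n%:R * B%:R / N%:R.
  have Gn : G%:R <= n%:R :> R.
    have -> : n%:R = \sum_(j < n) (1 : R) by rewrite sumr_const card_ord.
    rewrite -sf; apply: ler_sum => j _.
    by have /andP[_ /ltW] := kf j.
  rewrite toRa xN opprD addrACA subrr add0r.
  have b1 : `|(N%:R^-1 * G%:R) *: toR (V i)| <= N%:R^-1 * n%:R * B%:R.
    rewrite normrZ normrM !ger0_norm ?invr_ge0//.
    by rewrite ler_pM ?mulr_ge0 ?invr_ge0// ?HB// ler_wpM2l ?invr_ge0.
  have b2 : `|\sum_j (N%:R^-1 * f j) *: toR (V j)| <= N%:R^-1 * n%:R * B%:R.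
    apply: (le_trans (ler_norm_sum _ _ _)).
    apply: (@le_trans _ _ (\sum_(j < n) N%:R^-1 * f j * B%:R)).
      apply: ler_sum => j _; have /andP[fj _] := kf j.
      rewrite normrZ normrM !ger0_norm ?invr_ge0//.
      by rewrite ler_wpM2l ?HB// mulr_ge0 ?invr_ge0.
    rewrite -mulr_suml -mulr_sumr sf ler_wpM2r// ler_wpM2l ?invr_ge0//.
  apply: (le_trans (ler_normB _ _)).
  have -> : 2 * n%:R * B%:R / N%:R = N%:R^-1 * n%:R * B%:R + N%:R^-1 * n%:R * B%:R :> R.
    by rewrite -[in RHS]mulr2n -[RHS]mulr_natl; ring.
  exact: lerD.
have n0 : (0 < n)%N.
  rewrite lt0n; apply: contra_eqN t1 => /eqP nE.
  rewrite big1 ?(eq_sym 0) ?oner_eq0// => -[i Hi] _; exfalso.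
  by rewrite nE in Hi.
pose i0 := Ordinal n0.
(* Without defect [x] is itself [a / N]; the weights [f i / G] below make sense only for [G > 0]. *)
have [|G0] := posnP G.
  move=> G0; exists (a i0) => //; split; first exact: dist.
  suff -> : N%:R^-1 *: toR (a i0) = x by [].
  rewrite toRa xN G0 mulr0 scale0r; congr (_ + _); rewrite big1// => j _.
  have /eqP := sf; rewrite G0 psumr_eq0 => [/allP/(_ j)|i _]; last by have /andP[] := kf i.
  by rewrite mem_index_enum => /(_ isT)/eqP->; rewrite mulr0 scale0r.
pose s i := sec h0 z (N%:R^-1 *: toR (a i)).
have GR : 0 < G%:R :> R by rewrite ltr0n.
(* [x] is the mean of the points [a i / N] with weights [f i / G], so [sec z x] is a weighted
   geometric mean of the [s i] and the largest of them dominates it. *)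
have xs : sec h0 z x = \prod_i s i `^ (f i / G%:R).
  rewrite -secn_convex.
  - congr secn; rewrite xN.
    under [RHS]eq_bigr do rewrite toRa scalerDr.
    rewrite big_split /= -scaler_suml -mulr_suml sf divff ?gt_eqF// scale1r; congr (_ + _).
    apply: eq_bigr => j _; rewrite scalerA; congr (_ *: _).
    by field; rewrite !gt_eqF.
  - by move=> j; exact: nsq_ge0.
  - by move=> i; have /andP[fi _] := kf i; rewrite divr_ge0.
  - by rewrite -mulr_suml sf divff// gt_eqF.
  - exact: Pa.
have [im Hm] : exists im : 'I_n, forall i, s i <= s im.
  case: (@Order.TotalTheory.arg_maxP _ _ 'I_n i0 xpredT s isT) => im _ H.
  by exists im => i; exact: H.
exists (a im) => //; split; first exact: dist.
rewrite xs -/(s im).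
have sm : s im = \prod_i s im `^ (f i / G%:R).
  rewrite -powR_sum_ge0; last by move=> i; have /andP[fi _] := kf i; rewrite divr_ge0.
  by rewrite -mulr_suml sf divff ?gt_eqF// powRr1// sec_ge0.
rewrite [leRHS]sm; apply: ler_prod => i _; rewrite powR_ge0 /=.
have /andP[fi _] := kf i.
by rewrite ge0_ler_powR ?nnegrE ?sec_ge0// divr_ge0.
Qed.

End Lattice.

Section Limits.
Variables (R : realType).

Lemma limn_esup_le0 (u : nat -> \bar R) :
  (forall e : R, 0 < e -> exists N, forall k, (N <= k)%N -> (u k <= e%:E)%E) ->
  (limn_esup u <= 0)%E.
Proof.
move=> H; apply/lee_addgt0Pr => e e0; rewrite add0e.
have [N HN] := H e e0; rewrite /limn_esup limf_esupE.
apply: (@le_trans _ _ (ereal_sup (u @` [set k | (N <= k)%N]))).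
  by apply: ereal_inf_lbound; exists [set k | (N <= k)%N] => //; exists N.
by apply: ge_ereal_sup => _ [k /= Nk <-]; exact: HN.
Qed.

Lemma limn_einf_ge0 (u : nat -> \bar R) :
  (forall e : R, 0 < e -> exists N, forall k, (N <= k)%N -> ((- e)%:E <= u k)%E) ->
  (0 <= limn_einf u)%E.
Proof.
move=> H; rewrite /limn_einf oppe_ge0; apply: limn_esup_le0 => e e0.
by have [N HN] := H e e0; exists N => k /HN; rewrite EFinN leeNl.
Qed.

End Limits.

(** * Exponential bounds for the partition sums *)

Section Partition.
Variables (R : realType) (m : nat) (P : delzant R m) (h0 : metric P).
Local Notation toR := (toR R).
Local Notation pot := (pot h0).
Implicit Types (x y : 'rV[R]_m) (z : toric P) (h : 'rV[R]_m -> R).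

(** Continuity relative to [P], in a form that both [pot] and a test function continuous within [P]
    satisfy. *)
Definition local_modulus h := forall x, polytope P x -> forall e, 0 < e ->
  \forall y \near x, polytope P y -> `|h y - h x| <= e.

Lemma polytope_unif h : local_modulus h -> forall e, 0 < e -> exists2 d, 0 < d &
  forall x y, polytope P x -> polytope P y -> `|y - x| < d -> `|h y - h x| <= e.
Proof.
move=> hm e e0; pose F := (0:R)^'+.
have FPF : ProperFilter F by exact: at_right_proper_filter.
have H : F (fun r => polytope P `<=` (fun x => polytope P x -> forall y, polytope P y ->
    `|y - x| < r -> `|h y - h x| <= e)).
  have nc := proj1 (compact_near_coveringP _) (@polytope_compact R m P).
  have FF : Filter F by exact: filter_filter.
  apply: (nc R F (fun r x => polytope P x -> forall y, polytope P y ->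
    `|y - x| < r -> `|h y - h x| <= e) FF) => x Px.
  have e2 : 0 < e / 2 by rewrite divr_gt0.
  have /nbhs_ballP[r /= r0 Hr] := hm x Px _ e2.
  have r2 : 0 < r / 2 by rewrite divr_gt0.
  exists (ball x (r / 2), [set s | s < r / 2]).
    split; first exact: nbhsx_ballx.
    exact: nbhs_right_lt.
  move=> [x' s] /= [bx sr] Px' y Py ys.
  have rr : r / 2 < r by rewrite ltr_pdivrMr// ltr_pMr// ltr1n.
  have h1 := Hr x' (le_ball (ltW rr) bx) Px'.
  have by_ : ball x r y.
    rewrite -ball_normE /= -(subrKA x') [r]splitr.
    apply: (le_lt_trans (ler_normD _ _)); rewrite ltrD//.
      by move: bx; rewrite -ball_normE.
    by rewrite distrC; exact: lt_trans sr.
  have h2 := Hr y by_ Py.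
  rewrite -(subrKA (h x)) [e]splitr; apply: (le_trans (ler_normD _ _)).
  by rewrite lerD// distrC.
have H2 : F (fun r => 0 < r) by exact: nbhs_right_gt.
have [r [Hr r0]] := filter_ex (filterI H H2).
by exists r => // x y Px; exact: Hr.
Qed.

Lemma pot_modulus : local_modulus pot.
Proof.
move=> x Px e e0.
have := @filterI _ (nbhs x) (nbhs_filter x) _ _ (pot_usc h0 Px e0) (pot_lsc h0 Px e0).
apply: filterS => y [H1 H2] Py; rewrite ler_norml.
have h1 := H1 Py; have h2 := H2 Py.
by rewrite lerBrDl h2 lerBlDl h1.
Qed.

Lemma within_modulus h : {within polytope P, continuous h} -> local_modulus h.
Proof.
move=> ch x Px e e0; have /cvgrPdist_le/(_ e e0) := ch x.
have := @nbhs_subspaceP _ (polytope P) x; case => // _.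
move=> H; apply: (@filterS _ (nbhs x) _ (fun y => polytope P y -> `|h x - h y| <= e)); last exact: H.
by move=> y Hy Py; rewrite distrC; exact: Hy.
Qed.

Lemma mem_lattice_seq N a : (a \in lattice_seq P N) <-> lattice_points P N a.
Proof.
have [C HC] := lattice_card P; have [fin _] := HC N.
by rewrite /lattice_seq in_fset_set// inE.
Qed.

Definition mass N z a : R := section_normsq h0 N a z / Qnorm h0 N a.

Definition partition_fun h N z : R :=
  \sum_(a <- lattice_seq P N) mass N z a * expR (- N%:R * h (N%:R^-1 *: toR a)).

Lemma Qnorm_gt0 N a : (0 < N)%N -> lattice_points P N a -> 0 < Qnorm h0 N a.
Proof.
move=> N0 La; have [K1 [K2 [K10 K20 H]]] := Qnorm_bounds h0 (@ltr01 R).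
have /andP[h _] := H N a N0 La; apply: lt_le_trans h.
by rewrite mulr_gt0// exprn_gt0// expR_gt0.
Qed.

Lemma mass_ge0 N z a : (0 < N)%N -> lattice_points P N a -> 0 <= mass N z a.
Proof.
move=> N0 La; rewrite /mass section_normsqE// divr_ge0//.
  by rewrite exprn_ge0// sec_ge0.
exact/ltW/Qnorm_gt0.
Qed.

Lemma partition_term h N z a : (0 < N)%N -> lattice_points P N a ->
  mass N z a * expR (- N%:R * h (N%:R^-1 *: toR a)) =
  (sec h0 z (N%:R^-1 *: toR a) * expR (- h (N%:R^-1 *: toR a))) ^+ N / Qnorm h0 N a.
Proof.
move=> N0 La; rewrite /mass section_normsqE// mulrAC mulNr -mulrN.
by rewrite expRM_natl -exprMn.
Qed.

(* In terms of [sec], [s] is [- inf_x (h x + rate z x)]. *)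
Definition laplace_value z h (s : R) :=
  (forall x, polytope P x -> sec h0 z x * expR (- h x) <= expR (s + pot x)) /\
  forall e, 0 < e -> exists2 x, polytope P x &
    expR (s - e + pot x) <= sec h0 z x * expR (- h x).

(** One [e] comes from the lower bound for [Qnorm], the other from the number of lattice points. [K]
    is chosen before [z], [h] and [s]. *)
Lemma partition_upper e : 0 < e -> exists2 K, 0 < K & forall N z h s,
  (0 < N)%N -> laplace_value z h s ->
  partition_fun h N z <= K * expR (N%:R * (s + 2 * e)).
Proof.
move=> e0; have [K1 [K2 [K10 _ HQ]]] := Qnorm_bounds h0 e0.
have [K K0 HK] := lattice_count P e0.
exists (K * K1^-1); first by rewrite mulr_gt0// invr_gt0.
move=> N z h s N0 [U _].
apply: (@le_trans _ _ (\sum_(a <- lattice_seq P N) K1^-1 * expR (N%:R * (s + e)))).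
  rewrite /partition_fun [leLHS]big_seq [leRHS]big_seq; apply: ler_sum => a /mem_lattice_seq La.
  have Pa := lattice_polytope N0 La.
  rewrite partition_term//; set y := N%:R^-1 *: toR a in Pa *.
  have /andP[q1 _] := HQ N a N0 La; rewrite -/y in q1.
  have Q0 := Qnorm_gt0 N0 La.
  rewrite ler_pdivrMr//.
  have -> : K1^-1 * expR (N%:R * (s + e)) * Qnorm h0 N a =
     expR (s + e) ^+ N * (K1^-1 * Qnorm h0 N a).
    by rewrite expRM_natl mulrAC mulrC mulrA.
  apply: (@le_trans _ _ (expR (s + e) ^+ N * expR (pot y - e) ^+ N)).
    rewrite -exprMn -expRD; apply: lerXn2r.
    - by rewrite nnegrE mulr_ge0 ?sec_ge0 ?expR_ge0.
    - by rewrite nnegrE expR_ge0.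
    - by apply: (le_trans (U _ Pa)); rewrite addrACA subrr addr0.
  by rewrite ler_wpM2l ?exprn_ge0 ?expR_ge0// mulrC ler_pdivlMr// mulrC.
rewrite big_const_seq count_predT iter_addr_0 -[leLHS]mulr_natl.
have -> : K * K1^-1 * expR (N%:R * (s + 2 * e)) =
    K * expR (N%:R * e) * (K1^-1 * expR (N%:R * (s + e))).
  rewrite mulrACA -expRD -mulrDr; congr (_ * expR (_ * _)).
  by ring.
by rewrite ler_wpM2r// mulr_ge0 ?expR_ge0// invr_ge0 ltW.
Qed.

(** A single term suffices: the rounding of a nearly optimal [x]. The three [e] pay for
    near-optimality and for the oscillations of [h] and of [pot] between [x] and its rounding. *)
Lemma partition_lower e h : 0 < e -> local_modulus h ->
  exists2 K, 0 < K & exists N0, forall N z s,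
  (0 < N)%N -> (N0 <= N)%N -> laplace_value z h s ->
  K * expR (N%:R * (s - 3 * e)) <= partition_fun h N z.
Proof.
move=> e0 hm; have [K1 [K2 [_ K20 HQ]]] := Qnorm_bounds h0 e0.
have [d1 d10 Hh] := polytope_unif hm e0.
have [d2 d20 Hp] := polytope_unif pot_modulus e0.
have [c c0 HR] := rounding h0.
pose d := Num.min d1 d2; have d0 : 0 < d by rewrite lt_min d10.
exists K2^-1; first by rewrite invr_gt0.
(* From this rank on, the rounding error [c / N] is below both moduli of continuity. *)
exists (Num.truncn (c / d)).+1 => N z s N0 NN [_ L].
have NR : 0 < N%:R :> R by rewrite ltr0n.
have cN : c / N%:R < d.
  rewrite ltr_pdivrMr// mulrC -ltr_pdivrMr//.
  by apply: (lt_le_trans (truncnS_gt _)); rewrite ler_nat.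
have [x Px Lx] := L e e0.
have [a La [ax sa]] := HR N z x N0 Px.
have Pa := lattice_polytope N0 La.
have lt1 := le_lt_trans ax cN.
have mem_a : a \in lattice_seq P N by apply/mem_lattice_seq.
rewrite /partition_fun (bigD1_seq a)//=; last exact: finmap.fset_uniq.
apply: (@le_trans _ _ (mass N z a * expR (- N%:R * h (N%:R^-1 *: toR a)))); last first.
  rewrite lerDl big_seq_cond; apply: sumr_ge0 => b /andP[/mem_lattice_seq Lb _].
  by rewrite mulr_ge0 ?expR_ge0// mass_ge0.
rewrite partition_term//; set y := N%:R^-1 *: toR a in Pa ax sa lt1 *.
have /andP[_ q2] := HQ N a N0 La; rewrite -/y in q2.
have Q0 := Qnorm_gt0 N0 La.
rewrite ler_pdivlMr//.
have hy : `|h y - h x| <= e by apply: Hh => //; apply: (lt_le_trans lt1); rewrite ge_min lexx.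
have py : `|pot y - pot x| <= e by apply: Hp => //; apply: (lt_le_trans lt1); rewrite ge_min lexx orbT.
apply: (@le_trans _ _ (expR (s - 3 * e) ^+ N * expR (pot y) ^+ N)).
  have -> : K2^-1 * expR (N%:R * (s - 3 * e)) * Qnorm h0 N a =
     expR (s - 3 * e) ^+ N * (K2^-1 * Qnorm h0 N a).
    by rewrite expRM_natl mulrAC mulrC mulrA.
  rewrite ler_wpM2l ?exprn_ge0 ?expR_ge0//.
  by rewrite mulrC ler_pdivrMr// mulrC.
rewrite -exprMn -expRD; apply: lerXn2r.
- by rewrite nnegrE expR_ge0.
- by rewrite nnegrE mulr_ge0 ?sec_ge0 ?expR_ge0.
have h1 : expR (s - 3 * e + pot y) <= expR (s - e + pot x) * expR (- e).
  rewrite -expRD ler_expR.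
  by move: py; rewrite ler_norml => /andP[_]; move: (pot y) (pot x) => A B; lra.
apply: (le_trans h1).
apply: (@le_trans _ _ (sec h0 z x * expR (- h x) * expR (- e))).
  by rewrite ler_wpM2r ?expR_ge0.
rewrite -mulrA -expRD; apply: ler_pM; rewrite ?sec_ge0 ?expR_ge0//.
by rewrite ler_expR; move: hy; rewrite ler_norml => /andP[_]; move: (h y) (h x) => A B; lra.
Qed.

End Partition.

Lemma partition_arith (R : realType) (e c1 c2 s l n : R) : 0 < e -> 0 < n ->
  `|c1| + `|c2| <= e * n ->
  c1 + n * (s - 3 * e) <= l -> l <= c2 + n * (s + 2 * e) ->
  `|l - n * s| <= n * (4 * e).
Proof.
move=> e0 n0 H h1 h2.
have a1 := ler_norm c2; have a2 := ler_norm (- c1); rewrite normrN in a2.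
have a3 := normr_ge0 c1; have a4 := normr_ge0 c2.
rewrite ler_norml; apply/andP; split; nra.
Qed.

(** * Passage to logarithms and existence of the measures *)

Section Laplace.
Variables (R : realType) (m : nat) (P : delzant R m) (h0 : metric P).
Local Notation toR := (toR R).
Local Notation pot := (pot h0).
Implicit Types (x y : 'rV[R]_m) (z : toric P) (h : 'rV[R]_m -> R).

Lemma partition_ln e h : 0 < e -> local_modulus P h ->
  exists N0, forall N z s, (0 < N)%N -> (N0 <= N)%N -> laplace_value h0 z h s ->
  0 < partition_fun h0 h N z /\
  `|ln (partition_fun h0 h N z) - N%:R * s| <= N%:R * e.
Proof.
move=> e0 hm; pose d := e / 4; have d0 : 0 < d by rewrite divr_gt0.
have [K1 K10 H1] := partition_upper h0 d0.
have [K2 K20 [N1 H2]] := partition_lower h0 d0 hm.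
pose c := `|ln K2| + `|ln K1|.
exists (maxn N1 (Num.truncn (c / d)).+1) => N z s N0; rewrite geq_max => /andP[NN1 NN2] L.
have u := H1 N z h s N0 L; have l := H2 N z s N0 NN1 L.
have NR : 0 < N%:R :> R by rewrite ltr0n.
have pos : 0 < partition_fun h0 h N z by apply: lt_le_trans l; rewrite mulr_gt0 ?expR_gt0.
split=> //; have -> : e = 4 * d by rewrite /d mulrC divfK.
apply: (@partition_arith _ d (ln K2) (ln K1)) => //.
- rewrite -/c mulrC -ler_pdivrMr// ltW//.
  by apply: (lt_le_trans (truncnS_gt _)); rewrite ler_nat.
- rewrite -[X in _ + X <= _]expRK -lnM ?posrE ?expR_gt0//.
  by rewrite ler_ln ?posrE ?mulr_gt0 ?expR_gt0.
- rewrite -[X in _ <= _ + X]expRK -lnM ?posrE ?expR_gt0//.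
  by rewrite ler_ln ?posrE ?mulr_gt0 ?expR_gt0.
Qed.

Variables (mu0 : toric P -> 'rV[R]_m) (hmu0 : is_moment_map h0 mu0).

(** The normaliser [szego] is the partition sum of [h = 0]; its exponential rate is [0] because the
    rate function vanishes at [mu0 z]. *)
Lemma laplace_value0 z : laplace_value h0 z (fun=> 0) 0.
Proof.
split=> [x Px|e e0].
  by rewrite oppr0 expR0 mulr1 add0r; exact: sec_le_pot.
have [Px sx] := mu_polytope_sec hmu0 z; exists (mu0 z) => //.
by rewrite oppr0 expR0 mulr1 sx ler_expR gerDr sub0r oppr_le0 ltW.
Qed.

(** The infimum is finite: [h] is bounded below on [P], the rate is nonnegative, and [mu0 z] gives
    an upper bound. Points where [sec] vanishes have infinite rate, so they do not approach the
    infimum. *)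
Lemma laplace_valueP z h : {within polytope P, continuous h} -> exists2 s : R,
  laplace_F (polytope P) (rate h0) z h = s%:E & laplace_value h0 z h s.
Proof.
move=> ch; have [M [_ HM]] := compact_bounded (continuous_compact ch (@polytope_compact R m P)).
have hM x : polytope P x -> - (`|M| + 1) <= h x.
  move=> Px; have := HM (`|M| + 1); rewrite ltr_pwDr ?ler_norm// => /(_ isT (h x)).
  by move=> /(_ (ex_intro2 _ _ x Px erefl)) /=; rewrite ler_norml => /andP[].
pose S := [set ((h x)%:E + rate h0 z x)%E | x in polytope P].
have [Pm sm] := mu_polytope_sec hmu0 z.
have ub : (ereal_inf S <= (h (mu0 z))%:E)%E.
  by apply: ereal_inf_lbound; exists (mu0 z) => //; rewrite (rate_mu0 hmu0) adde0.
have lb : ((- (`|M| + 1))%:E <= ereal_inf S)%E.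
  apply: le_ereal_inf_tmp => _ [x Px <-].
  rewrite -[leLHS]adde0; apply: leeD; first by rewrite lee_fin hM.
  exact: rate_ge0.
have fin : ereal_inf S \is a fin_num.
  rewrite fin_numE; apply/andP; split.
    by rewrite gt_eqF//; apply: lt_le_trans lb; exact: ltNyr.
  by rewrite lt_eqF//; apply: le_lt_trans ub _; exact: ltry.
have SE : ereal_inf S = (fine (ereal_inf S))%:E by rewrite fineK.
pose i := fine (ereal_inf S).
exists (- i); first by rewrite /laplace_F -/S SE EFinN.
split=> [x Px|e e0].
  have [->|sx] := eqVneq (sec h0 z x) 0; first by rewrite mul0r expR_ge0.
  have : ((fine (ereal_inf S))%:E <= (h x)%:E + rate h0 z x)%E.
    by rewrite -SE; apply: ereal_inf_lbound; exists x.
  rewrite rateE// -EFinD lee_fin -/i => H.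
  have sE : sec h0 z x = expR (ln (sec h0 z x)) by rewrite lnK// posrE sec_gt0.
  rewrite [X in X * _]sE -expRD ler_expR.
  by move: H; move: (ln _) (pot x) (h x) => A B D; clear; lra.
have [_ [x Px <-] ] := lb_ereal_inf_adherent e0 fin.
rewrite SE -EFinD -/i; have [sx|sx] := eqVneq (sec h0 z x) 0.
  by rewrite /rate sx eqxx.
rewrite rateE// -EFinD lte_fin => H.
exists x => //.
have sE : sec h0 z x = expR (ln (sec h0 z x)) by rewrite lnK// posrE sec_gt0.
rewrite [X in _ <= X * _]sE -expRD ler_expR.
by move: H; move: (ln _) (pot x) (h x) => A B D; clear; lra.
Qed.

Lemma szegoE N z : szego h0 N z = partition_fun h0 (fun=> 0) N z.
Proof.
have [B HB] := lattice_card P; have [fin _] := HB N.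
rewrite /szego fsbig_finite//; apply: eq_bigr => a _.
by rewrite mulr0 expR0 mulr1.
Qed.

Lemma partition_gt0 N z : (0 < N)%N -> 0 < partition_fun h0 (fun=> 0) N z.
Proof.
move=> N0.
have [c _ HR] := rounding h0.
have [Pm sm] := mu_polytope_sec hmu0 z.
have [a La [_ sa]] := HR N z _ N0 Pm.
have mem_a : a \in lattice_seq P N by apply/mem_lattice_seq.
rewrite /partition_fun (bigD1_seq a)//=; last exact: finmap.fset_uniq.
apply: ltr_pwDl.
  rewrite mulr_gt0 ?expR_gt0// /mass section_normsqE// divr_gt0 ?Qnorm_gt0//.
  by rewrite exprn_gt0//; apply: lt_le_trans sa; rewrite sm expR_gt0.
rewrite big_seq_cond; apply: sumr_ge0 => b /andP[/mem_lattice_seq Lb _].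
by rewrite mulr_ge0 ?expR_ge0// mass_ge0.
Qed.

Lemma mu_exists N z : (0 < N)%N -> exists Q : probability (borel_rV R m) R,
  is_mu h0 N z Q /\ forall h, {within polytope P, continuous h} ->
  (\int[Q]_(x in polytope P) (expR (- N%:R * h x))%:E =
    (partition_fun h0 h N z / partition_fun h0 (fun=> 0) N z)%:E)%E.
Proof.
move=> N0; pose s := lattice_seq P N; pose Z := partition_fun h0 (fun=> 0) N z.
have Z0 : 0 < Z by exact: partition_gt0.
(* [nth] returns [0] past the end, and [0] is a lattice point of [N P]; so the facts below hold for
   every index [k]. *)
have L0 : lattice_points P N 0.
  by exists 0; [exact: polytope_0|rewrite toR0 scaler0].
have Ls k : lattice_points P N (nth 0 s k).
  have [ks|ks] := ltnP k (size s); last by rewrite nth_default.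
  by apply/mem_lattice_seq; exact: mem_nth.
have w0 k : 0 <= mass h0 N z (nth 0 s k) / Z by rewrite divr_ge0 ?mass_ge0// ltW.
pose w k : {nonneg R} := NngNum (w0 k).
pose p k : borel_rV R m := N%:R^-1 *: toR (nth 0 s k).
have sumE (f : 'rV[int]_m -> R) : \sum_(k < size s) f (nth 0 s k) = \sum_(a <- s) f a.
  by rewrite (big_nth 0) big_mkord.
have w1 : \sum_(k < size s) (w k)%:num = 1.
  rewrite /w /= (sumE (fun a => mass h0 N z a / Z)) -mulr_suml.
  have -> : \sum_(a <- s) mass h0 N z a = Z.
    by apply: eq_bigr => a _; rewrite mulr0 expR0 mulr1.
  by rewrite divff// gt_eqF.
have [Q [QE QI]] := discrete_probability p w1.
exists Q; split=> [A mA|h ch].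
  have [B HB] := lattice_card P; have [fin _] := HB N.
  rewrite QE// szegoE -/Z fsbig_finite// -/(lattice_seq P N) -/s (big_nth 0) big_mkord.
  rewrite ge0_sume_distrr; last first.
    by move=> k _; rewrite mule_ge0// lee_fin; exact: (mass_ge0 h0 z N0 (Ls k)).
  apply: eq_bigr => k _.
  have -> : ((w k)%:num)%:E = ((Z^-1)%:E * (mass h0 N z (nth 0%R s k))%:E)%E.
    by rewrite /w /= mulrC.
  by rewrite -muleA.
rewrite QI.
- rewrite /w /p /=; congr (_%:E).
  rewrite (sumE (fun a => mass h0 N z a / Z * expR (- N%:R * h (N%:R^-1 *: toR a)))).
  by rewrite [RHS]mulr_suml; apply: eq_bigr => a _; rewrite mulrAC.
- exact: measurable_polytope.
- by move=> k; exact: lattice_polytope.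
- by move=> y _; exact: expR_ge0.
- apply: measurableT_comp; first exact: measurable_expR.
  apply: measurable_funM; first exact: measurable_cst.
  exact: measurable_within.
Qed.

Lemma gap_arith (a b n s e : R) : 0 < n ->
  `|a - n * s| <= n * (e / 2) -> `|b - n * 0| <= n * (e / 2) ->
  `|n^-1 * (a - b) - s| <= e.
Proof.
move=> n0; rewrite mulr0 subr0 => h1 h2.
have -> : n^-1 * (a - b) - s = n^-1 * ((a - n * s) - b).
  by field; rewrite gt_eqF.
rewrite normrM ger0_norm ?invr_ge0 ?(ltW n0)// mulrC ler_pdivrMr//.
apply: (le_trans (ler_normB _ _)).
have -> : e * n = n * (e / 2) + n * (e / 2) by field.
exact: lerD.
Qed.

End Laplace.

Theorem theorem1p3 (R : realType) (m : nat) (P : delzant R m) (h0 : metric P)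
    (mu0 : toric P -> 'rV[R]_m) (hmu0 : is_moment_map h0 mu0)
    (d : nat) (hd : (1 <= d)%N) :
  exists (mu : nat -> toric P -> probability (borel_rV R m) R)
         (I : toric P -> 'rV[R]_m -> \bar R),
    (forall k z, (1 <= k)%N -> is_mu h0 (k * d) z (mu k z)) /\
    [/\ rate_open h0 I, rate_face h0 mu0 I & rate_fixed mu0 I] /\
    (forall z, rate_function (polytope P) (I z) /\ convex_on (polytope P) (I z)) /\
    uniform_laplace (polytope P) mu (fun k => (k * d)%:R) I.
Proof.
have /choice[mu Hmu] : forall kz : nat * toric P, exists Q : probability (borel_rV R m) R,
    (0 < kz.1)%N -> is_mu h0 (kz.1 * d) kz.2 Q /\
    forall h : 'rV[R]_m -> R, {within polytope P, continuous h} ->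
    (\int[Q]_(x in polytope P) (expR (- (kz.1 * d)%:R * h x))%:E =
    (partition_fun h0 h (kz.1 * d) kz.2 / partition_fun h0 (fun=> 0) (kz.1 * d) kz.2)%:E)%E.
  move=> [[|k] z].
    (* Nothing is claimed at [k = 0], so the measure for [N = 1] is taken as a placeholder. *)
    by have [Q _] := mu_exists hmu0 z (ltn0Sn 0); exists Q.
  have N0 : (0 < k.+1 * d)%N by rewrite muln_gt0.
  by have [Q HQ] := mu_exists hmu0 z N0; exists Q.
pose mu' k z := mu (k, z).
(* One two-sided estimate, uniform in [z], serves both inequalities: [e / 2] is spent on the
   partition sum of [h] and [e / 2] on the normaliser. *)
have gap (h : 'rV[R]_m -> R) : {within polytope P, continuous h} -> forall e : R, 0 < e ->
    exists N, forall k z, (N <= k)%N -> exists2 g : R,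
      laplace_gap (polytope P) mu' (fun k => (k * d)%:R) (rate h0) h k z = g%:E & `|g| <= e.
  move=> ch e e0; have e2 : 0 < e / 2 by rewrite divr_gt0.
  have [N1 H1] := partition_ln h0 e2 (within_modulus ch).
  have [N2 H2] := partition_ln h0 e2 (within_modulus (@cst_continuous _ _ (0 : R))).
  exists (maxn 1 (maxn N1 N2)) => k z; rewrite !geq_max => /and3P[k0 kN1 kN2].
  have N0 : (0 < k * d)%N by rewrite muln_gt0 k0.
  have kd : (k <= k * d)%N by rewrite leq_pmulr.
  have [s sE sL] := laplace_valueP hmu0 z ch.
  have [p1 l1] := H1 _ z s N0 (leq_trans kN1 kd) sL.
  have [p2 l2] := H2 _ z 0 N0 (leq_trans kN2 kd) (laplace_value0 hmu0 z).
  have [_ /(_ h ch) IE] := Hmu (k, z) k0.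
  exists ((k * d)%:R^-1 * (ln (partition_fun h0 h (k * d) z) -
      ln (partition_fun h0 (fun=> 0) (k * d) z)) - s).
    rewrite /laplace_gap sE /mu' IE lne_EFin ?divr_gt0//.
    by rewrite ln_div// ?posrE.
  by apply: gap_arith => //; rewrite ltr0n.
exists mu', (rate h0); split; first by move=> k z k0; have [] := Hmu (k, z) k0.
split; first by split; [exact: rate_openP|exact: rate_faceP|exact: rate_fixedP].
split; first by move=> z; split; [exact: rate_functionP|exact: rate_convex].
split.
(* For [c < 0] the union is empty. For [c >= 0] it is all of [P], since by [sec_attained] every [x]
   has rate [0] at some [z]. *)
- move=> c; have [c0|c0] := leP 0 c; last first.
    rewrite (_ : [set _ | _] = set0); first exact: compact0.
    apply/seteqP; split=> // x [_ [z /andP[h1 h2]]].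
    by have := le_trans h1 h2; rewrite lee_fin leNgt c0.
  rewrite (_ : [set _ | _] = polytope P); first exact: polytope_compact.
  apply/seteqP; split=> [x []//|x Px]; split => //.
  have [z zx] := sec_attained h0 Px; exists z.
  rewrite rateE//; last by rewrite zx; exact: lt0r_neq0 (expR_gt0 _).
  by rewrite zx expRK subrr lexx lee_fin.
- move=> h ch; apply: limn_esup_le0 => e e0; have [N HN] := gap h ch e e0.
  exists N => k Nk; apply: ge_ereal_sup => _ [z _ <-].
  have [g -> ge] := HN k z Nk; rewrite lee_fin; exact: le_trans (ler_norm _) ge.
- move=> h ch; apply: limn_einf_ge0 => e e0; have [N HN] := gap h ch e e0.
  exists N => k Nk; apply: le_ereal_inf_tmp => _ [z _ <-].
  by have [g -> ] := HN k z Nk; rewrite lee_fin ler_norml => /andP[].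
Qed.
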